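(* Let $\omega_*$ be a local (or global) maximizer of $\mu(\cdot)$ over $\mathbb{R}$, and let $\gamma_*=\arg\min_{\gamma\in\Omega}\sigma_2(\omega_*,\gamma)$. Assume $\omega_*\neq 0$, $\gamma_*\neq 1$, that the singular value $\sigma_2(\omega_*,\gamma_* )$ of $T(\omega_*,\gamma_* )$ is simple, and that $\mu''(\omega_* )\neq 0$. Let $\beta>0$ be given. Then there exist a constant $\eta>0$ and a constant $c>0$ such that the following holds. If $\omega_{k-1},\omega_k,\omega_{k+1}$ are three consecutive iterates generated by the Algorithm with $|\omega_i-\omega_*|<\eta$ for $i=k-1,k,k+1$ and $\omega_k\neq\omega_*$, and if the subspace $\mathcal{V}_k$ (with orthonormal basis matrix $V_k$) satisfies the nondegeneracy condition $$\sigma_{\min}\big(\mathrm{i}\omega_* I-V_k^*AV_k\big)\geq\beta,$$ then $$\frac{|\omega_{k+1}-\omega_*|}{|\omega_k-\omega_*|^2}\leq c .$$ The constants may depend only on the parameters of the original problem and on $\beta$, but not on the subspace $\mathcal{V}_k$ or the orthonormal basis $V_k$.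
   Context: Let $A\in\mathbb{R}^{n\times n}$ have all its eigenvalues in the open left half-plane, and let $B\in\mathbb{R}^{n\times m}$, $C\in\mathbb{R}^{p\times n}$. Singular values $\sigma_1\ge\sigma_2\ge\dots$ of a matrix are ordered non-increasingly, $\sigma_{\min}$ denotes the smallest one, $\mathrm{Re}$ and $\mathrm{Im}$ of a matrix are taken entrywise, and $\mathrm{i}$ is the imaginary unit. A singular value is simple if it has multiplicity one. Fix a small number $\Gamma\in(0,1)$ and set $\Omega=[\Gamma,1]$. Put $H(s)=C(sI-A)^{-1}B$ and, for $\omega\in\mathbb{R}$, $\gamma>0$, $$T(\omega,\gamma)=\begin{bmatrix}\mathrm{Re}\,H(\mathrm{i}\omega)&-\gamma\,\mathrm{Im}\,H(\mathrm{i}\omega)\\ \tfrac1\gamma\,\mathrm{Im}\,H(\mathrm{i}\omega)&\mathrm{Re}\,H(\mathrm{i}\omega)\end{bmatrix},$$ $$\sigma_i(\omega,\gamma)=\sigma_i(T(\omega,\gamma)),\qquad \mu(\omega)=\min_{\gamma\in\Omega}\sigma_2(\omega,\gamma).$$ For a subspace $\mathcal{V}\subset\mathbb{C}^n$ and a matrix $V$ whose columns form an orthonormal basis of $\mathcal{V}$, put $A^V=V^*AV$, $B^V=V^*B$, $C^V=CV$ and $H^{\mathcal{V}}(s)=C^V(sI-A^V)^{-1}B^V$. The quantities $T^{\mathcal{V}}(\omega,\gamma)$, $\sigma_i^{\mathcal{V}}(\omega,\gamma)$ and $\mu^{\mathcal{V}}(\omega)$ are defined exactly as $T,\sigma_i,\mu$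 with $H$ replaced by $H^{\mathcal{V}}$. The Algorithm: choose $\omega_1\in\mathbb{R}$. Let $V_1$ be a matrix whose columns form an orthonormal basis of the column space of $[(\mathrm{i}\omega_1I-A)^{-1}B\ \ (\mathrm{i}\omega_1I-A)^{-2}B\ \ (\mathrm{i}\omega_1I-A)^{-3}B]$, and let $\mathcal{V}_1$ be this column space. For $k=1,2,\dots$: let $\omega_{k+1}$ be a global maximizer of $\mu^{\mathcal{V}_k}(\omega)$ over $\omega\in\mathbb{R}$ (assumed to exist); let $V_{k+1}$ be a matrix whose columns form an orthonormal basis of the column space of $[V_k\ \ \widetilde V_{k+1}]$, where $\widetilde V_{k+1}=[(\mathrm{i}\omega_{k+1}I-A)^{-1}B\ \ (\mathrm{i}\omega_{k+1}I-A)^{-2}B\ \ (\mathrm{i}\omega_{k+1}I-A)^{-3}B]$; and let $\mathcal{V}_{k+1}$ be the column space of $V_{k+1}$. It is assumed that the iterates and the reduced functions are well defined. *)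

(* Defs.v *)
From mathcomp Require Import all_boot all_order all_algebra.
From mathcomp Require Import sesquilinear spectral complex.
From mathcomp Require Import boolp classical_sets reals topology normedtype derive.

Set Implicit Arguments.
Unset Strict Implicit.
Unset Printing Implicit Defensive.

Import Order.TTheory GRing.Theory Num.Theory.
Import numFieldNormedType.Exports.

Local Open Scope ring_scope.
Local Open Scope complex_scope.
Local Open Scope sesquilinear_scope.
Local Open Scope classical_set_scope.

Definition cplxmx (R : realType) (q r : nat) (M : 'M[R]_(q, r)) :
  'M[R[i]]_(q, r) := map_mx (real_complex R) M.

(* The nonincreasing list of the minn q r singular values of M, with
   multiplicity: square roots of the eigenvalues of the Hermitian matrix M^* M.
   When q < r, the r - q values dropped by [take] are zeros. *)
Definition singvals (R : realType) (q r : nat) (M : 'M[R[i]]_(q, r)) : seq R :=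
  take (minn q r)
    (sort >=%O [seq Num.sqrt (complex.Re (spectral_diag (M ^t* *m M) 0 j))
               | j <- enum 'I_r]).

(* Indexed from 1; the default value 0 is only taken out of range. *)
Definition singval (R : realType) (q r : nat) (M : 'M[R[i]]_(q, r)) (i : nat) :
  R := nth 0 (singvals M) i.-1.

Definition singval_min (R : realType) (q r : nat) (M : 'M[R[i]]_(q, r)) : R :=
  singval M (minn q r).

Definition simple_singval (R : realType) (q r : nat) (M : 'M[R[i]]_(q, r))
    (s : R) : Prop := count_mem s (singvals M) = 1%N.

Definition stable (R : realType) (n : nat) (A : 'M[R]_n) : Prop :=
  forall z : R[i], eigenvalue (cplxmx A) z -> complex.Re z < 0.

Definition argmin (R : realType) (D : set R) (f : R -> R) : set R :=
  [set x | D x /\ forall y, D y -> f x <= f y].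

Definition Omega (R : realType) (Gam : R) : set R := [set g | Gam <= g <= 1].

(* [ssT], [ssSigma] and [ssMu] are stated for complex state-space data, since
   the reduced systems are complex even though the original one is real. *)

Definition transfer (R : realType) (n m p : nat) (A : 'M[R[i]]_n)
    (B : 'M[R[i]]_(n, m)) (C : 'M[R[i]]_(p, n)) (s : R[i]) : 'M[R[i]]_(p, m) :=
  C *m invmx (s%:M - A) *m B.

Definition ssT (R : realType) (n m p : nat) (A : 'M[R[i]]_n)
    (B : 'M[R[i]]_(n, m)) (C : 'M[R[i]]_(p, n)) (w g : R) :
    'M[R]_(p + p, m + m) :=
  let H := transfer A B C (0 +i* w) in
  let ReH := map_mx (@complex.Re R) H in
  let ImH := map_mx (@complex.Im R) H in
  block_mx ReH (- (g *: ImH)) (g^-1 *: ImH) ReH.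

Definition ssSigma (R : realType) (n m p : nat) (A : 'M[R[i]]_n)
    (B : 'M[R[i]]_(n, m)) (C : 'M[R[i]]_(p, n)) (i : nat) (w g : R) : R :=
  singval (cplxmx (ssT A B C w g)) i.

(* [inf] is a minimum here: g |-> ssSigma A B C 2 w g is continuous on the
   compact interval Omega Gam when 0 < Gam <= 1. *)
Definition ssMu (R : realType) (n m p : nat) (A : 'M[R[i]]_n)
    (B : 'M[R[i]]_(n, m)) (C : 'M[R[i]]_(p, n)) (Gam w : R) : R :=
  inf [set ssSigma A B C 2 w g | g in Omega Gam].

Definition Tmx (R : realType) (n m p : nat) (A : 'M[R]_n) (B : 'M[R]_(n, m))
    (C : 'M[R]_(p, n)) : R -> R -> 'M[R]_(p + p, m + m) :=
  ssT (cplxmx A) (cplxmx B) (cplxmx C).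

Definition sigma (R : realType) (n m p : nat) (A : 'M[R]_n) (B : 'M[R]_(n, m))
    (C : 'M[R]_(p, n)) : nat -> R -> R -> R :=
  ssSigma (cplxmx A) (cplxmx B) (cplxmx C).

Definition mu (R : realType) (n m p : nat) (A : 'M[R]_n) (B : 'M[R]_(n, m))
    (C : 'M[R]_(p, n)) : R -> R -> R :=
  ssMu (cplxmx A) (cplxmx B) (cplxmx C).

Definition redA (R : realType) (n d : nat) (A : 'M[R]_n)
    (V : 'M[R[i]]_(n, d)) : 'M[R[i]]_d := V ^t* *m cplxmx A *m V.

Definition mu_red (R : realType) (n m p d : nat) (A : 'M[R]_n)
    (B : 'M[R]_(n, m)) (C : 'M[R]_(p, n)) (V : 'M[R[i]]_(n, d)) : R -> R -> R :=
  ssMu (redA A V) (V ^t* *m cplxmx B) (cplxmx C *m V).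

(* The columns of V form an orthonormal basis of the column space of W. *)
Definition orthobasis (R : realType) (n d k : nat) (V : 'M[R[i]]_(n, d))
    (W : 'M[R[i]]_(n, k)) : Prop :=
  V ^t* *m V = 1%:M /\ (V^T == W^T)%MS.

Definition krylov3 (R : realType) (n m : nat) (A : 'M[R]_n)
    (B : 'M[R]_(n, m)) (w : R) : 'M[R[i]]_(n, m + (m + m)) :=
  let S := invmx ((0 +i* w)%:M - cplxmx A) in
  let b := cplxmx B in
  row_mx (S *m b) (row_mx (S *m (S *m b)) (S *m (S *m (S *m b)))).

(* The first k steps of the algorithm, with w_1, ..., w_(k+1) and V_1, ..., V_k
   in w and V (index 0 is unused). Since V_j is not unique and its number of
   columns d j is not known beforehand, a run is a relation; w 1 is arbitrary.
   The third clause states that the reduced functions are well defined: each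
   reduced transfer function is defined on the whole imaginary axis. *)
Definition algorithm_run (R : realType) (n m p : nat) (A : 'M[R]_n)
    (B : 'M[R]_(n, m)) (C : 'M[R]_(p, n)) (Gam : R) (k : nat)
    (w : nat -> R) (d : nat -> nat) (V : forall j, 'M[R[i]]_(n, d j)) : Prop :=
  [/\ orthobasis (V 1%N) (krylov3 A B (w 1%N)),
      forall j, (1 <= j < k)%N ->
        orthobasis (V j.+1) (row_mx (V j) (krylov3 A B (w j.+1))),
      forall j, (1 <= j <= k)%N -> forall t : R,
        (0 +i* t)%:M - redA A (V j) \in unitmx
    & forall j, (1 <= j <= k)%N -> forall t : R,
        mu_red A B C (V j) Gam t <= mu_red A B C (V j) Gam (w j.+1)].

(* Main.v *)
(* Write f(N, g) for the square of the second singular value of the weighted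
   matrix built from the realification N of H(i w), h and v for the realified full
   and reduced transfer functions, and d = |w_(k+1) - w_k|.

   1. Hermite interpolation at w_k, with the resolvents bounded uniformly through
      beta, gives |v - h| <= K |w - w_k|^3 at w and
      |(v - h)(w') - (v - h)(w)| <= K |w' - w| (|w - w_k|^2 + |w' - w|).
   2. Near a simple positive singular value f satisfies the difference estimates of
      a C^2 function; they are obtained from u.(S - S')u' = (l - l') u.u' for
      eigenpairs (l, u), (l', u') of the Gram matrices S, S', without derivatives.
   3. If g1 minimizes f(N, .) then f(N, g) >= f(N, g1) + c (g - g1)^2: H is complex,
      so N commutes with multiplication by i, which sends null vectors of the pencil
      g^2 F + G (F, G real symmetric) at g1^2 to null vectors at g1^-2. Since g1 < 1
      these are different points, and this produces a plane on which the Gram matrix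
      exceeds f(N, g1) by the required amount.
   4. As w_(k+1) maximizes the reduced function, 1-3 yield
      mu(w_(k+1) + s)^2 - mu(w_(k+1))^2 <= K (d^2 + |s|) |s|, so that
      |mu'(w_(k+1))| <= K' d^2, while mu''(ws) <> 0 gives
      |mu'(w_(k+1))| >= c |w_(k+1) - ws|. *)

Require Import Defs.
From mathcomp Require Import all_boot all_order all_algebra.
From mathcomp Require Import sesquilinear spectral complex.
From mathcomp Require Import boolp classical_sets reals topology normedtype derive.
From mathcomp Require Import ring lra.

Set Implicit Arguments.
Unset Strict Implicit.
Unset Printing Implicit Defensive.

Import Order.TTheory GRing.Theory Num.Theory.
Import numFieldNormedType.Exports.

Local Open Scope ring_scope.
Local Open Scope complex_scope.
Local Open Scope sesquilinear_scope.
Local Open Scope classical_set_scope.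

(** * Inner product and entrywise norm *)

(** The argument runs on increments because derivatives are not at hand: [mu] is an infimum over the
    weight, its minimizer may be the endpoint [Gam], and of a reduced function only a maximizer is
    given. Upper bounds on increments suffice, and an infimum supplies them, since any weight may be
    inserted on the larger side. The price is that the weight optimal for the full function at
    w_(k+1) differs from the one optimal for the reduced function at w_(k+1) + s. Quadratic growth
    in the weight bounds their distance by O(d^2 + |s|), and this distance enters only multiplied by
    |s|. Uniformity in the subspace rests on carrying the reduced resolvent back to an n by n
    matrix: it obeys the same resolvent identity as the full one, so the bound at the single point
    [ws] given by [beta] spreads to a neighborhood of fixed size. Squares appear because the square
    of a singular value is an eigenvalue of a Gram matrix. Returning to [mu] requires a positive
    value at [ws]; it follows from the nonzero second derivative, since a nonnegative function is
    flat around a maximum equal to 0. *)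

Definition dot (R : realType) n (u v : 'cV[R]_n) : R := (u^T *m v) 0 0.

Section Dot.
Context {R : realType}.
Implicit Types n q r : nat.

Lemma dot_sum n (u v : 'cV[R]_n) : dot u v = \sum_i u i 0 * v i 0.
Proof. by rewrite /dot mxE; apply: eq_bigr => i _; rewrite mxE. Qed.

Lemma dotC n (u v : 'cV[R]_n) : dot u v = dot v u.
Proof. by rewrite !dot_sum; apply: eq_bigr => i _; rewrite mulrC. Qed.

Lemma dotDl n (u v w : 'cV[R]_n) : dot (u + v) w = dot u w + dot v w.
Proof. by rewrite /dot linearD mulmxDl mxE. Qed.

Lemma dotDr n (u v w : 'cV[R]_n) : dot w (u + v) = dot w u + dot w v.
Proof. by rewrite /dot mulmxDr mxE. Qed.

Lemma dotNl n (u w : 'cV[R]_n) : dot (- u) w = - dot u w.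
Proof. by rewrite /dot linearN mulNmx mxE. Qed.

Lemma dotNr n (u w : 'cV[R]_n) : dot w (- u) = - dot w u.
Proof. by rewrite /dot mulmxN mxE. Qed.

Lemma dotZl n k (u w : 'cV[R]_n) : dot (k *: u) w = k * dot u w.
Proof. by rewrite /dot linearZ /= -scalemxAl mxE. Qed.

Lemma dotZr n k (u w : 'cV[R]_n) : dot w (k *: u) = k * dot w u.
Proof. by rewrite /dot -scalemxAr mxE. Qed.

Lemma dot0l n (w : 'cV[R]_n) : dot 0 w = 0.
Proof. by rewrite /dot trmx0 mul0mx mxE. Qed.

Lemma dot0r n (w : 'cV[R]_n) : dot w 0 = 0.
Proof. by rewrite /dot mulmx0 mxE. Qed.

Definition dotE := (dotDl, dotDr, dotNl, dotNr, dotZl, dotZr, dot0l, dot0r).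

Lemma dot_mulmx q r (M : 'M[R]_(q, r)) u v : dot u (M *m v) = dot (M^T *m u) v.
Proof. by rewrite /dot trmx_mul trmxK mulmxA. Qed.

Lemma dot_ge0 n (u : 'cV[R]_n) : 0 <= dot u u.
Proof. by rewrite dot_sum sumr_ge0 // => i _; rewrite -expr2 sqr_ge0. Qed.

Lemma dot_eq0 n (u : 'cV[R]_n) : (dot u u == 0) = (u == 0).
Proof.
apply/idP/eqP => [|->]; last by rewrite dot0l.
rewrite dot_sum psumr_eq0 => [/allP u0|i _]; last by rewrite -expr2 sqr_ge0.
apply/matrixP => i j; rewrite (ord1 j) mxE; apply/eqP.
by have := u0 i (mem_index_enum _); rewrite /= mulf_eq0 orbb.
Qed.

Lemma dot_gt0 n (u : 'cV[R]_n) : (0 < dot u u) = (u != 0).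
Proof. by rewrite lt_def dot_eq0 dot_ge0 andbT. Qed.

Lemma dot_orthogonal n (U : 'M[R]_n) u v :
  U^T *m U = 1%:M -> dot (U *m u) (U *m v) = dot u v.
Proof. by move=> UU; rewrite dot_mulmx mulmxA UU mul1mx. Qed.

End Dot.

(** The entrywise l1 norm is submultiplicative, additive over blocks, and unchanged by transposition
    and by left multiplication with [Jmx], so block matrices are estimated without comparing
    norms. *)
Definition nrm (R : realType) q r (M : 'M[R]_(q, r)) : R :=
  \sum_i \sum_j `|M i j|.

Section Nrm.
Context {R : realType}.
Implicit Types n q r : nat.

Lemma nrm_ge0 q r (M : 'M[R]_(q, r)) : 0 <= nrm M.
Proof. by apply: sumr_ge0 => i _; apply: sumr_ge0. Qed.

Lemma nrmD q r (M P : 'M[R]_(q, r)) : nrm (M + P) <= nrm M + nrm P.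
Proof.
rewrite -big_split /=; apply: ler_sum => i _; rewrite -big_split /=.
by apply: ler_sum => j _; rewrite mxE ler_normD.
Qed.

Lemma nrmZ q r k (M : 'M[R]_(q, r)) : nrm (k *: M) = `|k| * nrm M.
Proof.
rewrite mulr_sumr; apply: eq_bigr => i _; rewrite mulr_sumr.
by apply: eq_bigr => j _; rewrite mxE normrM.
Qed.

Lemma nrmN q r (M : 'M[R]_(q, r)) : nrm (- M) = nrm M.
Proof. by rewrite -scaleN1r nrmZ normrN1 mul1r. Qed.

Lemma nrmB q r (M P : 'M[R]_(q, r)) : nrm (M - P) <= nrm M + nrm P.
Proof. by rewrite -(nrmN P); exact: nrmD. Qed.

Lemma nrmBC q r (M P : 'M[R]_(q, r)) : nrm (M - P) = nrm (P - M).
Proof. by rewrite -nrmN opprB. Qed.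

Lemma nrm_tr q r (M : 'M[R]_(q, r)) : nrm M^T = nrm M.
Proof.
rewrite /nrm exchange_big; apply: eq_bigr => i _; apply: eq_bigr => j _.
by rewrite mxE.
Qed.

Lemma nrm0 q r : nrm (0 : 'M[R]_(q, r)) = 0.
Proof. by rewrite -(scale0r 0) nrmZ normr0 mul0r. Qed.

Lemma entry_le_nrm q r (M : 'M[R]_(q, r)) i j : `|M i j| <= nrm M.
Proof.
rewrite /nrm (bigD1 i) //= (bigD1 j) //= -addrA lerDl addr_ge0 //.
  exact: sumr_ge0.
by apply: sumr_ge0 => k _; apply: sumr_ge0.
Qed.

Lemma nrmM q n r (M : 'M[R]_(q, n)) (P : 'M[R]_(n, r)) :
  nrm (M *m P) <= nrm M * nrm P.
Proof.
apply: (@le_trans _ _ (\sum_i \sum_j \sum_k `|M i k| * `|P k j|)).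
  apply: ler_sum => i _; apply: ler_sum => j _; rewrite mxE.
  by apply: (le_trans (ler_norm_sum _ _ _)); apply: ler_sum => k _; rewrite normrM.
rewrite mulr_suml; apply: ler_sum => i _; rewrite exchange_big /= mulr_suml.
apply: ler_sum => k _; rewrite -mulr_sumr ler_wpM2l //.
by rewrite /nrm (bigD1 k) //= lerDl; apply: sumr_ge0 => *; apply: sumr_ge0.
Qed.

Lemma nrm_block q1 q2 r1 r2 (X : 'M[R]_(q1, r1)) (Y : 'M[R]_(q1, r2))
    (Z : 'M[R]_(q2, r1)) (W : 'M[R]_(q2, r2)) :
  nrm (block_mx X Y Z W) = nrm X + nrm Y + nrm Z + nrm W.
Proof.
rewrite /nrm big_split_ord /= -addrA; congr (_ + _).
  rewrite -big_split; apply: eq_bigr => i _; rewrite big_split_ord /=.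
  by congr (_ + _); apply: eq_bigr => j _; rewrite (block_mxEul, block_mxEur).
rewrite -big_split; apply: eq_bigr => i _; rewrite big_split_ord /=.
by congr (_ + _); apply: eq_bigr => j _; rewrite (block_mxEdl, block_mxEdr).
Qed.

Lemma dot_le_nrm n (u v : 'cV[R]_n) : `|dot u v| <= nrm u * nrm v.
Proof. by rewrite -(nrm_tr u); apply: le_trans (entry_le_nrm _ _ _) (nrmM _ _). Qed.

Lemma quad_le_nrm n (M : 'M[R]_n) (v : 'cV[R]_n) :
  `|dot v (M *m v)| <= nrm M * dot v v.
Proof.
have sq_le i : v i 0 ^+ 2 <= dot v v.
  rewrite dot_sum (bigD1 i) //= -expr2 lerDl sumr_ge0 // => j _.
  by rewrite -expr2 sqr_ge0.
rewrite {1}dot_sum; apply: le_trans (ler_norm_sum _ _ _) _.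
rewrite /nrm mulr_suml; apply: ler_sum => i _.
rewrite mxE mulr_sumr; apply: le_trans (ler_norm_sum _ _ _) _.
rewrite mulr_suml; apply: ler_sum => j _.
rewrite mulrCA normrM ler_wpM2l // ler_norml.
have := sq_le i; have := sq_le j.
have := sqr_ge0 (v i 0 + v j 0); have := sqr_ge0 (v i 0 - v j 0).
rewrite !expr2; set a := v i 0; set b := v j 0; set c := dot v v => *.
by apply/andP; split; nra.
Qed.

End Nrm.

(** * Real spectral theorem *)

Section RealSpectral.
Context {R : realType}.

(** The complexification is Hermitian, hence unitarily diagonalizable with a real diagonal, and
    being an eigenvalue descends to the real field. *)
Lemma symmetric_eigenvalue n (S : 'M[R]_n.+1) :
  S^T = S -> exists a : R, eigenvalue S a.
Proof.
move=> St; pose Sc : 'M[R[i]]_n.+1 := map_mx (real_complex R) S.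
have Sc_herm : Sc \is hermsymmx.
  apply: realsym_hermsym.
    by apply/is_hermitianmxP; rewrite expr0 scale1r map_mx_id // /Sc map_trmx St.
  by apply/mxOverP => i j; rewrite mxE complex_real.
have /orthomx_spectralP ScE := hermitian_normalmx Sc_herm.
set P := spectralmx Sc in ScE; set D := spectral_diag Sc in ScE.
have Pu : P \in unitmx by exact: spectral_unit.
have /mxOverP/(_ 0 0)/complex_realP[b Db] := hermitian_spectral_diag_real Sc_herm.
exists b; rewrite -(eigenvalue_map (real_complex R)).
apply/eigenvalueP; exists (row 0 P).
  rewrite -/Sc -row_mul {1}ScE !mulmxA mulmxV // mul1mx row_mul.
  have -> : row 0 (diag_mx D) = b%:C *: delta_mx 0 0.
    apply/rowP => j; rewrite !mxE -Db eqxx eq_sym /=.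
    by case: (j == 0); rewrite ?mulr1 ?mulr0.
  by rewrite -scalemxAl rowE.
apply: contraTneq Pu => P0; apply/negP => Pu'.
have /(congr1 (mulmx^~ (invmx P))) := P0; rewrite rowE mulmxK // mul0mx.
by move/matrixP/(_ 0 0)/eqP; rewrite !mxE !eqxx /= oner_eq0.
Qed.

(** The reflection in the hyperplane orthogonal to [v - e] exchanges [v] and [e] because both have
    length one: this is [w.w = 2 w.v]. *)
Lemma householder n (v : 'cV[R]_n) (i : 'I_n) : dot v v = 1 ->
  exists Q : 'M[R]_n, [/\ Q^T = Q, Q *m Q = 1%:M & Q *m v = delta_mx i 0].
Proof.
move=> v1; set e : 'cV_n := delta_mx i 0.
have e1 : dot e e = 1.
  rewrite dot_sum (bigD1 i) //= !mxE !eqxx mulr1 big1 ?addr0 // => j ji.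
  by rewrite !mxE (negPf ji) mul0r.
have [->|ve] := eqVneq v e.
  by exists 1%:M; rewrite trmx1 !mul1mx.
pose w := v - e; pose c := 2 / dot w w.
have ww : dot w w != 0 by rewrite dot_eq0 subr_eq0.
exists (1%:M - c *: (w *m w^T)).
have wTw (u : 'cV[R]_n) : w^T *m u = (dot w u)%:M by rewrite [LHS]mx11_scalar.
have wwv (u : 'cV[R]_n) : w *m w^T *m u = dot w u *: w.
  by rewrite -mulmxA wTw mul_mx_scalar.
split.
- by rewrite linearB linearZ /= trmx1 trmx_mul trmxK.
- rewrite mulmxBl mul1mx mulmxBr mulmx1 -!scalemxAl -!scalemxAr.
  rewrite !mulmxA wwv -scalemxAl !scalerA.
  have -> : c * (c * dot w w) = c + c by rewrite /c; field.
  by rewrite scalerDl opprB addrK subrK.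
- rewrite mulmxBl mul1mx -scalemxAl wwv scalerA.
  have -> : c * dot w v = 1.
    have : dot w w = 2 * dot w v.
      by rewrite /w !dotE v1 e1 (dotC e v); ring.
    by rewrite /c => E; rewrite mulrAC -E mulfV.
  by rewrite scale1r /w opprB addrCA subrr addr0.
Qed.

(** Deflation: a reflection moves a unit eigenvector to the first basis vector, and symmetry then
    clears the first row together with the first column. The real form is wanted because [singvals]
    comes from a complex diagonalization, whereas the variational arguments use real vectors. *)
Lemma real_spectral n (S : 'M[R]_n) : S^T = S ->
  exists (U : 'M[R]_n) (d : 'rV[R]_n), U^T *m U = 1%:M /\ S = U *m diag_mx d *m U^T.
Proof.
elim: n S => [|n IH] S St.
  by exists 1%:M, 0; split; apply/matrixP => -[].
have [a /eigenvalueP[v0 Sv0 v0N0]] := symmetric_eigenvalue St.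
pose v : 'cV_n.+1 := (Num.sqrt (dot v0^T v0^T))^-1 *: v0^T.
have v0P : 0 < dot v0^T v0^T by rewrite dot_gt0 -(trmx0 _ _ _) (inj_eq trmx_inj).
have v1 : dot v v = 1.
  rewrite /v !dotE mulrA -expr2 exprVn sqr_sqrtr ?ltW // mulVf // gt_eqF //.
have Sv : S *m v = a *: v.
  rewrite /v -scalemxAr -{1}St -trmx_mul Sv0 linearZ /= !scalerA mulrC.
  by [].
have [Q [Qt QQ Qv]] := householder ord0 v1.
have [S1 S1D] : exists S1, S1 = Q *m S *m Q by exists (Q *m S *m Q).
have S1t : S1^T = S1 by rewrite S1D !trmx_mul Qt St mulmxA.
have S1e : S1 *m delta_mx 0 0 = a *: (delta_mx 0 0 : 'cV_n.+1).
  by rewrite -Qv S1D -!mulmxA (mulmxA Q Q) QQ mul1mx Sv -scalemxAr.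
pose S2 : 'M_n := @drsubmx _ 1 n 1 n S1.
have S2t : S2^T = S2 by rewrite /S2 (@trmx_drsub _ 1 n 1 n) S1t.
have [U [d [UU S2E]]] := IH _ S2t.
have S1E : S1 = @block_mx _ 1 n 1 n a%:M 0 0 S2.
  have c0 i : S1 i 0 = a *+ (i == 0).
    have /matrixP/(_ i 0) := S1e; rewrite -colE !mxE eqxx andbT => ->.
    by rewrite mulr_natr.
  rewrite -[LHS](@submxK _ 1 n 1 n); congr (@block_mx _ 1 n 1 n _ _ _ _).
  - apply/matrixP => i j; rewrite !mxE !ord1 /=.
    have -> : lshift n (0 : 'I_1) = 0 :> 'I_n.+1 by apply: val_inj.
    by rewrite c0 !eqxx.
  - apply/matrixP => i j; rewrite !mxE !ord1 /=.
    have -> : lshift n (0 : 'I_1) = 0 :> 'I_n.+1 by apply: val_inj.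
    by rewrite -S1t mxE c0.
  - apply/matrixP => i j; rewrite !mxE !ord1 /=.
    have -> : lshift n (0 : 'I_1) = 0 :> 'I_n.+1 by apply: val_inj.
    by rewrite c0.
pose W : 'M_n.+1 := @block_mx _ 1 n 1 n 1%:M 0 0 U.
have WW : W^T *m W = 1%:M.
  rewrite /W (@tr_block_mx _ 1 n 1 n) (@mulmx_block _ 1 n 1 n 1 n).
  rewrite !trmx0 !mulmx0 !mul0mx !addr0 !add0r trmx1 mul1mx UU.
  exact/esym/(@scalar_mx_block _ 1 n).
exists (Q *m W), (@row_mx _ 1 1 n a%:M d); split.
  by rewrite trmx_mul Qt mulmxA -(mulmxA _ Q Q) QQ mulmx1.
have -> : S = Q *m S1 *m Q.
  by rewrite S1D !mulmxA QQ mul1mx -mulmxA QQ mulmx1.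
rewrite trmx_mul Qt !mulmxA; congr (_ *m Q); rewrite -!mulmxA; congr (Q *m _).
rewrite S1E S2E /W (@diag_mx_row _ n 1) (@tr_block_mx _ 1 n 1 n).
rewrite !(@mulmx_block _ 1 n 1 n 1 n) !trmx0 !mulmx0 !mul0mx !addr0 !add0r.
rewrite trmx1 mul1mx mulmx1 !mulmxA mul1mx mulmx0; congr (@block_mx _ 1 n 1 n _ _ _ _).
by apply/matrixP => i j; rewrite !mxE !ord1.
Qed.

End RealSpectral.

(** * The second singular value *)

Definition lam2 (R : realType) q r (T : 'M[R]_(q, r)) : R :=
  singval (cplxmx T) 2 ^+ 2.

Section SecondSingularValue.
Context {R : realType}.

(** Both diagonals list the roots of one characteristic polynomial, hence are permutations of each
    other, and sorting forgets the order. *)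
Lemma singvals_real q r (T : 'M[R]_(q, r)) (U : 'M[R]_r) (d : 'rV[R]_r) :
  U^T *m U = 1%:M -> T^T *m T = U *m diag_mx d *m U^T ->
  singvals (cplxmx T) =
    take (minn q r) (sort >=%O [seq Num.sqrt (d 0 j) | j <- enum 'I_r]).
Proof.
move=> UU TT; rewrite /singvals; congr take.
set Sc := (_ ^t _ *m _)%sesqui.
have ScE : Sc = map_mx (real_complex R) (T^T *m T).
  rewrite /Sc map_mxM; congr (_ *m _); apply/matrixP => i j; rewrite !mxE.
  exact/CrealP/complex_realP/ex_intro.
have Sc_herm : Sc \is hermsymmx.
  apply: realsym_hermsym.
    apply/is_hermitianmxP; rewrite expr0 scale1r map_mx_id // ScE map_trmx.
    by rewrite trmx_mul trmxK.
  by apply/mxOverP => i j; rewrite ScE mxE complex_real.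
have /orthomx_spectralP := hermitian_normalmx Sc_herm.
have Pu : spectralmx Sc \in unitmx by exact: spectral_unit.
move: (spectralmx Sc) (spectral_diag Sc) Pu => P D Pu SD.
have cp_sim (K : fieldType) (Q M : 'M[K]_r) : Q \in unitmx ->
    char_poly (invmx Q *m M *m Q) = char_poly M.
  move=> Qu; rewrite /char_poly /char_poly_mx !map_mxM /=.
  set Qp := map_mx polyC Q; set Qi := map_mx polyC (invmx Q).
  have QiQ : Qi *m Qp = 1%:M by rewrite -map_mxM mulVmx // map_mx1.
  have -> : 'X%:M - Qi *m map_mx polyC M *m Qp =
            Qi *m ('X%:M - map_mx polyC M) *m Qp.
    by rewrite mulmxBr mulmxBl mul_mx_scalar -scalemxAl QiQ scalemx1.
  by rewrite !det_mulmx mulrAC -det_mulmx QiQ det1 mul1r.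
have cp_diag (K : fieldType) (e : 'rV[K]_r) :
    char_poly (diag_mx e) = \prod_(x <- [seq e 0 j | j <- enum 'I_r]) ('X - x%:P).
  rewrite char_poly_trig ?diag_mx_is_trig // big_map big_enum /=.
  by apply: eq_bigr => i _; rewrite mxE eqxx.
have : perm_eq [seq D 0 j | j <- enum 'I_r]
               [seq (d 0 j)%:C | j <- enum 'I_r].
  apply: prod_XsubC_eq; rewrite -cp_diag -(cp_sim _ _ _ Pu) -SD.
  have -> : \prod_(x <- [seq (d 0 j)%:C | j <- enum 'I_r]) ('X - x%:P) =
            char_poly (diag_mx (map_mx (real_complex R) d)).
    rewrite cp_diag !big_map; apply: eq_bigr => j _; by rewrite mxE.
  have Uu : U^T \in unitmx by case/mulmx1_unit: UU.
  have Ui : U = invmx U^T.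
    by rewrite -[LHS](mulKmx Uu) UU mulmx1.
  by rewrite ScE TT {1}Ui -map_char_poly cp_sim // map_char_poly map_diag_mx.
move=> /(perm_map (fun z : R[i] => Num.sqrt (complex.Re z))).
rewrite -!map_comp => pe; apply/perm_sortP => //.
- exact: ge_total.
- exact: ge_trans.
- by move=> x y; rewrite andbC => /le_anti.
Qed.

End SecondSingularValue.

Lemma count_mem1_nth (T : eqType) (x0 x : T) (s : seq T) i j :
  count_mem x s = 1%N -> (i < size s)%N -> (j < size s)%N ->
  nth x0 s i = x -> nth x0 s j = x -> i = j.
Proof.
wlog lt_ij : i j / (i < j)%N => [th c1 si sj xi xj|c1 si sj xi xj].
  by case: (ltngtP i j) => // ?; [exact: th|exact/esym/th].
move: c1; rewrite -(cat_take_drop j s) count_cat (drop_nth x0 sj) /= xj eqxx.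
have : x \in take j s.
  by rewrite -xi -(nth_take x0 lt_ij) mem_nth // size_take sj.
by rewrite -has_pred1 has_count addnCA add1n => cx [] /eqP; rewrite addn_eq0 -leqn0 leqNgt cx.
Qed.

Section SecondSingularValueFacts.
Context {R : realType}.

(** The columns of [U] selected by [f] give a nonsingular compression of [T^T *m T], whose rank is
    at most the number of rows of [T]. This controls the eigenvalues that [take] drops from
    [singvals]. *)
Lemma diag_rank_le q r (T : 'M[R]_(q, r)) (U : 'M[R]_r) (d : 'rV[R]_r) k
    (f : 'I_k -> 'I_r) :
  U^T *m U = 1%:M -> T^T *m T = U *m diag_mx d *m U^T -> injective f ->
  (forall i, d 0 (f i) != 0) -> (k <= q)%N.
Proof.
move=> UU TT finj dn0; pose W := colsub f U.
have WW : W^T *m (T^T *m T) *m W = diag_mx (\row_i d 0 (f i)).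
  have -> : W = U *m colsub f 1%:M by rewrite mulmx_colsub mulmx1.
  rewrite TT trmx_mul !mulmxA -(mulmxA _ U^T U) UU mulmx1 -(mulmxA _ U^T U) UU mulmx1.
  apply/matrixP => i j; rewrite mxE (bigD1 (f j)) //= big1 ?addr0 => [|l lj].
    rewrite mxE (bigD1 (f j)) //= big1 ?addr0 => [|l lj].
      rewrite !mxE eqxx mulr1 mulr1n (inj_eq finj) eq_sym.
      by case: eqVneq => [->|ij]; rewrite (mul1r, mul0r).
    by rewrite !mxE (negPf lj) mulr0n mulr0.
  by rewrite !mxE (negPf lj) mulr0.
have : (\rank (W^T *m (T^T *m T) *m W) <= q)%N.
  rewrite mulmxA -mulmxA; apply: leq_trans (mxrankM_maxr _ _) (rank_leq_row _).
rewrite WW mxrank_unit // unitmxE det_diag unitfE.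
by apply/prodf_neq0 => i _; rewrite mxE.
Qed.

(** The indices [j1] and [j2] carry the two largest eigenvalues. Simplicity speaks only of the
    entries kept by [take]; a positive [lam2 T] cannot equal a dropped one, so simplicity passes to
    the whole spectrum. *)
Lemma lam2_spectral q r (T : 'M[R]_(q, r)) : (1 < q)%N -> (1 < r)%N ->
  exists (U : 'M[R]_r) (d : 'rV[R]_r) (j1 j2 : 'I_r),
  [/\ U^T *m U = 1%:M, T^T *m T = U *m diag_mx d *m U^T,
      j1 != j2 /\ d 0 j2 <= d 0 j1,
      (forall j, j != j1 -> d 0 j <= d 0 j2) /\ lam2 T = d 0 j2
    & simple_singval (cplxmx T) (singval (cplxmx T) 2) -> 0 < lam2 T ->
      forall j, j != j2 -> d 0 j != d 0 j2].
Proof.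
move=> q1 r1; have TTs : (T^T *m T)^T = T^T *m T by rewrite trmx_mul trmxK.
have [U [d [UU TT]]] := real_spectral TTs.
have d_ge0 j : 0 <= d 0 j.
  have : dot (T *m col j U) (T *m col j U) = d 0 j.
    rewrite dot_mulmx mulmxA TT dotC.
    rewrite colE !mulmxA -(mulmxA _ U^T U) UU mulmx1 -!mulmxA.
    rewrite dot_orthogonal //; rewrite dot_sum (bigD1 j) //=.
    rewrite big1 ?addr0 => [|i ij]; last by rewrite !mxE (negPf ij) mul0r.
    by rewrite mul_diag_mx !mxE !eqxx !mulr1 mul1r.
  by move=> <-; exact: dot_ge0.
have sv := singvals_real UU TT.
pose f j : R := Num.sqrt (d 0 j).
pose o := sort (relpre f >=%R) (enum 'I_r).
have so : size o = r by rewrite size_sort size_enum_ord.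
have uo : uniq o by rewrite sort_uniq enum_uniq.
have mo j : j \in o by rewrite mem_sort mem_enum.
rewrite sort_map -/o in sv.
pose j0 := Ordinal (ltnW r1).
have o_sorted i j : (i <= j < r)%N -> d 0 (nth j0 o j) <= d 0 (nth j0 o i).
  case/andP=> ij jr.
  have : relpre f >=%R (nth j0 o i) (nth j0 o j).
    have tr : transitive (relpre f >=%R).
      by move=> y x z /= xy yz; exact: le_trans yz xy.
    have rf : reflexive (relpre f >=%R) by move=> x /=.
    have st : sorted (relpre f >=%R) o.
      by apply: sort_sorted => x y /=; exact: ge_total.
    by apply: (sorted_leq_nth tr rf j0 st) => //; rewrite inE so // (leq_ltn_trans ij).
  by rewrite /= /f ler_sqrt.
have sv1 : singval (cplxmx T) 2 = f (nth j0 o 1).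
  rewrite /singval sv nth_take ?leq_min ?q1 //= (nth_map j0) ?so //.
exists U, d, (nth j0 o 0), (nth j0 o 1); split => //.
- by split; [rewrite nth_uniq ?so // ltnW | exact: o_sorted].
- split=> [j jn|]; last by rewrite /lam2 sv1 sqr_sqrtr.
  rewrite -(nth_index j0 (mo j)); apply: o_sorted.
  have -> : (index j o < r)%N by move: (mo j); rewrite -index_mem so.
  rewrite andbT lt0n.
  by apply: contra jn => /eqP i0; rewrite -i0 nth_index.
- move=> simple lam_gt0 j jn; apply: contra_neqN (jn) => /eqP dj.
  rewrite /lam2 sv1 sqr_sqrtr // -dj in lam_gt0.
  pose i := index j o.
  have ir : (i < r)%N by move: (mo j); rewrite -index_mem so.
  (* If position [i] were dropped, positions 0 to q would hold q + 1 positive eigenvalues, more than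
     the rank allows. *)
  have iq : (i < q)%N.
    rewrite ltnNge; apply/negP => qi.
    have kr (k : 'I_q.+1) : (k < r)%N.
      by apply: leq_ltn_trans ir; apply: leq_trans qi; rewrite -ltnS.
    have /(diag_rank_le UU TT) : injective (fun k : 'I_q.+1 => nth j0 o k).
      by move=> k l /eqP; rewrite nth_uniq ?so // => /eqP/val_inj.
    rewrite ltnn => dn0; suff: false by []; apply: dn0 => k; rewrite gt_eqF //.
    apply: lt_le_trans lam_gt0 _; rewrite -(nth_index j0 (mo j)).
    apply: o_sorted; rewrite ir andbT; apply: leq_trans qi.
    by rewrite -ltnS.
  suff i1 : i = 1%N by rewrite -[LHS](nth_index j0 (mo j)) -/i i1.
  apply: (@count_mem1_nth _ 0 _ _ _ _ simple).
  - by rewrite sv size_takel ?size_map ?so ?geq_minr // leq_min iq.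
  - by rewrite sv size_takel ?size_map ?so ?geq_minr // leq_min q1.
  - rewrite sv nth_take ?leq_min ?iq // (nth_map j0) ?so // sv1.
    by rewrite /f (nth_index j0 (mo j)) dj.
  - by [].
Qed.

End SecondSingularValueFacts.

(** * Max-min characterization of the second eigenvalue over planes *)

Section Variational.
Context {R : realType} (q r : nat) (T : 'M[R]_(q, r)).
Hypotheses (q_gt1 : (1 < q)%N) (r_gt1 : (1 < r)%N).

Let diag_quad (d : 'rV[R]_r) (c : 'cV[R]_r) :
  dot c (diag_mx d *m c) = \sum_j d 0 j * c j 0 ^+ 2.
Proof.
rewrite dot_sum; apply: eq_bigr => j _; rewrite mul_diag_mx !mxE.
by rewrite mulrCA expr2.
Qed.

Let spectral_quad (U : 'M[R]_r) (d : 'rV[R]_r) (z : 'cV[R]_r) :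
  U^T *m U = 1%:M -> T^T *m T = U *m diag_mx d *m U^T ->
  dot z z = \sum_j (U^T *m z) j 0 ^+ 2 /\
  dot (T *m z) (T *m z) = \sum_j d 0 j * (U^T *m z) j 0 ^+ 2.
Proof.
move=> UU TT; split.
  rewrite -(@dot_orthogonal _ _ U^T z z) ?trmxK; last exact: mulmx1C.
  by rewrite dot_sum; apply: eq_bigr => j _; rewrite -expr2.
by rewrite dot_mulmx mulmxA TT dotC -!mulmxA dot_mulmx diag_quad.
Qed.

(** Courant-Fischer: every plane contains a nonzero vector orthogonal to the leading eigenvector,
    and on such vectors the form is at most [lam2 T] times the squared length. *)
Lemma lam2_ge (a b : 'cV[R]_r) (m : R) :
  (forall s t, s *: a + t *: b = 0 -> s = 0 /\ t = 0) ->
  (forall s t, let z := s *: a + t *: b in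
     m * dot z z <= dot (T *m z) (T *m z)) ->
  m <= lam2 T.
Proof.
have [U [d [j1 [j2 [UU TT _ [dle ->] _]]]]] := lam2_spectral T q_gt1 r_gt1.
move=> indep ge_m; rewrite leNgt; apply/negP => lt_m.
pose fa := (U^T *m a) j1 0; pose fb := (U^T *m b) j1 0.
have [[s t] /= stN0 st0] : exists2 st : R * R, st != (0, 0) & st.1 * fa + st.2 * fb = 0.
  have [fb0|fbN0] := eqVneq fb 0.
    by exists (0, 1); rewrite /= ?fb0 ?xpair_eqE ?oner_eq0 ?andbF //; ring.
  by exists (fb, - fa); rewrite /= ?xpair_eqE ?(negPf fbN0) //; ring.
pose z := s *: a + t *: b.
have zN0 : z != 0.
  by apply: contra stN0 => /eqP/indep[-> ->].
have z1 : (U^T *m z) j1 0 = 0.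
  by rewrite /z mulmxDr -!scalemxAr mxE [X in X + _]mxE [X in _ + X]mxE.
have [zz Tz] := spectral_quad z UU TT.
have := ge_m s t; rewrite /= -/z zz Tz mulr_sumr -subr_ge0 -sumrB.
rewrite leNgt => /negP[].
rewrite (eq_bigr (fun j => - ((m - d 0 j) * (U^T *m z) j 0 ^+ 2))); last by move=> j _; ring.
rewrite sumrN oppr_lt0.
have term_ge0 j : 0 <= (m - d 0 j) * (U^T *m z) j 0 ^+ 2.
  have [->|jn] := eqVneq j j1; first by rewrite z1 expr2 !mulr0.
  by rewrite mulr_ge0 ?sqr_ge0 // subr_ge0 (le_trans (dle _ jn)) // ltW.
rewrite lt_def sumr_ge0 ?andbT //; apply: contra zN0.
rewrite psumr_eq0 // => /allP all0; rewrite -dot_eq0 zz; apply/eqP.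
apply: big1 => j _; have [->|jn] := eqVneq j j1; first by rewrite z1 expr2 mulr0.
have := all0 j (mem_index_enum _); rewrite /= mulf_eq0 => /orP[|/eqP //].
by rewrite subr_eq0 => /eqP mE; have := dle _ jn; rewrite -mE leNgt lt_m.
Qed.

Lemma lam2_span : exists a b : 'cV[R]_r,
  (forall s t, s *: a + t *: b = 0 -> s = 0 /\ t = 0) /\
  (forall s t, let z := s *: a + t *: b in
     lam2 T * dot z z <= dot (T *m z) (T *m z)).
Proof.
have [U [d [j1 [j2 [UU TT [j12 d12] [dle ->] _]]]]] := lam2_spectral T q_gt1 r_gt1.
exists (U *m delta_mx j1 0), (U *m delta_mx j2 0).
have coord s t j :
    (U^T *m (s *: (U *m delta_mx j1 0) + t *: (U *m delta_mx j2 0)) : 'cV_r) j 0 =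
    s * (j == j1)%:R + t * (j == j2)%:R.
  by rewrite mulmxDr -!scalemxAr !mulmxA UU !mul1mx !mxE !andbT.
split=> s t.
  move=> z0; have := coord s t j1; have := coord s t j2.
  rewrite z0 mulmx0 !mxE !eqxx (negPf j12) eq_sym (negPf j12) !mulr1 !mulr0.
  by rewrite addr0 add0r => <- <-.
set z := _ + _; have [zz Tz] := spectral_quad z UU TT.
rewrite /= zz Tz mulr_sumr; apply: ler_sum => j _.
rewrite coord; have [->|jn1] := eqVneq j j1.
  by rewrite ler_wpM2r // sqr_ge0.
have [->|jn2] := eqVneq j j2; first by [].
by rewrite !mulr0 addr0 expr2 mulr0 !mulr0.
Qed.

Lemma lam2_eigenvector : exists v : 'cV[R]_r,
  [/\ dot v v = 1, T^T *m T *m v = lam2 T *: v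
    & simple_singval (cplxmx T) (singval (cplxmx T) 2) -> 0 < lam2 T ->
      forall w, T^T *m T *m w = lam2 T *: w -> w = dot v w *: v].
Proof.
have [U [d [j1 [j2 [UU TT _ [_ ->] sd]]]]] := lam2_spectral T q_gt1 r_gt1.
have De : diag_mx d *m delta_mx j2 0 = d 0 j2 *: delta_mx j2 0 :> 'cV_r.
  apply/matrixP => i j; rewrite mul_diag_mx !mxE !ord1.
  by case: eqVneq => [->|]; rewrite ?mulr0.
exists (U *m delta_mx j2 0); split.
- rewrite dot_orthogonal // dot_sum (bigD1 j2) //= big1 ?addr0.
    by rewrite !mxE !eqxx mulr1.
  by move=> j jn; rewrite !mxE (negPf jn) mul0r.
- by rewrite TT -!mulmxA (mulmxA U^T) UU mul1mx De -scalemxAr.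
move=> simple lam_gt0 w; rewrite TT => Tw; have sd' := sd simple lam_gt0.
have [c cE] : exists c, c = U^T *m w by exists (U^T *m w).
have UUt : U *m U^T = 1%:M by exact: mulmx1C.
have wE : w = U *m c by rewrite cE mulmxA UUt mul1mx.
have Dc : diag_mx d *m c = d 0 j2 *: c.
  have /(congr1 (mulmx U^T)) := Tw.
  by rewrite -!mulmxA mulmxA UU mul1mx -scalemxAr -cE.
have c0 j : j != j2 -> c j 0 = 0.
  move=> /sd' dj; have /matrixP/(_ j 0) := Dc; rewrite mul_diag_mx !mxE => /eqP.
  by rewrite -subr_eq0 -mulrBl mulf_eq0 subr_eq0 (negPf dj) => /eqP.
rewrite {2}wE dot_orthogonal // {1}wE scalemxAr; congr (_ *m _).
apply/matrixP => i j; rewrite !mxE ord1; have [->|ni] := eqVneq i j2.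
  rewrite dot_sum (bigD1 j2) //= big1 ?addr0 => [|k kn].
    by rewrite !mxE !eqxx mul1r mulr1.
  by rewrite !mxE (negPf kn) mul0r.
by rewrite c0 // mulr0.
Qed.

End Variational.

(* Freezing the matrix products first keeps [mxE] from expanding them into
   sums, on which [ring] is very slow. *)
Ltac mxring :=
  repeat (let x := fresh "x" in set x := (_ *m _); clearbody x);
  apply/matrixP => ? ?; rewrite !mxE; ring.

Lemma trmxB (V : zmodType) q r (M P : 'M[V]_(q, r)) : (M - P)^T = M^T - P^T.
Proof. by apply/matrixP => i j; rewrite !mxE. Qed.

(** * Perturbation of a simple singular value *)

Section Perturbation.
Context {R : realType} (q r : nat).
Hypotheses (q_gt1 : (1 < q)%N) (r_gt1 : (1 < r)%N).
Implicit Types T : 'M[R]_(q, r).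

Lemma dot_gram T z : dot (T *m z) (T *m z) = dot z (T^T *m T *m z).
Proof. by rewrite dot_mulmx mulmxA dotC. Qed.

(** Weyl's inequality: the plane that is optimal for one matrix is tested on the other, which loses
    at most the norm of the difference of the forms. *)
Lemma lam2_weyl T T' : `|lam2 T - lam2 T'| <= nrm (T^T *m T - T'^T *m T').
Proof.
wlog suff half : T T' / lam2 T - lam2 T' <= nrm (T^T *m T - T'^T *m T').
  by rewrite ler_norml half andbT lerNl opprB nrmBC half.
have [a [b [indep span]]] := lam2_span T q_gt1 r_gt1.
rewrite lerBlDr -lerBlDl; apply: (lam2_ge q_gt1 r_gt1 indep) => s t /=; have := span s t.
rewrite /=; move: (s *: a + t *: b) => z; rewrite !dot_gram => sp.
have := quad_le_nrm (T^T *m T - T'^T *m T') z.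
rewrite ler_norml mulmxBl !dotE => /andP[_ qu].
by rewrite mulrBl; lra.
Qed.

Lemma gram_sub_le T T' :
  nrm (T^T *m T - T'^T *m T') <= (nrm T + nrm T') * nrm (T - T').
Proof.
have -> : T^T *m T - T'^T *m T' = T^T *m (T - T') + (T - T')^T *m T'.
  by rewrite mulmxBr linearB mulmxBl addrA subrK.
rewrite mulrDl; apply: le_trans (nrmD _ _) _; apply: lerD.
  by rewrite -(nrm_tr T) nrmM.
by rewrite mulrC -(nrm_tr (T - _)) nrmM.
Qed.

(** Adding [v *m v^T] fills the one-dimensional kernel of [S - lam2 T], so [M] is invertible, and on
    the complement of [v] both matrices agree. The summand 1 in the constant keeps it positive. *)
Lemma kernel_gap T : simple_singval (cplxmx T) (singval (cplxmx T) 2) ->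
  0 < lam2 T -> exists (v : 'cV[R]_r) (K : R), [/\ dot v v = 1, T^T *m T *m v = lam2 T *: v, 0 < K &
    forall w, dot v w = 0 -> nrm w <= K * nrm (T^T *m T *m w - lam2 T *: w)].
Proof.
move=> simple lam_gt0; have [v [v1 Tv ker]] := lam2_eigenvector T q_gt1 r_gt1.
set S := T^T *m T in Tv ker *; have St : S^T = S by rewrite trmx_mul trmxK.
pose M := S - (lam2 T)%:M + v *m v^T.
have ME w : M *m w = S *m w - lam2 T *: w + dot v w *: v.
  rewrite mulmxDl mulmxBl mul_scalar_mx -mulmxA [v^T *m w]mx11_scalar.
  by rewrite mul_mx_scalar.
have Minj (w : 'cV_r) : M *m w = 0 -> w = 0.
  move=> Mw0; have vw : dot v w = 0.
    have : dot v (M *m w) = 0 by rewrite Mw0 dot0r.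
    by rewrite ME !dotE dot_mulmx St Tv v1 !dotE mulr1 subrr add0r.
  have := Mw0; rewrite ME vw scale0r addr0 => /subr0_eq Sw.
  by rewrite (ker simple lam_gt0 _ Sw) vw scale0r.
have Mu : M \in unitmx.
  rewrite -unitmx_tr -row_free_unit -kermx_eq0; apply/eqP/row_matrixP => i.
  rewrite row0; apply/trmx_inj; rewrite trmx0; apply: Minj.
  by apply: trmx_inj; rewrite trmx_mul trmxK -row_mul mulmx_ker row0 trmx0.
exists v, (nrm (invmx M) + 1); split => // [|w vw].
  by rewrite ltr_wpDl ?nrm_ge0.
have wE : w = invmx M *m (S *m w - lam2 T *: w).
  by rewrite -[_ - _]addr0 -(scale0r v) -vw -ME mulKmx.
rewrite {1}wE; apply: le_trans (nrmM _ _) _.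
by rewrite ler_wpM2r ?nrm_ge0 // lerDl.
Qed.

End Perturbation.

(** * Eigenvectors near a simple eigenvalue *)

Section EigenvectorField.
Context {R : realType} (q r : nat).
Hypotheses (q_gt1 : (1 < q)%N) (r_gt1 : (1 < r)%N).
Variables (T0 : 'M[R]_(q, r)) (v : 'cV[R]_r) (K1 : R).
Hypotheses (v_unit : dot v v = 1) (v_eigen : T0^T *m T0 *m v = lam2 T0 *: v).
Hypotheses (K1_gt0 : 0 < K1) (gap : forall w, dot v w = 0 ->
  nrm w <= K1 * nrm (T0^T *m T0 *m w - lam2 T0 *: w)).

Let b := nrm T0 + 1.
(** The radius makes [d = K1 * (4 * b * rho)] satisfy [d * (1 + nrm v) <= 1 / 4], where [d] is the
    relative error committed when an eigenpair of a nearby matrix is inserted into [gap]. *)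
Let rho := (1 + 16 * K1 * b * (1 + nrm v))^-1.

Let b_ge1 : 1 <= b. Proof. by rewrite lerDr nrm_ge0. Qed.
Let Kb_gt0 : 0 < K1 * b. Proof. by rewrite mulr_gt0 // (lt_le_trans ltr01). Qed.
Let nv_ge0 : 0 <= nrm v. Proof. exact: nrm_ge0. Qed.

Let K_gt0 : 0 < (K1 * b) * (1 + nrm v).
Proof. by rewrite mulr_gt0 // ltr_wpDr. Qed.

Let rho_gt0 : 0 < rho.
Proof. by rewrite invr_gt0; have := K_gt0; lra. Qed.

Let rho_le1 : rho <= 1.
Proof. by rewrite invf_le1; have := K_gt0; lra. Qed.

Let delta_le : K1 * (4 * b * rho) * (1 + nrm v) <= 1 / 4.
Proof.
have rhoE : rho * (1 + 16 * K1 * b * (1 + nrm v)) = 1.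
  by rewrite mulVf // gt_eqF //; have := K_gt0; lra.
by have := rho_gt0; lra.
Qed.

Let d_bounds : [/\ 0 <= K1 * (4 * b * rho), K1 * (4 * b * rho) <= 1 / 4 &
  K1 * (4 * b * rho) * nrm v <= 1 / 4].
Proof.
have d_ge0 : 0 <= K1 * (4 * b * rho).
  by rewrite !mulr_ge0 ?(ltW K1_gt0) ?(ltW rho_gt0) // (le_trans ler01).
have := delta_le; move: (K1 * (4 * b * rho)) (nrm v) d_ge0 nv_ge0 => d x d0 x0 dx.
by have := mulr_ge0 d0 x0; split; lra.
Qed.

Let near_bound (T : 'M[R]_(q, r)) : nrm (T - T0) < rho -> nrm T <= b.
Proof.
move=> nT; rewrite -[T](subrK T0) addrC; apply: le_trans (nrmD _ _) _.
by rewrite lerD2l (le_trans (ltW nT)).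
Qed.

Let near_gram (T T' : 'M[R]_(q, r)) : nrm (T - T0) < rho -> nrm (T' - T0) < rho ->
  nrm (T^T *m T - T'^T *m T') <= 2 * b * nrm (T - T').
Proof.
move=> /near_bound nT /near_bound nT'; apply: le_trans (gram_sub_le _ _) _.
by rewrite ler_wpM2r ?nrm_ge0 //; lra.
Qed.

Let near0 : nrm (T0 - T0) < rho. Proof. by rewrite subrr nrm0. Qed.

Let resid (T : 'M[R]_(q, r)) l (w : 'cV[R]_r) :
  nrm (T - T0) < rho -> `|l - lam2 T0| <= 2 * b * rho ->
  nrm (T0^T *m T0 *m w - lam2 T0 *: w) <=
    4 * b * rho * nrm w + nrm (T^T *m T *m w - l *: w).
Proof.
move=> nT nl.
have -> : T0^T *m T0 *m w - lam2 T0 *: w =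
    ((T0^T *m T0 - T^T *m T) *m w + (l - lam2 T0) *: w) +
    (T^T *m T *m w - l *: w).
  by rewrite mulmxBl; apply/matrixP => i j; rewrite !mxE; ring.
apply: le_trans (nrmD _ _) _; rewrite lerD2r; apply: le_trans (nrmD _ _) _.
rewrite nrmZ; have nw := nrm_ge0 w.
have := nrmM (T0^T *m T0 - T^T *m T) w.
have := ler_wpM2r nw nl; have := ler_wpM2r nw (near_gram near0 nT).
rewrite nrmBC in nT; have := ler_wpM2l (ltW (lt_le_trans ltr01 b_ge1)) (ltW nT).
by move: (b) (rho) => *; nra.
Qed.

Lemma eigenvector_not_orthogonal (T : 'M[R]_(q, r)) l u :
  nrm (T - T0) < rho -> `|l - lam2 T0| <= 2 * b * rho ->
  T^T *m T *m u = l *: u -> u != 0 -> dot v u != 0.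
Proof.
move=> nT nl Tu; apply: contra => /eqP vu.
have := gap vu; have := resid u nT nl; rewrite Tu subrr nrm0 addr0 => res ga.
have u_le : nrm u <= 1 / 2 * nrm u.
  have nu := nrm_ge0 u; apply: le_trans ga _.
  have := ler_wpM2l (ltW K1_gt0) res; rewrite mulrA.
  have [d_ge0 d_le _] := d_bounds; move: (K1 * (4 * b * rho)) d_ge0 d_le => d *.
  by nra.
have := dot_le_nrm u u; have -> : nrm u = 0 by have := nrm_ge0 u; lra.
by rewrite mulr0 normr_le0 dot_eq0.
Qed.

(** Normalizing by [dot v u = 1] instead of unit length makes [u - v], and later the difference of
    two eigenvectors, orthogonal to [v], which is where [gap] applies; it also fixes the sign. *)
Lemma eigenvector_close (T : 'M[R]_(q, r)) l u :
  nrm (T - T0) < rho -> `|l - lam2 T0| <= 2 * b * rho ->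
  T^T *m T *m u = l *: u -> dot v u = 1 ->
  nrm u <= 2 * nrm v /\ nrm (u - v) <= 1 / 2.
Proof.
move=> nT nl Tu vu; have vr : dot v (u - v) = 0 by rewrite !dotE vu v_unit subrr.
have := gap vr.
have -> : T0^T *m T0 *m (u - v) - lam2 T0 *: (u - v) = T0^T *m T0 *m u - lam2 T0 *: u.
  by rewrite mulmxBr v_eigen; apply/matrixP => i j; rewrite !mxE; ring.
move=> ga; have := resid u nT nl.
rewrite Tu subrr nrm0 addr0 => res.
have nu : nrm u <= nrm v + nrm (u - v) by rewrite -{1}(subrK v u) addrC nrmD.
have r_ge0 := nrm_ge0 (u - v).
have [d_ge0 d_le d_le'] := d_bounds.
have := ler_wpM2l (ltW K1_gt0) res; rewrite mulrA => res'.
move: (K1 * (4 * b * rho)) d_ge0 res' d_le d_le' => d d_ge0 res' d_le d_le'.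
have r_le : nrm (u - v) <= d * (nrm v + nrm (u - v)).
  by apply: le_trans (ler_wpM2l d_ge0 nu); lra.
have := ler_wpM2r r_ge0 d_le.
have := ler_wpM2r nv_ge0 d_le; rewrite mulrDr in r_le.
by split; lra.
Qed.

Lemma eigenvector_dot_ge (T T' : 'M[R]_(q, r)) l l' u u' :
  nrm (T - T0) < rho -> `|l - lam2 T0| <= 2 * b * rho ->
  nrm (T' - T0) < rho -> `|l' - lam2 T0| <= 2 * b * rho ->
  T^T *m T *m u = l *: u -> T'^T *m T' *m u' = l' *: u' ->
  dot v u = 1 -> dot v u' = 1 -> 1 / 2 <= dot u u'.
Proof.
move=> nT nl nT' nl' Tu Tu' vu vu'.
have [_ ru] := eigenvector_close nT nl Tu vu.
have [_ ru'] := eigenvector_close nT' nl' Tu' vu'.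
have -> : dot u u' = 1 + dot (u - v) (u' - v).
  by rewrite !dotE vu' v_unit (dotC u v) vu; ring.
have := dot_le_nrm (u - v) (u' - v); rewrite ler_norml => /andP[lo _].
have := nrm_ge0 (u - v); have := nrm_ge0 (u' - v).
by nra.
Qed.

Lemma eigenvector_lipschitz (T T' : 'M[R]_(q, r)) l l' u u' :
  nrm (T - T0) < rho -> `|l - lam2 T0| <= 2 * b * rho ->
  nrm (T' - T0) < rho -> `|l' - lam2 T0| <= 2 * b * rho ->
  T^T *m T *m u = l *: u -> T'^T *m T' *m u' = l' *: u' ->
  dot v u = 1 -> dot v u' = 1 ->
  nrm (u - u') <= 4 * K1 * nrm v * (2 * b * nrm (T - T') + `|l - l'|).
Proof.
move=> nT nl nT' nl' Tu Tu' vu vu'.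
have [nu' _] := eigenvector_close nT' nl' Tu' vu'.
have vw : dot v (u - u') = 0 by rewrite !dotE vu vu' subrr.
have ga := gap vw; have := resid (u - u') nT nl.
have -> : T^T *m T *m (u - u') - l *: (u - u') =
    - ((T^T *m T - T'^T *m T') *m u' - (l - l') *: u').
  by rewrite mulmxBr Tu mulmxBl Tu'; apply/matrixP => i j; rewrite !mxE; ring.
rewrite nrmN => res.
have nS := near_gram nT nT'.
have nw := nrm_ge0 (u - u').
have [d_ge0 d_le d_le'] := d_bounds.
have := ler_wpM2l (ltW K1_gt0) res; rewrite mulrDr mulrA => res'.
set D := nrm (_ *m u' - _ *: u') in res' res.
have D_le : D <= (2 * b * nrm (T - T') + `|l - l'|) * (2 * nrm v).
  apply: le_trans (nrmB _ _) _; rewrite nrmZ.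
  apply: le_trans (lerD (nrmM _ _) (lexx _)) _.
  rewrite -mulrDl; apply: ler_pM => //; rewrite ?addr_ge0 ?nrm_ge0 //.
  by rewrite lerD2r.
have := ler_wpM2l (ltW K1_gt0) D_le.
move: (K1 * (4 * b * rho)) d_ge0 res' d_le d_le' => d d_ge0 res' d_le _ K1D.
by have := ler_wpM2r nw d_le; lra.
Qed.

End EigenvectorField.

(** The last clause isolates the eigenvalue: eigenvectors for different eigenvalues are orthogonal,
    whereas two normalized ones near [T0] have inner product at least 1/2. *)
Lemma lam2_eigenvector_field (R : realType) q r (T0 : 'M[R]_(q, r)) :
  (1 < q)%N -> (1 < r)%N ->
  simple_singval (cplxmx T0) (singval (cplxmx T0) 2) -> 0 < lam2 T0 ->
  exists (ev : 'M[R]_(q, r) -> 'cV[R]_r) (rho K : R),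
  [/\ 0 < rho, 0 < K,
   forall T, nrm (T - T0) < rho ->
     [/\ T^T *m T *m ev T = lam2 T *: ev T, ev T != 0 & nrm (ev T) <= K],
   forall T T', nrm (T - T0) < rho -> nrm (T' - T0) < rho ->
     nrm (ev T - ev T') <= K * nrm (T - T') /\ 1 / 2 <= dot (ev T) (ev T')
  & forall T l (u : 'cV[R]_r), nrm (T - T0) < rho -> `|l - lam2 T0| < rho ->
     T^T *m T *m u = l *: u -> u != 0 -> l = lam2 T].
Proof.
move=> q1 r1 simple0 lam_gt0.
have [v [K1 [v1 Tv K1_gt0 gap]]] := kernel_gap q1 r1 simple0 lam_gt0.
pose b := nrm T0 + 1; pose rho := (1 + 16 * K1 * b * (1 + nrm v))^-1.
have b_ge1 : 1 <= b by rewrite lerDr nrm_ge0.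
have b_gt0 : 0 < b by apply: lt_le_trans b_ge1.
have Kb_gt0 : 0 < K1 * b * (1 + nrm v).
  by rewrite !mulr_gt0 // ltr_wpDr ?nrm_ge0.
have rho_gt0 : 0 < rho.
  by rewrite invr_gt0; lra.
have rho_le1 : rho <= 1.
  by rewrite invf_le1; lra.
have gram_le T T' : nrm (T - T0) < rho -> nrm (T' - T0) < rho ->
    nrm (T^T *m T - T'^T *m T') <= 2 * b * nrm (T - T').
  have near_le (X : 'M[R]_(q, r)) : nrm (X - T0) < rho -> nrm X <= b.
    move=> nX; rewrite -[X](subrK T0) addrC; apply: le_trans (nrmD _ _) _.
    by rewrite lerD2l (le_trans (ltW nX)).
  move=> /near_le nT /near_le nT'; apply: le_trans (gram_sub_le _ _) _.
  by rewrite ler_wpM2r ?nrm_ge0 //; lra.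
have lam_le T T' : nrm (T - T0) < rho -> nrm (T' - T0) < rho ->
    `|lam2 T - lam2 T'| <= 2 * b * nrm (T - T').
  by move=> nT nT'; apply: le_trans (lam2_weyl q1 r1 _ _) (gram_le _ _ nT nT').
have near0 : nrm (T0 - T0) < rho by rewrite subrr nrm0.
have lam_near T : nrm (T - T0) < rho -> `|lam2 T - lam2 T0| <= 2 * b * rho.
  move=> nT; apply: le_trans (lam_le _ _ nT near0) _.
  by rewrite ler_wpM2l ?(ltW nT) // mulr_ge0 // (le_trans ler01).
have ex_ev T : exists u : 'cV[R]_r, nrm (T - T0) < rho ->
    T^T *m T *m u = lam2 T *: u /\ dot v u = 1.
  have [u [u1 Tu _]] := lam2_eigenvector T q1 r1.
  have [nT|] := boolP (nrm (T - T0) < rho); last by exists 0.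
  have uN0 : u != 0 by rewrite -dot_eq0 u1 oner_eq0.
  have vu := eigenvector_not_orthogonal K1_gt0 gap nT (lam_near _ nT) Tu uN0.
  exists ((dot v u)^-1 *: u) => _.
  by rewrite -scalemxAr Tu !scalerA mulrC !dotE mulVf.
have [ev evP] := choice ex_ev.
pose K := 2 * nrm v + 4 * K1 * nrm v * (4 * b).
have K_ge : 2 * nrm v <= K.
  by rewrite lerDl !mulr_ge0 ?nrm_ge0 // ltW.
have K_ge' : 4 * K1 * nrm v * (4 * b) <= K by rewrite lerDr mulr_ge0 ?nrm_ge0.
have ev_dot T T' : nrm (T - T0) < rho -> nrm (T' - T0) < rho ->
    1 / 2 <= dot (ev T) (ev T').
  move=> nT nT'; have [Tu vu] := evP _ nT; have [Tu' vu'] := evP _ nT'.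
  exact: (eigenvector_dot_ge v1 Tv K1_gt0 gap nT (lam_near _ nT) nT'
    (lam_near _ nT') Tu Tu' vu vu').
exists ev, rho, (K + 1); split => //.
- by rewrite ltr_wpDl // (le_trans _ K_ge) // mulr_ge0 ?nrm_ge0.
- move=> T nT; have [Tu vu] := evP _ nT; split=> //.
    by apply/eqP => u0; move: vu; rewrite u0 dot0r => /eqP; rewrite eq_sym oner_eq0.
  have [nu _] := eigenvector_close v1 Tv K1_gt0 gap nT (lam_near _ nT) Tu vu.
  by lra.
- move=> T T' nT nT'; split; last exact: ev_dot.
  have [Tu vu] := evP _ nT; have [Tu' vu'] := evP _ nT'.
  have := eigenvector_lipschitz v1 Tv K1_gt0 gap nT (lam_near _ nT) nT'
    (lam_near _ nT') Tu Tu' vu vu'.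
  move=> /le_trans -> //.
  have nTT := nrm_ge0 (T - T').
  apply: (@le_trans _ _ (4 * K1 * nrm v * (4 * b) * nrm (T - T'))).
    rewrite -[_ * _ * nrm (T - T')]mulrA ler_wpM2l //.
      by rewrite !mulr_ge0 ?nrm_ge0 // ltW.
    by have := lam_le _ _ nT nT'; rewrite /b; lra.
  by rewrite ler_wpM2r //; lra.
- move=> T l u nT nl Tu uN0.
  have nl' : `|l - lam2 T0| <= 2 * b * rho by apply: le_trans (ltW nl) _; nra.
  have vu := eigenvector_not_orthogonal K1_gt0 gap nT nl' Tu uN0.
  pose u1 := (dot v u)^-1 *: u.
  have Tu1 : T^T *m T *m u1 = l *: u1 by rewrite -scalemxAr Tu !scalerA mulrC.
  have vu1 : dot v u1 = 1 by rewrite !dotE mulVf.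
  have [Te ve] := evP _ nT.
  have := eigenvector_dot_ge v1 Tv K1_gt0 gap nT nl' nT (lam_near _ nT)
    Tu1 Te vu1 ve.
  have : (l - lam2 T) * dot u1 (ev T) = 0.
    have : dot (T^T *m T *m u1) (ev T) = dot u1 (T^T *m T *m ev T).
      by rewrite [RHS]dot_mulmx trmx_mul trmxK.
    by rewrite Tu1 Te !dotE mulrBl => ->; rewrite subrr.
  move=> /eqP; rewrite mulf_eq0 subr_eq0 => /orP[/eqP //|/eqP ->].
  by rewrite ler_pdivrMr // mul0r ler10.
Qed.

(** The Gram matrix is quadratic in [T], so its mixed difference is controlled by the mixed
    difference of the arguments and a product of two first differences. *)
Lemma gram_four_point (R : realType) q r (T1 T2 T3 T4 : 'M[R]_(q, r)) :
  nrm ((T1^T *m T1 - T2^T *m T2) - (T3^T *m T3 - T4^T *m T4)) <=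
  (nrm T1 + nrm T2) * nrm ((T1 - T2) - (T3 - T4)) +
  nrm (T3 - T4) * (nrm (T1 - T3) + nrm (T2 - T4)).
Proof.
set Z := (T1 - T2) - _; set Y := T3 - T4.
have -> : (T1^T *m T1 - T2^T *m T2) - (T3^T *m T3 - T4^T *m T4) =
    (T1^T *m Z + Z^T *m T2) + ((T1 - T3)^T *m Y + Y^T *m (T2 - T4)).
  rewrite /Z /Y !trmxB !(mulmxDl, mulNmx, mulmxDr, mulmxN).
  by mxring.
apply: le_trans (nrmD _ _) _; apply: lerD.
  rewrite mulrDl; apply: le_trans (nrmD _ _) _; apply: lerD.
    by rewrite -(nrm_tr T1) nrmM.
  by rewrite mulrC -(nrm_tr Z) nrmM.
rewrite mulrDr; apply: le_trans (nrmD _ _) _; apply: lerD.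
  by rewrite mulrC -(nrm_tr (T1 - T3)) nrmM.
by rewrite -(nrm_tr Y) nrmM.
Qed.

(* For eigenvectors u, u' of symmetric S, S' with eigenvalues l, l' one has
   [(l - l') u.u' = u.(S - S')u'] exactly, so no derivative of l is needed. *)
Lemma lam2_four_point (R : realType) q r (T0 : 'M[R]_(q, r)) :
  (1 < q)%N -> (1 < r)%N ->
  simple_singval (cplxmx T0) (singval (cplxmx T0) 2) -> 0 < lam2 T0 ->
  exists rho K : R, [/\ 0 < rho, 0 < K & forall T1 T2 T3 T4,
    nrm (T1 - T0) < rho -> nrm (T2 - T0) < rho ->
    nrm (T3 - T0) < rho -> nrm (T4 - T0) < rho ->
    `|(lam2 T1 - lam2 T2) - (lam2 T3 - lam2 T4)| <=
    K * (nrm ((T1 - T2) - (T3 - T4)) +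
         nrm (T3 - T4) * (nrm (T1 - T3) + nrm (T2 - T4)))].
Proof.
move=> q1 r1 simple0 lam_gt0.
have [ev [rho0 [K [rho0_gt0 K_gt0 evP evL _]]]] :=
  lam2_eigenvector_field q1 r1 simple0 lam_gt0.
pose rho := Num.min rho0 1; pose b := nrm T0 + 1.
have b_ge1 : 1 <= b by rewrite lerDr nrm_ge0.
have [b' b'E] : exists b', b' = b by exists b.
exists rho, (2 * K ^+ 2 * (8 * b' + 1)); split.
- by rewrite lt_min rho0_gt0 ltr01.
- by rewrite b'E !mulr_gt0 ?exprn_gt0 // ltr_wpDl // mulr_ge0 // (le_trans ler01).
move=> T1 T2 T3 T4; rewrite !lt_min.
move=> /andP[n1 m1] /andP[n2 m2] /andP[n3 m3] /andP[n4 m4].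
have near_le (X : 'M[R]_(q, r)) : nrm (X - T0) < 1 -> nrm X <= b'.
  move=> nX; rewrite -[X](subrK T0) addrC; apply: le_trans (nrmD _ _) _.
  by rewrite b'E lerD2l ltW.
have bound4 := gram_four_point T1 T2 T3 T4.
have bound2 := gram_sub_le T3 T4.
have weyl := lam2_weyl q1 r1 T3 T4.
set A := T1^T *m T1 - T2^T *m T2 in bound4 *.
set B := T3^T *m T3 - T4^T *m T4 in bound4 bound2 weyl *.
set z := nrm (_ - _) in bound4 *; set y := nrm (T3 - T4) in bound4 bound2 *.
set d := (nrm (T1 - T3) + nrm (T2 - T4)) in bound4 *.
have [e1 _ k1] := evP _ n1; have [e2 _ k2] := evP _ n2.
have [e3 _ k3] := evP _ n3; have [e4 _ k4] := evP _ n4.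
have [L13 _] := evL _ _ n1 n3; have [L24 _] := evL _ _ n2 n4.
have [_ p_ge] := evL _ _ n1 n2.
have pencil (X X' : 'M[R]_(q, r)) (u u' : 'cV[R]_r) : X^T *m X *m u = lam2 X *: u ->
    X'^T *m X' *m u' = lam2 X' *: u' ->
    (lam2 X - lam2 X') * dot u u' = dot u ((X^T *m X - X'^T *m X') *m u').
  move=> eu eu'; rewrite mulmxBl eu' !dotE.
  have -> : dot u (X^T *m X *m u') = dot (X^T *m X *m u) u'.
    by rewrite dot_mulmx trmx_mul trmxK.
  by rewrite eu !dotE mulrBl.
have P12 := pencil _ _ _ _ e1 e2; have P34 := pencil _ _ _ _ e3 e4.
set u1 := ev T1 in e1 k1 L13 p_ge P12; set u2 := ev T2 in e2 k2 L24 p_ge P12.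
set u3 := ev T3 in e3 k3 L13 P34; set u4 := ev T4 in e4 k4 L24 P34.
rewrite -/A in P12; rewrite -/B in P34.
set al := lam2 T1 - lam2 T2 in P12 *; set be := lam2 T3 - lam2 T4 in P34 weyl *.
have K0 := ltW K_gt0.
have y0 : 0 <= y by exact: nrm_ge0.
have z0 : 0 <= z by exact: nrm_ge0.
have d0 : 0 <= d by rewrite addr_ge0 ?nrm_ge0.
have b0 : 0 <= b' by rewrite b'E (le_trans ler01).
have L13d : nrm (u1 - u3) <= K * d.
  by apply: le_trans L13 _; rewrite ler_wpM2l // lerDl nrm_ge0.
have L24d : nrm (u2 - u4) <= K * d.
  by apply: le_trans L24 _; rewrite ler_wpM2l // lerDr nrm_ge0.
clear e1 e2 e3 e4 pencil L13 L24.
clearbody al be u1 u2 u3 u4 z y d; clearbody A B.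
(* The identities for the two pairs are subtracted after replacing [u3], [u4] by [u1], [u2]. Every
   term then carries either [A - B] or a difference of eigenvectors times [B] or [be], both of order
   [y]. *)
have E1 : (al - be) * dot u1 u2 =
    dot u1 ((A - B) *m u2) + dot (u1 - u3) (B *m u2) + dot u3 (B *m (u2 - u4)) -
    be * (dot (u1 - u3) u2 + dot u3 (u2 - u4)).
  rewrite mulrBl P12 mulmxBl mulmxBr !dotE.
  have -> : be * (dot u1 u2 - dot u3 u2 + (dot u3 u2 - dot u3 u4)) =
     be * dot u1 u2 - be * dot u3 u4 by ring.
  by rewrite P34; ring.
have nB : nrm B <= 2 * b' * y.
  apply: le_trans bound2 _; rewrite ler_wpM2r //.
  by have := near_le _ m3; have := near_le _ m4; lra.
have nAB : nrm (A - B) <= 2 * b' * z + y * d.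
  apply: le_trans bound4 _; rewrite lerD2r ler_wpM2r //.
  by have := near_le _ m1; have := near_le _ m2; lra.
have dot3 (x w : 'cV[R]_r) (M : 'M[R]_r) s t c : nrm x <= s -> nrm M <= t -> nrm w <= c ->
    `|dot x (M *m w)| <= s * t * c.
  move=> xs Mt wc; apply: le_trans (dot_le_nrm _ _) _.
  apply: le_trans (ler_wpM2l (nrm_ge0 _) (nrmM _ _)) _.
  rewrite mulrA; apply: ler_pM => //; rewrite ?mulr_ge0 ?nrm_ge0 //.
  by apply: ler_pM => //; rewrite nrm_ge0.
have t1 := dot3 _ _ _ _ _ _ k1 nAB k2.
have t2 := dot3 _ _ _ _ _ _ L13d nB k2.
have t3 := dot3 _ _ _ _ _ _ k3 nB L24d.
have t4 : `|dot (u1 - u3) u2| <= K * d * K.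
  by apply: le_trans (dot_le_nrm _ _) _; apply: ler_pM; rewrite ?nrm_ge0.
have t5 : `|dot u3 (u2 - u4)| <= K * (K * d).
  by apply: le_trans (dot_le_nrm _ _) _; apply: ler_pM; rewrite ?nrm_ge0.
have t6 : `|be * (dot (u1 - u3) u2 + dot u3 (u2 - u4))| <=
    (2 * b' * y) * (K * d * K + K * (K * d)).
  rewrite normrM; apply: ler_pM => //; first exact: le_trans weyl _.
  by apply: le_trans (ler_normD _ _) _; exact: lerD.
have : `|(al - be) * dot u1 u2| <= K ^+ 2 * (2 * b' * z + y * d + 8 * b' * (y * d)).
  rewrite E1; apply: le_trans (ler_normB _ _) _.
  apply: le_trans (lerD (ler_normD _ _) (lexx _)) _.
  apply: le_trans (lerD (lerD (ler_normD _ _) (lexx _)) (lexx _)) _.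
  by rewrite expr2; lra.
rewrite normrM => main.
have : `|al - be| * (1 / 2) <= `|al - be| * `|dot u1 u2|.
  by rewrite ler_wpM2l // (le_trans p_ge) // ler_norm.
have := mulr_ge0 (sqr_ge0 K) (mulr_ge0 b0 z0).
have := mulr_ge0 (sqr_ge0 K) z0.
by lra.
Qed.

(** * Growth of the weighted singular value in the weight *)

Section WeightedBlocks.
Context {R : realType}.
Implicit Types (p m k : nat) (g Gam : R).

(* For N = [Re H, - Im H; Im H, Re H] this is the matrix T of weight g, and it
   equals [Dg g *m N *m (Dg g)^-1]. Multiplication by i is [Jmx]. *)
Definition Tg p m g (N : 'M[R]_(p + p, m + m)) : 'M[R]_(p + p, m + m) :=
  block_mx (ulsubmx N) (g *: ursubmx N) (g^-1 *: dlsubmx N) (drsubmx N).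

Definition Dg k g : 'M[R]_(k + k) := block_mx g%:M 0 0 1%:M.
Definition E1 k : 'M[R]_(k + k) := block_mx 1%:M 0 0 0.
Definition E2 k : 'M[R]_(k + k) := block_mx 0 0 0 1%:M.
Definition Jmx k : 'M[R]_(k + k) := block_mx 0 (- 1%:M) 1%:M 0.

Lemma TgE p m g (N : 'M[R]_(p + p, m + m)) : g != 0 ->
  Tg g N *m Dg m g = Dg p g *m N.
Proof.
move=> g0; rewrite -[in RHS](submxK N) /Tg /Dg !mulmx_block.
rewrite !mulmx0 !mul0mx !addr0 !add0r !mulmx1 !mul1mx !mul_mx_scalar !mul_scalar_mx.
by rewrite scalerA divff // scale1r.
Qed.

Lemma Dg_tr k g : (Dg k g)^T = Dg k g.
Proof. by rewrite tr_block_mx !trmx0 !tr_scalar_mx. Qed.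

Lemma DgDg k g : Dg k g *m Dg k g = g ^+ 2 *: E1 k + E2 k.
Proof.
rewrite /Dg mulmx_block !mulmx0 !mul0mx !addr0 !add0r mulmx1 -scalar_mxM -expr2.
by rewrite /E1 /E2 scale_block_mx add_block_mx !scaler0 !addr0 !add0r scalemx1.
Qed.

Lemma DgK k g : g != 0 -> Dg k g^-1 *m Dg k g = 1%:M.
Proof.
move=> g0; rewrite /Dg mulmx_block !mulmx0 !mul0mx !addr0 !add0r mulmx1 -scalar_mxM.
by rewrite mulVf // -scalar_mx_block.
Qed.

Lemma Tg_sub p m g (N N' : 'M[R]_(p + p, m + m)) : Tg g (N - N') = Tg g N - Tg g N'.
Proof.
rewrite /Tg opp_block_mx add_block_mx -!scalerBr.
by congr block_mx; try congr (_ *: _); apply/matrixP => i j; rewrite !mxE.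
Qed.

(** The factor is [Gam^-2] because differences of [g^-1] cost that much in [nrm_Tg_sub]; a single
    constant then serves both estimates. *)
Lemma nrm_Tg p m Gam g (N : 'M[R]_(p + p, m + m)) : 0 < Gam -> Gam <= g <= 1 ->
  nrm (Tg g N) <= Gam^-2 * nrm N.
Proof.
move=> G0 /andP[Gg g1]; have g0 := lt_le_trans G0 Gg.
have gV : g^-1 <= Gam^-2.
  apply: (@le_trans _ _ Gam^-1); first by rewrite lef_pV2.
  by rewrite lef_pV2 ?posrE ?exprn_gt0 // expr2 ler_piMl ?(ltW G0) ?(le_trans Gg g1).
have G2 : 1 <= Gam^-2.
  by apply: le_trans gV; rewrite invf_ge1.
rewrite -[in X in _ <= X](submxK N) /Tg !nrm_block !nrmZ !ger0_norm ?invr_ge0 ?(ltW g0) //.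
rewrite !mulrDr.
have := nrm_ge0 (ulsubmx N); have := nrm_ge0 (ursubmx N).
have := nrm_ge0 (dlsubmx N); have := nrm_ge0 (drsubmx N).
by move: (nrm _) (nrm _) (nrm _) (nrm _) => *; rewrite !lerD // ?ler_wpM2r //; nra.
Qed.

Lemma nrm_Tg_sub p m Gam g g' (N : 'M[R]_(p + p, m + m)) : 0 < Gam ->
  Gam <= g <= 1 -> Gam <= g' <= 1 ->
  nrm (Tg g N - Tg g' N) <= Gam^-2 * `|g - g'| * nrm N.
Proof.
move=> G0 /andP[Gg g1] /andP[Gg' g'1].
have g0 := lt_le_trans G0 Gg; have g'0 := lt_le_trans G0 Gg'.
have -> : Tg g N - Tg g' N = block_mx 0 ((g - g') *: ursubmx N)
    ((g^-1 - g'^-1) *: dlsubmx N) 0.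
  by rewrite /Tg opp_block_mx add_block_mx !subrr -!scalerBl.
have gV : `|g^-1 - g'^-1| <= Gam^-2 * `|g - g'|.
  have -> : g^-1 - g'^-1 = - ((g * g')^-1 * (g - g')) by field; rewrite !gt_eqF.
  rewrite normrN normrM ler_wpM2r // ger0_norm ?invr_ge0 ?mulr_ge0 ?(ltW g0) ?(ltW g'0) //.
  by rewrite lef_pV2 ?posrE ?exprn_gt0 ?mulr_gt0 // expr2 ler_pM ?(ltW G0).
have G2 : 1 <= Gam^-2.
  rewrite invf_ge1 ?exprn_gt0 // expr2; nra.
rewrite -[in X in _ <= X](submxK N) !nrm_block !nrmZ !nrm0 add0r addr0.
have := nrm_ge0 (ulsubmx N); have := nrm_ge0 (ursubmx N).
have := nrm_ge0 (dlsubmx N); have := nrm_ge0 (drsubmx N).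
have d0 : 0 <= `|g - g'| by [].
have gg : `|g - g'| <= Gam^-2 * `|g - g'| by rewrite ler_peMl.
move: (nrm _) (nrm _) (nrm _) (nrm _) => x1 x2 x3 x4 h1 h2 h3 h4.
have := ler_wpM2r h2 gV; have := ler_wpM2r h3 gg.
have := mulr_ge0 (le_trans d0 gg) h1; have := mulr_ge0 (le_trans d0 gg) h4.
by lra.
Qed.

Lemma Jmx_tr k : (Jmx k)^T = - Jmx k.
Proof.
rewrite /Jmx tr_block_mx opp_block_mx !trmx0 trmx1 opprK oppr0.
by rewrite raddfN /= trmx1.
Qed.

Lemma JmxK k : Jmx k *m Jmx k = - 1%:M.
Proof.
rewrite /Jmx mulmx_block !mulmx0 !mul0mx !mulmx1 mul1mx !addr0 !add0r.
by rewrite (scalar_mx_block k k) opp_block_mx oppr0.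
Qed.

Lemma E1J k : E1 k *m Jmx k = Jmx k *m E2 k.
Proof.
by rewrite /E1 /E2 /Jmx !mulmx_block !mulmx0 !mul0mx ?mulmx1 ?mul1mx
  ?mulmxN ?mulNmx ?mulmx1 ?mulmx0 ?mul0mx ?oppr0 ?addr0 ?add0r.
Qed.

Lemma E2J k : E2 k *m Jmx k = Jmx k *m E1 k.
Proof.
by rewrite /E1 /E2 /Jmx !mulmx_block !mulmx0 !mul0mx ?mulmx1 ?mul1mx
  ?mulmxN ?mulNmx ?mulmx1 ?mulmx0 ?mul0mx ?oppr0 ?addr0 ?add0r.
Qed.

Lemma E1_tr k : (E1 k)^T = E1 k.
Proof. by rewrite /E1 tr_block_mx !trmx0 trmx1. Qed.

Lemma E2_tr k : (E2 k)^T = E2 k.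
Proof. by rewrite /E2 tr_block_mx !trmx0 trmx1. Qed.

End WeightedBlocks.

(* Eigenvectors of the Gram matrix of [Tg g N] for the eigenvalue l correspond,
   through [Dg g], to null vectors of [g ^+ 2 *: Fmx N l + Gmx N l]. *)
Definition Fmx (R : realType) p m (N : 'M[R]_(p + p, m + m)) (l : R) : 'M[R]_(m + m) :=
  N^T *m E1 p *m N - l *: E1 m.
Definition Gmx (R : realType) p m (N : 'M[R]_(p + p, m + m)) (l : R) : 'M[R]_(m + m) :=
  N^T *m E2 p *m N - l *: E2 m.

Section Pencil.
Context {R : realType} (p m : nat).
Variables (N : 'M[R]_(p + p, m + m)) (l : R).
Hypothesis NJ : N *m Jmx m = Jmx p *m N.
Notation F := (Fmx N l).
Notation G := (Gmx N l).
Notation J := (Jmx m).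

Lemma Fmx_tr : F^T = F.
Proof. by rewrite /Fmx trmxB linearZ /= !trmx_mul trmxK !E1_tr mulmxA. Qed.

Lemma Gmx_tr : G^T = G.
Proof. by rewrite /Gmx trmxB linearZ /= !trmx_mul trmxK !E2_tr mulmxA. Qed.

Let NtJ : N^T *m Jmx p = J *m N^T.
Proof.
have /(congr1 trmx) := NJ; rewrite !trmx_mul !Jmx_tr mulNmx mulmxN.
by move/oppr_inj.
Qed.

(** [J] passes through [N] and exchanges the two halves of the coordinates, hence exchanges the two
    coefficients of the pencil. This is the symmetry t -> 1/t of its null points. *)
Lemma Fmx_J : F *m J = J *m G.
Proof.
rewrite /Fmx /Gmx mulmxBl mulmxBr -!mulmxA NJ (mulmxA (E1 p)) E1J -scalemxAl E1J.
by rewrite -scalemxAr !mulmxA NtJ.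
Qed.

Lemma Gmx_J : G *m J = J *m F.
Proof.
rewrite /Fmx /Gmx mulmxBl mulmxBr -!mulmxA NJ (mulmxA (E2 p)) E2J -scalemxAl E2J.
by rewrite -scalemxAr !mulmxA NtJ.
Qed.

Lemma dotJ (u w : 'cV[R]_(m + m)) : dot (J *m u) w = - dot u (J *m w).
Proof. by rewrite dot_mulmx Jmx_tr mulNmx dotNl opprK. Qed.

Lemma dotJJ (u w : 'cV[R]_(m + m)) : dot (J *m u) (J *m w) = dot u w.
Proof. by rewrite dotJ mulmxA JmxK mulNmx mul1mx dotNr opprK. Qed.

Lemma dotJ0 (u : 'cV[R]_(m + m)) : dot u (J *m u) = 0.
Proof. by have := dotJ u u; rewrite dotC; lra. Qed.

(* [J] maps a null vector x of the pencil [t F + G] at t1 to one at 1 / t1, and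
   [F x] is orthogonal to [F (J x)]; moving x and J x along these directions
   makes the pencil positive on a plane. *)
Lemma pencil_plane (t1 t s : R) (x : 'cV[R]_(m + m)) :
  t1 != 0 -> t1 != 1 -> (t1 *: F + G) *m x = 0 ->
  let P := t *: F + G in let D := t - t1 in let th := t1^-1 - t in
  let a := F *m x in let b := - t1 *: (J *m a) in
  let u := x + (s * D) *: a in let w := J *m x - s *: b in
  [/\ dot u (P *m u) = D * dot x a + 2 * s * D ^+ 2 * dot a a +
        s ^+ 2 * D ^+ 2 * dot a (P *m a),
      dot w (P *m w) = th * t1 * dot x a + 2 * s * th * t1 ^+ 2 * dot a a +
        s ^+ 2 * dot b (P *m b),
      dot u (P *m w) = - (s ^+ 2 * D * dot a (P *m b)) &
      dot w (P *m u) = - (s ^+ 2 * D * dot a (P *m b))].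
Proof.
move=> t10 t11 Px P D th a b u w.
have Gx : G *m x = - t1 *: a.
  have := Px; rewrite mulmxDl -scalemxAl addrC => /eqP; rewrite addr_eq0 => /eqP ->.
  by rewrite scaleNr.
have Fy : F *m (J *m x) = b.
  by rewrite mulmxA Fmx_J -mulmxA Gx -scalemxAr.
have Gy : G *m (J *m x) = - t1^-1 *: b.
  by rewrite mulmxA Gmx_J -mulmxA /b scalerA mulNr mulrN opprK mulVf // scale1r.
have PX : P *m x = D *: a.
  by rewrite mulmxDl -scalemxAl Gx -scalerDl.
have PY : P *m (J *m x) = - th *: b.
  by rewrite mulmxDl -scalemxAl Gy Fy -scalerDl; congr (_ *: _); rewrite /th; ring.
have Ps (c e : 'cV[R]_(m + m)) : dot c (P *m e) = dot e (P *m c).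
  by rewrite dot_mulmx dotC /P linearD linearZ /= Fmx_tr Gmx_tr.
(* Evaluating the symmetric form [x.F(J x)] from either side gives [(1 - t1) * x.(J a) = 0]; here
   [t1 != 1] is decisive. *)
have xJa : dot x (J *m a) = 0.
  have : dot x (F *m (J *m x)) = dot a (J *m x).
    by rewrite dot_mulmx Fmx_tr.
  rewrite Fy /b !dotE (dotC a) dotJ => /eqP.
  rewrite -subr_eq0 opprK -[X in _ + X]mul1r -mulrDl mulf_eq0 => /orP[/eqP h|/eqP //].
  by case/eqP: t11; lra.
have xb : dot x b = 0 by rewrite !dotE xJa mulr0.
have ab : dot a b = 0 by rewrite !dotE dotJ0 mulr0.
have ya : dot (J *m x) a = 0 by rewrite dotJ xJa oppr0.
have yb : dot (J *m x) b = - t1 * dot x a by rewrite !dotE dotJJ.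
have bb : dot b b = t1 ^+ 2 * dot a a by rewrite !dotE dotJJ; ring.
have uw : dot u (P *m w) = - (s ^+ 2 * D * dot a (P *m b)).
  rewrite /u /w mulmxBr PY -scalemxAr; clearbody a b D th; rewrite !dotE.
  by rewrite (Ps x b) PX !dotE ab xb (dotC b) ab; ring.
split => //; last by rewrite Ps.
- rewrite /u mulmxDr PX -scalemxAr; clearbody a b D th; rewrite !dotE.
  by rewrite (Ps x a) PX !dotE; ring.
- rewrite /w mulmxBr PY -scalemxAr; clearbody a b D th; rewrite !dotE.
  by rewrite (Ps (J *m x) b) PY !dotE yb bb; ring.
Qed.

End Pencil.

(** In the coordinates [Dg m g *m z] the Gram form shifted by [l] depends on the weight only through
    [g ^+ 2], and affinely. *)
Lemma gram_pencil (R : realType) p m (N : 'M[R]_(p + p, m + m)) l g z : g != 0 ->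
  dot (Tg g N *m (Dg m g *m z)) (Tg g N *m (Dg m g *m z)) -
  l * dot (Dg m g *m z) (Dg m g *m z) = dot z ((g ^+ 2 *: Fmx N l + Gmx N l) *m z).
Proof.
move=> g0; have DD k (u : 'cV[R]_(k + k)) :
    dot (Dg k g *m u) (Dg k g *m u) = g ^+ 2 * dot u (E1 k *m u) + dot u (E2 k *m u).
  by rewrite dot_mulmx Dg_tr mulmxA DgDg mulmxDl -scalemxAl dotC !dotE.
rewrite mulmxA TgE // -mulmxA !DD.
have NE (E : 'M[R]_(p + p)) : dot (N *m z) (E *m (N *m z)) = dot z (N^T *m E *m N *m z).
  by rewrite -!mulmxA [RHS]dot_mulmx trmxK.
rewrite !NE /Fmx /Gmx mulmxDl -scalemxAl !mulmxBl -!scalemxAl !dotE.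
by ring.
Qed.

Lemma dot_plane (R : realType) n (P : 'M[R]_n) (u w : 'cV[R]_n) al be :
  dot (al *: u + be *: w) (P *m (al *: u + be *: w)) =
  al ^+ 2 * dot u (P *m u) + al * be * (dot u (P *m w) + dot w (P *m u)) +
  be ^+ 2 * dot w (P *m w).
Proof. by rewrite mulmxDr -!scalemxAr !dotE; ring. Qed.

(** Since [s * Q <= c2 / 2], the diagonal and the mixed terms lose at most [s * c2 / 2] each out of
    [2 * s * c2]. The first coordinate is weighed by [D], as the form along it is only guaranteed to
    be of order [D ^+ 2]; the mixed term is absorbed by the squares of [al * D + be] and
    [al * D - be]. *)
Lemma plane_form_ge (R : realType) (al be D s c2 Q q A B : R) :
  0 < s -> s * Q <= c2 / 2 -> - Q <= q -> q <= Q ->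
  D ^+ 2 * (2 * s * c2 - s ^+ 2 * Q) <= A -> 2 * s * c2 - s ^+ 2 * Q <= B ->
  s * c2 * (al ^+ 2 * D ^+ 2 + be ^+ 2) <=
  al ^+ 2 * A + be ^+ 2 * B - 2 * (al * be * (s ^+ 2 * D * q)).
Proof.
move=> s0 sQ qQ Qq hA hB.
have := ler_wpM2l (sqr_ge0 al) hA; have := ler_wpM2l (sqr_ge0 be) hB.
have qp : 0 <= s ^+ 2 * ((Q - q) * (al * D + be) ^+ 2 + (Q + q) * (al * D - be) ^+ 2).
  by rewrite mulr_ge0 ?sqr_ge0 // addr_ge0 // mulr_ge0 ?sqr_ge0 //; lra.
have := ler_wpM2l (addr_ge0 (sqr_ge0 (al * D)) (sqr_ge0 be))
  (ler_wpM2l (ltW s0) sQ).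
move: qp; rewrite !exprMn !expr2 => *; lra.
Qed.

(** The plane of [pencil_plane] is fed to [lam2_ge]. Up to a positive factor [dot x (F x)] is the
    derivative of the eigenvalue in [g ^+ 2], so the two sign hypotheses are the first-order
    conditions at a minimizer [g1 < 1] over an interval; they allow the linear terms of the form to
    be dropped. The bound [c1] keeps the second null point [1 / g1 ^+ 2] away from [g ^+ 2]. *)
Lemma pencil_growth (R : realType) p m (Gam c0 c1 KB : R) :
  (0 < p)%N -> (0 < m)%N -> 0 < Gam -> 0 < c0 -> 0 < c1 -> 0 < KB ->
  exists2 c : R, 0 < c & forall (N : 'M[R]_(p + p, m + m)) l (x : 'cV[R]_(m + m)) g1 g,
    N *m Jmx m = Jmx p *m N -> nrm N <= KB -> `|l| <= KB -> nrm x <= KB ->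
    Gam <= g1 < 1 -> Gam <= g <= 1 -> g != g1 ->
    c1 <= (g1 ^+ 2)^-1 - g ^+ 2 ->
    (g1 ^+ 2 *: Fmx N l + Gmx N l) *m x = 0 ->
    c0 <= dot (Fmx N l *m x) (Fmx N l *m x) ->
    0 <= dot x (Fmx N l *m x) ->
    0 <= (g ^+ 2 - g1 ^+ 2) * dot x (Fmx N l *m x) ->
    l + c * (g ^+ 2 - g1 ^+ 2) ^+ 2 <= lam2 (Tg g N).
Proof.
move=> p0 m0 Gam0 c00 c10 KB0.
pose e : R := nrm (@E1 R p) + nrm (@E2 R p) + nrm (@E1 R m) + nrm (@E2 R m) +
  nrm (@Jmx R m).
have e1p : nrm (@E1 R p) <= e.
  by rewrite /e -!addrA lerDl !addr_ge0 ?nrm_ge0.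
have e2p : nrm (@E2 R p) <= e.
  by rewrite /e -!addrA addrCA lerDl !addr_ge0 ?nrm_ge0.
have e12m : nrm (@E1 R m) + nrm (@E2 R m) <= e.
  have := nrm_ge0 (@E1 R p); have := nrm_ge0 (@E2 R p); have := nrm_ge0 (@Jmx R m).
  by rewrite /e; lra.
have ej : nrm (@Jmx R m) <= e by rewrite /e lerDr !addr_ge0 ?nrm_ge0.
have e0 : 0 <= e by apply: le_trans ej; exact: nrm_ge0.
have e1m : nrm (@E1 R m) <= e by have := nrm_ge0 (@E2 R m); lra.
have e2m : nrm (@E2 R m) <= e by have := nrm_ge0 (@E1 R m); lra.
clearbody e.
(* [KF] is to bound [F] and [G], [Ka] the vector [a], and [Kb] both [a] and [b]. *)
pose KF := KB * e * KB + KB * e; pose Ka := KF * KB; pose Kb := Ka + e * Ka.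
have KF0 : 0 <= KF by rewrite addr_ge0 // !mulr_ge0 // ltW.
have Ka0 : 0 <= Ka by rewrite mulr_ge0 // ltW.
have Kb0 : 0 <= Kb by rewrite addr_ge0 // mulr_ge0.
pose Q := Kb * (2 * KF) * Kb.
have Q0 : 0 <= Q by rewrite !mulr_ge0.
(* A common lower bound for the gains along the plane: [dot a a >= c0] for [u], after division by
   [D ^+ 2], and [th * t1 ^+ 2 * dot a a >= c1 * Gam ^+ 4 * c0] for [w]. *)
pose c2 := Num.min c0 (c1 * Gam ^+ 4 * c0).
have c20 : 0 < c2 by rewrite lt_min c00 !mulr_gt0 // exprn_gt0.
pose s := c2 / (2 * (Q + 1)).
have s0 : 0 < s by rewrite divr_gt0 // mulr_gt0 // ltr_wpDl.
have sQ : s * Q <= c2 / 2.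
  have Q1 : 0 < Q + 1 by rewrite ltr_wpDl.
  have -> : s * Q = c2 / 2 * (Q / (Q + 1)) by rewrite /s; field; rewrite gt_eqF.
  by rewrite ler_piMr ?divr_ge0 ?(ltW c20) // ler_pdivrMr // mul1r lerDl.
have c2le1 : c2 <= c0 by rewrite ge_min lexx.
have c2le2 : c2 <= c1 * Gam ^+ 4 * c0 by rewrite ge_min lexx orbT.
clearbody s c2.
pose Kz := KB + e * KB + s * Kb.
have Kz0 : 0 <= Kz by rewrite !addr_ge0 ?mulr_ge0 // ltW.
(* [Kz] bounds [u] and [w], and [KE] bounds the squared length of [Dg m g *m (al *: u + be *: w)]
   relative to [al ^+ 2 + be ^+ 2]; this converts growth in the pencil coordinates into growth in
   the original ones. *)
pose KE := e * (2 * Kz ^+ 2) + 1.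
have KE0 : 0 < KE by rewrite ltr_wpDl // mulr_ge0 // mulr_ge0 // sqr_ge0.
exists (s * c2 / KE); first by rewrite divr_gt0 // mulr_gt0.
move=> N l x g1 g NJ nN nl nx /andP[Gg1 g11] /andP[Gg g_le1] gg1 th_ge Px a_ge F0 DF0.
have g10 := lt_le_trans Gam0 Gg1; have g0 := lt_le_trans Gam0 Gg.
set t1 := g1 ^+ 2 in th_ge Px DF0 *; set t := g ^+ 2 in th_ge DF0 *.
have t1_lt1 : t1 < 1 by rewrite expr_lt1 // ltW.
have t_le1 : t <= 1 by rewrite expr_le1 // ltW.
have t10 : 0 < t1 by rewrite exprn_gt0.
have t0 : 0 < t by rewrite exprn_gt0.
have t1G : Gam ^+ 4 <= t1 ^+ 2.
  by rewrite -exprM; apply: lerXn2r; rewrite ?nnegrE ?(ltW g10) ?(ltW Gam0).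
have D0 : t - t1 != 0.
  by rewrite subr_eq0 eqrXn2 // ltW.
have D1 : (t - t1) ^+ 2 <= 1 by rewrite expr2; nra.
have t1n0 : t1 != 0 by rewrite gt_eqF.
have t1n1 : t1 != 1 by rewrite lt_eqF.
have [uu ww uw wu] := pencil_plane NJ t s t1n0 t1n1 Px.
move: uu ww uw wu.
set F := Fmx N l in Px a_ge F0 DF0 *; set G := Gmx N l in Px *.
set P := t *: F + G; set a := F *m x in a_ge F0 DF0 *; set b := - t1 *: _.
set u := x + _; set w := _ - s *: b; set D := t - t1 in D0 D1 DF0 *.
set th := t1^-1 - t in th_ge *.
move=> uu ww uw wu.
have nNEN (E : 'M[R]_(p + p)) (E' : 'M[R]_(m + m)) : nrm E <= e -> nrm E' <= e ->
    nrm (N^T *m E *m N - l *: E') <= KF.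
  move=> nE nE'; apply: le_trans (nrmB _ _) _; apply: lerD.
    apply: le_trans (nrmM _ _) _; apply: ler_pM => //; rewrite ?nrm_ge0 //.
    apply: le_trans (nrmM _ _) _; rewrite nrm_tr.
    by apply: ler_pM => //; rewrite nrm_ge0.
  by rewrite nrmZ; apply: ler_pM => //; rewrite nrm_ge0.
have nF : nrm F <= KF by exact: nNEN.
have nG : nrm G <= KF by exact: nNEN.
have nP : nrm P <= 2 * KF.
  apply: le_trans (nrmD _ _) _; rewrite nrmZ ger0_norm ?(ltW t0) //.
  have : t * nrm F <= 1 * KF by apply: ler_pM => //; rewrite ?nrm_ge0 // ltW.
  by lra.
have na : nrm a <= Ka.
  by apply: le_trans (nrmM _ _) _; apply: ler_pM => //; rewrite nrm_ge0.
have nb : nrm b <= e * Ka.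
  rewrite /b nrmZ normrN ger0_norm ?(ltW t10) //.
  apply: (@le_trans _ _ (nrm (Jmx m *m a))).
    by rewrite ler_piMl ?nrm_ge0 // ltW.
  by apply: le_trans (nrmM _ _) _; apply: ler_pM => //; rewrite nrm_ge0.
have eKa : 0 <= e * Ka by rewrite mulr_ge0.
have naKb : nrm a <= Kb by rewrite (le_trans na) // lerDl.
have nbKb : nrm b <= Kb by rewrite (le_trans nb) // lerDr.
have quadQ (c d : 'cV[R]_(m + m)) : nrm c <= Kb -> nrm d <= Kb ->
    `|dot c (P *m d)| <= Q.
  move=> nc nd; apply: le_trans (dot_le_nrm _ _) _.
  apply: le_trans (ler_wpM2l (nrm_ge0 _) (nrmM _ _)) _; rewrite mulrA.
  apply: ler_pM => //; rewrite ?mulr_ge0 ?nrm_ge0 //.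
  by apply: ler_pM => //; rewrite nrm_ge0.
have := quadQ _ _ naKb naKb; have := quadQ _ _ nbKb nbKb; have := quadQ _ _ naKb nbKb.
rewrite !ler_norml => /andP[ab1 ab2] /andP[bb1 _] /andP[aa1 _].
have form_ge (al be : R) : s * c2 * (al ^+ 2 * D ^+ 2 + be ^+ 2) <=
    dot (al *: u + be *: w) (P *m (al *: u + be *: w)).
  have A_ge : D ^+ 2 * (2 * s * c2 - s ^+ 2 * Q) <= dot u (P *m u).
    rewrite uu; have := ler_wpM2l (mulr_ge0 (ltW s0) (sqr_ge0 D)) (le_trans c2le1 a_ge).
    have := ler_wpM2l (mulr_ge0 (sqr_ge0 s) (sqr_ge0 D)) aa1.
    by move: DF0; clear; move: (dot x a) (dot a a) (dot a _) => *; lra.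
  have B_ge : 2 * s * c2 - s ^+ 2 * Q <= dot w (P *m w).
    rewrite ww; have th0 : 0 <= th * t1 * dot x a.
      by apply: mulr_ge0 F0; apply: mulr_ge0 (ltW t10); apply: le_trans th_ge; exact: ltW.
    have c2b : c2 <= th * t1 ^+ 2 * dot a a.
      apply: le_trans c2le2 _; apply: ler_pM => //; first 2 last.
      - by apply: ler_pM => //; rewrite ?exprn_ge0 ?(ltW c10) ?(ltW Gam0).
      - by rewrite mulr_ge0 ?exprn_ge0 ?(ltW c10) ?(ltW Gam0).
      - exact: ltW.
    have := ler_wpM2l (ltW s0) c2b; have := ler_wpM2l (sqr_ge0 s) bb1.
    by move: th0; clear; move: (dot x a) (dot a a) (dot b _) => *; lra.
  apply: le_trans (plane_form_ge al be s0 sQ ab1 ab2 A_ge B_ge) _.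
  by rewrite dot_plane uw wu; move: (dot u _) (dot w _) (dot a _); clear => *; lra.
have sKb : 0 <= s * Kb by rewrite mulr_ge0 // ltW.
have nD1 : `|D| <= 1 by rewrite -(@expr_le1 _ 2) // -normrX ger0_norm // sqr_ge0.
have nu : nrm u <= Kz.
  apply: le_trans (nrmD _ _) _; rewrite nrmZ normrM (ger0_norm (ltW s0)).
  have : `|D| * nrm a <= 1 * Kb.
    by apply: ler_pM => //; rewrite ?nrm_ge0.
  move=> /(ler_wpM2l (ltW s0)); have := mulr_ge0 e0 (ltW KB0); rewrite /Kz -/D.
  by move: nx sKb; clear; lra.
have nw : nrm w <= Kz.
  apply: le_trans (nrmB _ _) _; rewrite nrmZ (ger0_norm (ltW s0)).
  have := ler_wpM2l (ltW s0) nbKb.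
  have : nrm (Jmx m *m x) <= e * KB.
    by apply: le_trans (nrmM _ _) _; apply: ler_pM; rewrite ?nrm_ge0.
  by rewrite /Kz; move: KB0 sKb; clear; lra.
have D2 : 0 < D ^+ 2 by rewrite lt_def sqrf_eq0 D0 sqr_ge0.
have form_ge' (al be : R) : s * c2 * (D ^+ 2 * (al ^+ 2 + be ^+ 2)) <=
    dot (al *: u + be *: w) (P *m (al *: u + be *: w)).
  apply: le_trans (form_ge al be); rewrite ler_wpM2l ?mulr_ge0 ?(ltW s0) ?(ltW c20) //.
  by have := ler_wpM2r (sqr_ge0 be) D1; clear; lra.
have EzKE (al be : R) : let z := Dg m g *m (al *: u + be *: w) in
    dot z z <= KE * (al ^+ 2 + be ^+ 2).
  rewrite /= dot_mulmx Dg_tr mulmxA DgDg dotC.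
  apply: le_trans (ler_norm _) _; apply: le_trans (dot_le_nrm _ _) _.
  have nz : nrm (al *: u + be *: w) <= (`|al| + `|be|) * Kz.
    apply: le_trans (nrmD _ _) _; rewrite !nrmZ mulrDl.
    by apply: lerD; rewrite ler_wpM2l.
  have nE : nrm (t *: E1 m + E2 m) <= e.
    apply: le_trans (nrmD _ _) _; rewrite nrmZ ger0_norm ?(ltW t0) //.
    by have := ler_wpM2r (nrm_ge0 (@E1 R m)) t_le1; move: e12m; clear; lra.
  move: nz; set z := _ + _ => nz.
  apply: (@le_trans _ _ (e * ((`|al| + `|be|) * Kz) ^+ 2)).
    apply: le_trans (ler_wpM2l (nrm_ge0 _) (nrmM _ _)) _.
    rewrite expr2 mulrCA; apply: ler_pM; rewrite ?mulr_ge0 ?nrm_ge0 //.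
    by apply: ler_pM; rewrite ?nrm_ge0.
  apply: (@le_trans _ _ (e * (2 * Kz ^+ 2 * (al ^+ 2 + be ^+ 2)))).
    rewrite ler_wpM2l // exprMn -(real_normK (num_real al)) -(real_normK (num_real be)).
    have := mulr_ge0 (sqr_ge0 Kz) (sqr_ge0 (`|al| - `|be|)).
    by clear; rewrite !expr2; lra.
  rewrite /KE mulrA [X in _ <= X]mulrDl mul1r mulrA.
  by rewrite !mulrA lerDl addr_ge0 ?sqr_ge0.
have combo (y z : 'cV[R]_(m + m)) (al be : R) :
    al *: (Dg m g *m y) + be *: (Dg m g *m z) = Dg m g *m (al *: y + be *: z).
  by rewrite mulmxDr -!scalemxAr.
have gn0 : g != 0 by rewrite gt_eqF.
apply: (@lam2_ge _ _ _ _ _ _ (Dg m g *m u) (Dg m g *m w)).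
- exact: (leq_add p0 p0).
- exact: (leq_add m0 m0).
- move=> al be; rewrite combo => /(congr1 (mulmx (Dg m g^-1))).
  rewrite mulmxA DgK // mul1mx mulmx0 => z0.
  have := form_ge' al be; rewrite z0 mulmx0 dot0l pmulr_rle0 ?mulr_gt0 //.
  rewrite pmulr_rle0 // => ab0.
  have := sqr_ge0 al; have := sqr_ge0 be => be2 al2.
  by split; apply/eqP; rewrite -sqrf_eq0 eq_le sqr_ge0 andbT; move: ab0 al2 be2; clear; lra.
- move=> al be /=; rewrite combo mulrDl.
  have := gram_pencil N l (al *: u + be *: w) gn0; rewrite -/F -/G -/t -/P => gp.
  have := EzKE al be => /= Ez.
  have cD0 : 0 <= s * c2 / KE * D ^+ 2.
    by rewrite mulr_ge0 ?sqr_ge0 // divr_ge0 ?mulr_ge0 ?ltW.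
  have := ler_wpM2l cD0 Ez.
  have -> : s * c2 / KE * D ^+ 2 * (KE * (al ^+ 2 + be ^+ 2)) =
     s * c2 * (D ^+ 2 * (al ^+ 2 + be ^+ 2)).
    by field; rewrite gt_eqF.
  by move=> h; have := form_ge' al be; rewrite -gp; move: h; clear; lra.
Qed.

(** * Null vectors of the pencil as functions of the matrix and the weight *)

Section PencilEigenvectors.
Context {R : realType} (p m : nat).
Implicit Types (N : 'M[R]_(p + p, m + m)) (g l : R).

Lemma pencilE N l g : g != 0 ->
  g ^+ 2 *: Fmx N l + Gmx N l =
  Dg m g *m ((Tg g N)^T *m Tg g N - l%:M) *m Dg m g.
Proof.
move=> g0; rewrite mulmxBr mulmxBl mul_mx_scalar -scalemxAl DgDg.
have -> : Dg m g *m ((Tg g N)^T *m Tg g N) *m Dg m g =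
    N^T *m (g ^+ 2 *: E1 p + E2 p) *m N.
  rewrite -DgDg !mulmxA -{1}(Dg_tr m g) -trmx_mul TgE // -!mulmxA TgE //.
  by rewrite trmx_mul Dg_tr !mulmxA.
rewrite /Fmx /Gmx mulmxDr mulmxDl -scalemxAr -scalemxAl.
by mxring.
Qed.

Lemma pencil_eigenvector N l g (v : 'cV[R]_(m + m)) : g != 0 ->
  (Tg g N)^T *m Tg g N *m v = l *: v ->
  (g ^+ 2 *: Fmx N l + Gmx N l) *m (Dg m g^-1 *m v) = 0.
Proof.
move=> g0 Tv; rewrite pencilE // -!mulmxA [Dg m g *m (_ *m v)]mulmxA.
have -> : Dg m g *m Dg m g^-1 = 1%:M by rewrite -{1}[g]invrK DgK ?invr_eq0.
rewrite mul1mx mulmxBl Tv mul_scalar_mx subrr.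
by rewrite mulmx0.
Qed.

Lemma eigenvector_pencil N l g (x : 'cV[R]_(m + m)) : g != 0 ->
  (g ^+ 2 *: Fmx N l + Gmx N l) *m x = 0 ->
  (Tg g N)^T *m Tg g N *m (Dg m g *m x) = l *: (Dg m g *m x).
Proof.
move=> g0; rewrite pencilE // -!mulmxA => /(congr1 (mulmx (Dg m g^-1))).
rewrite mulmxA DgK // mul1mx mulmx0 mulmxBl mul_scalar_mx -mulmxA => /eqP.
by rewrite subr_eq0 => /eqP.
Qed.

Lemma nrm_Dg_sub g g' : nrm (Dg m g - Dg m g') = `|g - g'| * nrm (1%:M : 'M[R]_m).
Proof.
rewrite /Dg opp_block_mx add_block_mx nrm_block !subrr !nrm0 !addr0.
by rewrite -[g%:M]scalemx1 -[g'%:M]scalemx1 -scalerBl nrmZ.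
Qed.

Lemma Tg_near Gam g g' N N' : 0 < Gam -> Gam <= g <= 1 -> Gam <= g' <= 1 ->
  nrm (Tg g N - Tg g' N') <=
  Gam^-2 * (nrm (N - N') + `|g - g'| * nrm N').
Proof.
move=> G0 gO g'O; rewrite -(subrK (Tg g N') (Tg g N)) -addrA -Tg_sub.
apply: le_trans (nrmD _ _) _; rewrite mulrDr mulrA; apply: lerD.
  exact: nrm_Tg.
exact: nrm_Tg_sub.
Qed.

End PencilEigenvectors.

Lemma pencil_field (R : realType) p m (Gam g0 : R) (N0 : 'M[R]_(p + p, m + m)) :
  (0 < p)%N -> (0 < m)%N -> 0 < Gam -> Gam <= g0 <= 1 ->
  simple_singval (cplxmx (Tg g0 N0)) (singval (cplxmx (Tg g0 N0)) 2) ->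
  0 < lam2 (Tg g0 N0) ->
  exists (x : 'M[R]_(p + p, m + m) -> R -> 'cV[R]_(m + m)) (rho C : R),
  [/\ 0 < rho, 0 < C,
   (forall N g, nrm (N - N0) < rho -> `|g - g0| < rho -> Gam <= g <= 1 ->
     (g ^+ 2 *: Fmx N (lam2 (Tg g N)) + Gmx N (lam2 (Tg g N))) *m x N g = 0 /\
     nrm (x N g) <= C),
   (forall N g N' g', nrm (N - N0) < rho -> `|g - g0| < rho -> Gam <= g <= 1 ->
     nrm (N' - N0) < rho -> `|g' - g0| < rho -> Gam <= g' <= 1 ->
     [/\ nrm (x N g - x N' g') <= C * (nrm (N - N') + `|g - g'|),
         `|lam2 (Tg g N) - lam2 (Tg g' N')| <= C * (nrm (N - N') + `|g - g'|) &
         1 / 2 <= dot (Dg m g *m x N g) (Dg m g' *m x N' g')]) &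
   (forall g l (y : 'cV[R]_(m + m)), `|g - g0| < rho -> Gam <= g <= 1 ->
     `|l - lam2 (Tg g0 N0)| < rho -> y != 0 ->
     (g ^+ 2 *: Fmx N0 l + Gmx N0 l) *m y = 0 -> l = lam2 (Tg g N0))].
Proof.
move=> p_gt0 m_gt0 Gam_gt0 g0_Omega simple0 lam2_gt0.
have pp_gt1 : (1 < p + p)%N by exact: (leq_add p_gt0 p_gt0).
have mm_gt1 : (1 < m + m)%N by exact: (leq_add m_gt0 m_gt0).
have [ev [rho0 [K [rho00 K0 evP evL evU]]]] :=
  lam2_eigenvector_field pp_gt1 mm_gt1 simple0 lam2_gt0.
pose L := Gam^-2; pose b := nrm N0 + 1.
have L0 : 0 < L by rewrite invr_gt0 exprn_gt0.
have b1 : 1 <= b by rewrite lerDr nrm_ge0.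
have b0 : 0 < b by apply: lt_le_trans b1.
(* Keeps [Tg g N] within [rho0] of [Tg g0 N0]: the distance is at most [2 * L * b * rho]. *)
pose rho := Num.min 1 (rho0 / (4 * (1 + L * b))).
have Lb : 0 < 1 + L * b by rewrite ltr_wpDr ?mulr_ge0 ?ltW.
have rho_gt0 : 0 < rho by rewrite lt_min ltr01 divr_gt0 // mulr_gt0.
have rho1 : rho <= 1 by rewrite ge_min lexx.
have rhoE : 4 * (1 + L * b) * rho <= rho0.
  have : rho <= rho0 / (4 * (1 + L * b)) by rewrite ge_min lexx orbT.
  by rewrite ler_pdivlMr ?mulr_gt0 // mulrC.
have rho_le : rho <= rho0.
  have : 0 <= L * b * rho by rewrite !mulr_ge0 // ltW.
  by move: rho_gt0 rhoE; clear; lra.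
have gpos g : Gam <= g <= 1 -> 0 < g by case/andP=> Gg _; apply: lt_le_trans Gg.
have gn0 g : Gam <= g <= 1 -> g != 0 by move/gpos => g_gt0; rewrite gt_eqF.
have nN N : nrm (N - N0) < rho -> nrm N <= b.
  move=> nN; rewrite -[N](subrK N0) addrC; apply: le_trans (nrmD _ _) _.
  by rewrite lerD2l ltW // (lt_le_trans nN).
have g0z : `|g0 - g0| < rho by rewrite subrr normr0.
have N0z : nrm (N0 - N0) < rho by rewrite subrr nrm0.
have nTT N g N' g' : nrm (N' - N0) < rho -> Gam <= g <= 1 -> Gam <= g' <= 1 ->
    nrm (Tg g N - Tg g' N') <= L * b * (nrm (N - N') + `|g - g'|).
  move=> nN' gO g'O; apply: le_trans (Tg_near _ _ Gam_gt0 gO g'O) _.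
  rewrite -mulrA ler_wpM2l ?(ltW L0) // mulrDr; apply: lerD.
    by rewrite ler_peMl ?nrm_ge0.
  by rewrite mulrC ler_wpM2r // nN.
have near N g : nrm (N - N0) < rho -> `|g - g0| < rho -> Gam <= g <= 1 ->
    nrm (Tg g N - Tg g0 N0) < rho0.
  move=> hN hg gO; apply: le_lt_trans (nTT _ _ _ _ N0z gO g0_Omega) _.
  have : L * b * (nrm (N - N0) + `|g - g0|) <= L * b * (rho + rho).
    by rewrite ler_wpM2l ?lerD ?ltW // mulr_gt0.
  have : 0 <= L * b * rho by rewrite !mulr_ge0 // ltW.
  by move: rhoE rho_gt0; clear; lra.
pose n1 := nrm (1%:M : 'M[R]_m).
have n10 : 0 <= n1 by exact: nrm_ge0.
have gV g : Gam <= g <= 1 -> 1 <= g^-1 <= L.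
  move=> gO; have /andP[Gg g1] := gO; have g_gt0 := gpos _ gO.
  rewrite invf_ge1 // g1 /=; apply: (@le_trans _ _ Gam^-1); first by rewrite lef_pV2.
  by rewrite lef_pV2 ?posrE ?exprn_gt0 // expr2 ler_piMl ?(ltW Gam_gt0) // (le_trans Gg).
have nD g : Gam <= g <= 1 -> nrm (Dg m g^-1) <= 2 * L * n1.
  move=> gO; have /andP[gV1 gVL] := gV _ gO.
  rewrite /Dg nrm_block !nrm0 !addr0 -[g^-1%:M]scalemx1 nrmZ ger0_norm ?(le_trans ler01) //.
  have := ler_wpM2r n10 (le_trans gV1 gVL); have := ler_wpM2r n10 gVL.
  by rewrite -/n1; clear; lra.
have nDD g g' : Gam <= g <= 1 -> Gam <= g' <= 1 ->
    nrm (Dg m g^-1 - Dg m g'^-1) <= L * `|g - g'| * n1.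
  move=> gO g'O; rewrite nrm_Dg_sub ler_wpM2r //.
  have g_gt0 := gpos _ gO; have g'_gt0 := gpos _ g'O.
  have -> : g^-1 - g'^-1 = - ((g * g')^-1 * (g - g')) by field; rewrite !gt_eqF.
  rewrite normrN normrM ler_wpM2r // ger0_norm ?invr_ge0 ?mulr_ge0 ?(ltW g_gt0) ?(ltW g'_gt0) //.
  have /andP[Gg _] := gO; have /andP[Gg' _] := g'O.
  by rewrite lef_pV2 ?posrE ?exprn_gt0 ?mulr_gt0 // expr2 ler_pM ?(ltW Gam_gt0).
pose x N g := Dg m g^-1 *m ev (Tg g N).
have Dx N g : Gam <= g <= 1 -> Dg m g *m x N g = ev (Tg g N).
  move=> gO; rewrite mulmxA.
  have -> : Dg m g *m Dg m g^-1 = 1%:M.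
    by rewrite -{1}[g]invrK DgK ?invr_eq0 ?gn0.
  by rewrite mul1mx.
pose C1 := 2 * L * n1 * K; pose C2 := L * n1 * K + 2 * L * n1 * (K * (L * b)).
pose C3 := (L * b + L * b) * (L * b).
have C10 : 0 <= C1 by rewrite !mulr_ge0 // ltW.
have C20 : 0 <= C2 by rewrite addr_ge0 ?mulr_ge0 // ltW // mulr_gt0.
have C30 : 0 <= C3 by rewrite mulr_ge0 ?addr_ge0 ?mulr_ge0 // ltW.
exists x, rho, (C1 + C2 + C3 + 1); split => //.
- by move: C10 C20 C30; clear; lra.
- move=> N g hN hg gO; have [Te _ ne] := evP _ (near _ _ hN hg gO); split.
    exact: (pencil_eigenvector (gn0 _ gO) Te).
  apply: (@le_trans _ _ C1); last by move: C20 C30; clear; lra.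
  apply: le_trans (nrmM _ _) _; apply: ler_pM; rewrite ?nrm_ge0 //.
  exact: nD.
- move=> N g N' g' hN hg gO hN' hg' g'O.
  have nT := near _ _ hN hg gO; have nT' := near _ _ hN' hg' g'O.
  have [_ _ ne] := evP _ nT; have [ed e12] := evL _ _ nT nT'.
  have nTd := nTT _ g _ g' hN' gO g'O.
  have e0 : 0 <= nrm (N - N') + `|g - g'| by rewrite addr_ge0 ?nrm_ge0.
  split; last by rewrite !Dx.
  + have -> : x N g - x N' g' = (Dg m g^-1 - Dg m g'^-1) *m ev (Tg g N) +
        Dg m g'^-1 *m (ev (Tg g N) - ev (Tg g' N')).
      by rewrite mulmxBl mulmxBr addrA subrK.
    apply: (@le_trans _ _ (C2 * (nrm (N - N') + `|g - g'|))); last first.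
      by rewrite ler_wpM2r //; move: C10 C30; clear; lra.
    apply: le_trans (nrmD _ _) _; rewrite mulrDl; apply: lerD.
      apply: le_trans (nrmM _ _) _.
      apply: (@le_trans _ _ (L * `|g - g'| * n1 * K)).
        by apply: ler_pM; rewrite ?nrm_ge0 // nDD.
      rewrite -mulrA (mulrAC L) mulrA ler_wpM2l ?mulr_ge0 ?(ltW L0) ?(ltW K0) //.
      by rewrite lerDr nrm_ge0.
    apply: le_trans (nrmM _ _) _; rewrite -mulrA; apply: ler_pM; rewrite ?nrm_ge0 //.
      exact: nD.
    apply: le_trans ed _; rewrite -mulrA ler_wpM2l // ?(ltW K0) //.
  + apply: (@le_trans _ _ (C3 * (nrm (N - N') + `|g - g'|))); last first.
      by rewrite ler_wpM2r //; move: C10 C20; clear; lra.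
    apply: le_trans (lam2_weyl pp_gt1 mm_gt1 _ _) _.
    apply: le_trans (gram_sub_le _ _) _; rewrite -mulrA.
    have nTb (M : 'M[R]_(p + p, m + m)) h : nrm (M - N0) < rho -> Gam <= h <= 1 ->
        nrm (Tg h M) <= L * b.
      move=> hM hO; apply: le_trans (nrm_Tg _ Gam_gt0 hO) _.
      by rewrite ler_wpM2l ?(ltW L0) // nN.
    by apply: ler_pM; rewrite ?addr_ge0 ?nrm_ge0 // lerD // nTb.
- move=> g l y hg gO hl y0 Py.
  have := evU (Tg g N0) l (Dg m g *m y) (near _ _ N0z hg gO) (lt_le_trans hl rho_le).
  apply; first exact: eigenvector_pencil (gn0 _ gO) Py.
  apply: contra y0 => /eqP Dy; apply/eqP.
  by rewrite -[y]mul1mx -(DgK m (gn0 _ gO)) -mulmxA Dy mulmx0.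
Qed.

(** Both null vectors are inserted into the symmetric pencil with the new weight and the old
    eigenvalue; this yields the derivative of the eigenvalue in [g ^+ 2] as an exact difference
    quotient. *)
Lemma pencil_step (R : realType) p m (N : 'M[R]_(p + p, m + m)) l l' g g'
    (x x' : 'cV[R]_(m + m)) :
  (g ^+ 2 *: Fmx N l + Gmx N l) *m x = 0 ->
  (g' ^+ 2 *: Fmx N l' + Gmx N l') *m x' = 0 ->
  (g' ^+ 2 - g ^+ 2) * dot (Fmx N l *m x) x' =
  (l' - l) * dot (Dg m g' *m x) (Dg m g' *m x').
Proof.
move=> Px Px'.
have PX : (g' ^+ 2 *: Fmx N l + Gmx N l) *m x = (g' ^+ 2 - g ^+ 2) *: (Fmx N l *m x).
  move: (Fmx N l) (Gmx N l) Px => F G; rewrite !mulmxDl -!scalemxAl scalerBl => /eqP.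
  by rewrite addrC addr_eq0 => /eqP ->.
have PX' : (g' ^+ 2 *: Fmx N l + Gmx N l) *m x' =
    (l' - l) *: (Dg m g' *m (Dg m g' *m x')).
  rewrite mulmxA DgDg scalemxAl -[LHS]subr0 -Px' -mulmxBl; congr (_ *m _).
  by rewrite /Fmx /Gmx; mxring.
have : dot x ((g' ^+ 2 *: Fmx N l + Gmx N l) *m x') =
    dot ((g' ^+ 2 *: Fmx N l + Gmx N l) *m x) x'.
  rewrite dot_mulmx [X in X *m x]linearD linearZ /= Fmx_tr Gmx_tr //.
rewrite PX PX' !dotE => <-; rewrite dot_mulmx Dg_tr //.
Qed.

Lemma ge0_of_linear (R : realType) (y K h1 : R) : 0 < h1 -> 0 <= K ->
  (forall h, 0 < h < h1 -> - (K * h) <= y) -> 0 <= y.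
Proof.
move=> h10 K0 hy; rewrite leNgt; apply/negP => y0.
have K1 : 0 < K + 1 by rewrite ltr_wpDl.
pose h := Num.min (h1 / 2) (- y / (2 * (K + 1))).
have h_gt0 : 0 < h by rewrite lt_min !divr_gt0 ?mulr_gt0 ?oppr_gt0.
have h_le1 : h <= h1 / 2 by rewrite ge_min lexx.
have : h <= - y / (2 * (K + 1)) by rewrite ge_min lexx orbT.
rewrite ler_pdivlMr ?mulr_gt0 // => hK.
have : 0 < h < h1 by rewrite h_gt0 /=; lra.
by move=> /hy; lra.
Qed.

Lemma nrm_pencil_sub (R : realType) k r (E : 'M[R]_k) (E' : 'M[R]_r)
    (N N' : 'M[R]_(k, r)) l l' :
  nrm ((N^T *m E *m N - l *: E') - (N'^T *m E *m N' - l' *: E')) <=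
  (nrm N + nrm N') * nrm E * nrm (N - N') + `|l - l'| * nrm E'.
Proof.
have -> : (N^T *m E *m N - l *: E') - (N'^T *m E *m N' - l' *: E') =
    (N^T *m E *m (N - N') + (N - N')^T *m E *m N') - (l - l') *: E'.
  by rewrite trmxB mulmxBr !mulmxBl; mxring.
apply: le_trans (nrmB _ _) _; rewrite nrmZ lerD2r.
apply: le_trans (nrmD _ _) _; rewrite mulrDl mulrDl; apply: lerD.
  apply: le_trans (nrmM _ _) _; rewrite ler_wpM2r ?nrm_ge0 //.
  by rewrite -(nrm_tr N) nrmM.
apply: le_trans (nrmM _ _) _.
rewrite [X in _ <= X](_ : _ = nrm (N - N') * nrm E * nrm N'); last by ring.
by rewrite ler_wpM2r ?nrm_ge0 // -(nrm_tr (N - N')) nrmM.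
Qed.

(** * First-order conditions and growth near the optimal weight *)

Section Growth.
Context {R : realType} (p m : nat) (Gam g0 : R) (N0 : 'M[R]_(p + p, m + m)).
Variables (x : 'M[R]_(p + p, m + m) -> R -> 'cV[R]_(m + m)) (rho C : R).
Notation f := (fun N g => lam2 (Tg g N)).

Hypothesis Gam_gt0 : 0 < Gam.
Hypotheses (C_gt0 : 0 < C).
Hypothesis x_null : forall N g,
  nrm (N - N0) < rho -> `|g - g0| < rho -> Gam <= g <= 1 ->
  (g ^+ 2 *: Fmx N (f N g) + Gmx N (f N g)) *m x N g = 0 /\ nrm (x N g) <= C.
Hypothesis x_lip : forall N g N' g',
  nrm (N - N0) < rho -> `|g - g0| < rho -> Gam <= g <= 1 ->
  nrm (N' - N0) < rho -> `|g' - g0| < rho -> Gam <= g' <= 1 ->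
  [/\ nrm (x N g - x N' g') <= C * (nrm (N - N') + `|g - g'|),
      `|f N g - f N' g'| <= C * (nrm (N - N') + `|g - g'|) &
      1 / 2 <= dot (Dg m g *m x N g) (Dg m g' *m x N' g')].

(** By [pencil_step], the inequality [f N g <= f N g'] fixes the sign of the product with [x N g'],
    and the Lipschitz field trades [x N g'] for [x N g] at a cost linear in the step. The threshold
    [h0] keeps the inner product in [pencil_step] nonnegative although both of its factors use the
    weight [g']. *)
Lemma minimizer_first_order : exists2 h0 : R, 0 < h0 & forall N g g',
  nrm (N - N0) < rho -> `|g - g0| < rho -> Gam <= g <= 1 ->
  `|g' - g0| < rho -> Gam <= g' <= 1 -> `|g' - g| < h0 -> f N g <= f N g' ->
  - (`|g' ^+ 2 - g ^+ 2| * (nrm (Fmx N (f N g) *m x N g) * (C * `|g' - g|))) <=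
  (g' ^+ 2 - g ^+ 2) * dot (Fmx N (f N g) *m x N g) (x N g).
Proof.
pose n1 := nrm (1%:M : 'M[R]_m); pose Q := n1 * C * ((n1 + n1) * C).
have n10 : 0 <= n1 by exact: nrm_ge0.
have Q0 : 0 <= Q by rewrite !mulr_ge0 ?addr_ge0 // ltW.
exists (1 / (2 * (Q + 1))); first by rewrite divr_gt0 // mulr_gt0 // ltr_wpDl.
move=> N g g' hN hg gO hg' g'O hgg lefg.
have [Px nx] := x_null hN hg gO; have [Px' nx'] := x_null hN hg' g'O.
have [xl _ vv] := x_lip hN hg gO hN hg' g'O.
have := pencil_step Px Px'; set a := Fmx _ _ *m _; rewrite -/(f N g).
set v := Dg m g' *m x N g; set v' := Dg m g' *m x N g' => step.
have vv'_ge0 : 0 <= dot v v'.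
  have -> : v = (Dg m g' - Dg m g) *m x N g + Dg m g *m x N g.
    by rewrite mulmxBl subrK.
  rewrite dotDl; have : `|dot ((Dg m g' - Dg m g) *m x N g) v'| <= `|g' - g| * Q.
    apply: le_trans (dot_le_nrm _ _) _.
    rewrite /Q !mulrA -mulrA; apply: ler_pM; rewrite ?nrm_ge0 //.
      apply: le_trans (nrmM _ _) _; rewrite nrm_Dg_sub.
      by rewrite ler_wpM2l ?mulr_ge0.
    apply: le_trans (nrmM _ _) _; apply: ler_pM; rewrite ?nrm_ge0 //.
    rewrite /Dg nrm_block !nrm0 !addr0 lerD2r -[g'%:M]scalemx1 nrmZ.
    have /andP[Gg' g'1] := g'O; rewrite ger0_norm ?ler_piMl ?nrm_ge0 //.
    by rewrite (le_trans _ Gg') // ltW.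
  have : `|g' - g| * Q <= 1 / 2.
    have : `|g' - g| * (2 * (Q + 1)) <= 1.
      by rewrite -ler_pdivlMr ?mulr_gt0 ?ltr_wpDl // ltW.
    rewrite ler_pdivlMr // -mulrA (mulrC Q) => hQ; apply: le_trans hQ.
    by rewrite ler_wpM2l // ler_pM2l // lerDl.
  move=> hQ /ler_normlP[hd _]; rewrite -lerBlDl sub0r.
  exact: le_trans hd (le_trans hQ vv).
have s0 : 0 <= (g' ^+ 2 - g ^+ 2) * dot a (x N g').
  by rewrite step mulr_ge0 // subr_ge0.
have -> : x N g = x N g' + (x N g - x N g') by rewrite addrC subrK.
rewrite dotDr mulrDr -[X in X <= _]add0r; apply: lerD => //.
rewrite lerNl -mulrN; apply: le_trans (ler_norm _) _.
rewrite normrM ler_wpM2l // normrN; apply: le_trans (dot_le_nrm _ _) _.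
rewrite ler_wpM2l ?nrm_ge0 //; apply: le_trans xl _.
by rewrite subrr nrm0 add0r distrC.
Qed.

End Growth.

(** If [F x0] vanished, so would [G x0], and [x0] would remain a null vector for every weight with
    the same [l]. The second singular value would then be constant just to the right of [g0], where
    there is room because [g0 < 1], against the uniqueness of the minimizer. *)
Lemma pencil_image_neq0 (R : realType) p m (Gam g0 rho : R)
    (N0 : 'M[R]_(p + p, m + m)) (x0 : 'cV[R]_(m + m)) :
  0 < rho -> Gam <= g0 < 1 -> x0 != 0 ->
  (g0 ^+ 2 *: Fmx N0 (lam2 (Tg g0 N0)) + Gmx N0 (lam2 (Tg g0 N0))) *m x0 = 0 ->
  (forall g l (y : 'cV[R]_(m + m)), `|g - g0| < rho -> Gam <= g <= 1 ->
     `|l - lam2 (Tg g0 N0)| < rho -> y != 0 ->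
     (g ^+ 2 *: Fmx N0 l + Gmx N0 l) *m y = 0 -> l = lam2 (Tg g N0)) ->
  (forall g, Gam <= g <= 1 -> g != g0 -> lam2 (Tg g0 N0) < lam2 (Tg g N0)) ->
  Fmx N0 (lam2 (Tg g0 N0)) *m x0 != 0.
Proof.
move=> rho_gt0 /andP[Gg0 g0_lt1] x0N0 Px x_uniq uniq_min; apply/eqP => a0.
have Gx : Gmx N0 (lam2 (Tg g0 N0)) *m x0 = 0.
  by have := Px; rewrite mulmxDl -scalemxAl a0 scaler0 add0r.
pose h := Num.min (rho / 2) (1 - g0).
have h_gt0 : 0 < h by rewrite lt_min divr_gt0 // subr_gt0.
have h_le1 : h <= rho / 2 by rewrite ge_min lexx.
have h_le2 : h <= 1 - g0 by rewrite ge_min lexx orbT.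
clearbody h; have gO : Gam <= g0 + h <= 1.
  by move: h_gt0 h_le2 Gg0; clear => *; apply/andP; split; lra.
have gg0 : g0 + h != g0 by rewrite -subr_eq0 addrAC subrr add0r gt_eqF.
have gnear : `|g0 + h - g0| < rho.
  rewrite addrAC subrr add0r ger0_norm ?(ltW h_gt0) //.
  by move: h_le1 rho_gt0; clear; lra.
have := uniq_min _ gO gg0.
rewrite -(x_uniq _ (lam2 (Tg g0 N0)) x0 gnear gO) ?ltxx //.
  by rewrite subrr normr0.
by rewrite mulmxDl -scalemxAl a0 Gx scaler0 addr0.
Qed.

Lemma pencil_bounds (R : realType) p m (Gam g0 rho0 C : R)
    (N0 : 'M[R]_(p + p, m + m))
    (x : 'M[R]_(p + p, m + m) -> R -> 'cV[R]_(m + m)) :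
  let l (N : 'M[R]_(p + p, m + m)) (g : R) := lam2 (Tg g N) in
  let a (N : 'M[R]_(p + p, m + m)) (g : R) := Fmx N (l N g) *m x N g in
  0 < rho0 -> 0 < C -> Gam <= g0 <= 1 ->
  (forall N g, nrm (N - N0) < rho0 -> `|g - g0| < rho0 -> Gam <= g <= 1 ->
     [/\ nrm (x N g) <= C, nrm (x N g - x N0 g0) <= C * (nrm (N - N0) + `|g - g0|) &
         `|l N g - l N0 g0| <= C * (nrm (N - N0) + `|g - g0|)]) ->
  a N0 g0 != 0 ->
  exists rho c0 KB : R, [/\ 0 < rho, 0 < c0, 0 < KB &
    forall N g, nrm (N - N0) < rho -> `|g - g0| < rho -> Gam <= g <= 1 ->
    [/\ nrm N <= KB, `|l N g| <= KB, nrm (x N g) <= KB & c0 <= dot (a N g) (a N g)]].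
Proof.
move=> l a rho0_gt0 C_gt0 g0O x_lip a0N0.
have N0z : nrm (N0 - N0) < rho0 by rewrite subrr nrm0.
have g0z : `|g0 - g0| < rho0 by rewrite subrr normr0.
have aa0 : 0 < dot (a N0 g0) (a N0 g0) by rewrite dot_gt0.
pose c0 := dot (a N0 g0) (a N0 g0) / 2.
have c0_gt0 : 0 < c0 by rewrite divr_gt0.
pose b := nrm N0 + 1; pose e := nrm (@E1 R p) + nrm (@E1 R m).
have b_ge1 : 1 <= b by rewrite lerDr nrm_ge0.
have b_gt0 : 0 < b by apply: lt_le_trans b_ge1.
have e_ge0 : 0 <= e by rewrite addr_ge0 ?nrm_ge0.
pose KB := b + (`|l N0 g0| + C) + C.
have KB_gt0 : 0 < KB by rewrite ltr_wpDl // addr_ge0 ?(ltW b_gt0) // addr_ge0 // ltW.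
pose KF := KB * e * KB + KB * e.
have KF_ge0 : 0 <= KF by rewrite addr_ge0 ?mulr_ge0 // ltW.
have near1 N : nrm (N - N0) < 1 -> nrm N <= b.
  move=> nN; rewrite -[N](subrK N0) addrC; apply: le_trans (nrmD _ _) _.
  by rewrite lerD2l ltW.
have nF (N : 'M[R]_(p + p, m + m)) l' : nrm N <= KB -> `|l'| <= KB -> nrm (Fmx N l') <= KF.
  move=> nN nl; apply: le_trans (nrmB _ _) _; apply: lerD.
    apply: le_trans (nrmM _ _) _; apply: ler_pM => //; rewrite ?nrm_ge0 //.
    apply: le_trans (nrmM _ _) _; rewrite nrm_tr.
    by apply: ler_pM => //; rewrite ?nrm_ge0 // lerDl nrm_ge0.
  by rewrite nrmZ; apply: ler_pM => //; rewrite ?nrm_ge0 // lerDr nrm_ge0.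
pose K1 := ((2 * KB * e + C * e) * C + KF * C).
have K1_ge0 : 0 <= K1.
  by rewrite addr_ge0 ?mulr_ge0 ?addr_ge0 ?mulr_ge0 // ltW.
(* Within this radius [a N g] moves by at most [2 * K1 * rho], which costs at most [c0], half of the
   squared length of [a N0 g0]. *)
pose rho := Num.min (Num.min (rho0 / 2) (1 / 2)) (c0 / (4 * (K1 * (KF * C) + 1))).
have Kc_gt0 : 0 < 4 * (K1 * (KF * C) + 1).
  by rewrite mulr_gt0 // ltr_wpDl // !mulr_ge0 // ltW.
have rho_gt0 : 0 < rho by rewrite !lt_min !divr_gt0.
have rho_le1 : rho <= rho0 / 2 by rewrite !ge_min lexx.
have rho_le2 : rho <= 1 / 2 by rewrite !ge_min lexx orbT.
have rho_le4 : 4 * (K1 * (KF * C) + 1) * rho <= c0.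
  rewrite mulrC -ler_pdivlMr // !ge_min lexx !orbT //.
clearbody rho; exists rho, c0, KB; split=> //.
  move=> N g hN hg gO.
  have hN0 : nrm (N - N0) < rho0.
    by move: hN rho_le1 rho0_gt0; clear; lra.
  have hg0 : `|g - g0| < rho0.
    by move: hg rho_le1 rho0_gt0; clear; lra.
  have [nx xl ll] := x_lip _ _ hN0 hg0 gO; have [nx0 _ _] := x_lip _ _ N0z g0z g0O.
  have dist1 : nrm (N - N0) + `|g - g0| <= 1.
    by move: hN hg rho_le2; clear; lra.
  have KB1 : b <= KB by rewrite /KB; move: (normr_ge0 (l N0 g0)) C_gt0; clear; lra.
  have KB2 : `|l N0 g0| + C <= KB.
    by rewrite /KB; move: (C_gt0) b_gt0; clear; lra.
  have KB3 : C <= KB by rewrite /KB; move: (normr_ge0 (l N0 g0)) C_gt0 b_gt0; clear; lra.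
  have nN : nrm N <= KB by apply: le_trans KB1; apply: near1; move: hN rho_le2; clear; lra.
  have nN0 : nrm N0 <= KB by apply: le_trans KB1; rewrite lerDl.
  have nl0 : `|l N0 g0| <= KB by move: KB2 C_gt0; clear; lra.
  have nl : `|l N g| <= KB.
    apply: le_trans KB2; rewrite -[l N g](subrK (l N0 g0)) addrC.
    apply: le_trans (ler_normD _ _) _; rewrite lerD2l; apply: le_trans ll _.
    by rewrite ler_piMr // ltW.
  split=> //; first exact: le_trans nx _.
  pose eta := nrm (N - N0) + `|g - g0|.
  have eta_ge0 : 0 <= eta by rewrite addr_ge0 ?nrm_ge0.
  have na N' g' : nrm N' <= KB -> `|l N' g'| <= KB -> nrm (x N' g') <= C ->
      nrm (a N' g') <= KF * C.
    move=> ? ? ?; apply: le_trans (nrmM _ _) _.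
    by apply: ler_pM; rewrite ?nrm_ge0 // nF.
  have nad : nrm (a N g - a N0 g0) <= K1 * eta.
    have split_diff (F F0 : 'M[R]_(m + m)) (y z : 'cV[R]_(m + m)) :
        F *m y - F0 *m z = (F - F0) *m y + F0 *m (y - z).
      by rewrite mulmxBl mulmxBr addrA subrK.
    rewrite /a split_diff.
    apply: le_trans (nrmD _ _) _; rewrite mulrDl; apply: lerD.
      apply: le_trans (nrmM _ _) _; rewrite mulrAC; apply: ler_pM; rewrite ?nrm_ge0 //.
      apply: le_trans (nrm_pencil_sub _ _ _ _ _ _) _.
      rewrite [X in _ <= X]mulrDl; apply: lerD.
        apply: ler_pM; rewrite ?mulr_ge0 ?addr_ge0 ?nrm_ge0 //; last by rewrite lerDl.
        apply: ler_pM; rewrite ?addr_ge0 ?nrm_ge0 //.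
          by move: nN nN0; clear; lra.
        by rewrite lerDl nrm_ge0.
      rewrite mulrAC; apply: ler_pM; rewrite ?nrm_ge0 //.
      by rewrite lerDr nrm_ge0.
    apply: le_trans (nrmM _ _) _; rewrite -mulrA; apply: ler_pM; rewrite ?nrm_ge0 //.
    exact: (nF _ _ nN0 nl0).
  have dotd : `|dot (a N g - a N0 g0) (a N g + a N0 g0)| <= K1 * eta * (2 * (KF * C)).
    apply: le_trans (dot_le_nrm _ _) _; apply: ler_pM; rewrite ?nrm_ge0 //.
    apply: le_trans (nrmD _ _) _; rewrite mulrDl mul1r.
    by apply: lerD; apply: na.
  have dotE2 : dot (a N g - a N0 g0) (a N g + a N0 g0) =
      dot (a N g) (a N g) - dot (a N0 g0) (a N0 g0).
    by move: (a N g) (a N0 g0) => y z; rewrite !dotE (dotC z y); ring.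
  have eta_le : eta <= 2 * rho by rewrite /eta; move: hN hg; clear; lra.
  have K1KF : 0 <= K1 * (KF * C) by rewrite !mulr_ge0 // ltW.
  have := ler_wpM2l K1KF eta_le.
  move: dotd; rewrite dotE2 ler_norml /c0 => /andP[+ _].
  by move: rho_gt0 rho_le4; rewrite /c0; clear; lra.
Qed.

(** The minimizer [g1] of a nearby [N] may be interior or equal to [Gam], so its first-order
    conditions come from one-sided steps: to the right always, as [g1 < 1], and to the left whenever
    some [g < g1] is admissible. *)
Lemma lam2_growth (R : realType) p m (Gam g0 : R) (N0 : 'M[R]_(p + p, m + m)) :
  (0 < p)%N -> (0 < m)%N -> 0 < Gam -> Gam <= g0 < 1 ->
  simple_singval (cplxmx (Tg g0 N0)) (singval (cplxmx (Tg g0 N0)) 2) ->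
  0 < lam2 (Tg g0 N0) ->
  (forall g, Gam <= g <= 1 -> g != g0 -> lam2 (Tg g0 N0) < lam2 (Tg g N0)) ->
  exists rho c : R, [/\ 0 < rho, 0 < c &
    forall (N : 'M[R]_(p + p, m + m)) g1 g,
      N *m Jmx m = Jmx p *m N -> nrm (N - N0) < rho -> `|g1 - g0| < rho ->
      Gam <= g1 <= 1 -> Gam <= g <= 1 ->
      (forall g', Gam <= g' <= 1 -> lam2 (Tg g1 N) <= lam2 (Tg g' N)) ->
      lam2 (Tg g1 N) + c * (g - g1) ^+ 2 <= lam2 (Tg g N)].
Proof.
move=> p0 m0 Gam_gt0 /andP[Gg0 g0_lt1] simple0 lam_gt0 uniq_min.
have g0O : Gam <= g0 <= 1 by rewrite Gg0 ltW.
have [x [rho0 [C [rho0_gt0 C_gt0 x_null x_lip x_uniq]]]] :=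
  pencil_field p0 m0 Gam_gt0 g0O simple0 lam_gt0.
have [h0 h0_gt0 first_order] := minimizer_first_order Gam_gt0 C_gt0 x_null x_lip.
pose l (N : 'M[R]_(p + p, m + m)) (g : R) := lam2 (Tg g N).
pose a (N : 'M[R]_(p + p, m + m)) (g : R) := Fmx N (l N g) *m x N g.
have N0z : nrm (N0 - N0) < rho0 by rewrite subrr nrm0.
have g0z : `|g0 - g0| < rho0 by rewrite subrr normr0.
have xN0 : x N0 g0 != 0.
  apply/eqP => x0; have [_ _] := x_lip _ _ _ _ N0z g0z g0O N0z g0z g0O.
  by rewrite x0 mulmx0 dot0l; clear; lra.
have [Px0 _] := x_null _ _ N0z g0z g0O.
have a0N0 : a N0 g0 != 0.
  by apply: (pencil_image_neq0 rho0_gt0 _ xN0 Px0 x_uniq uniq_min); rewrite Gg0.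
have x_bd N g : nrm (N - N0) < rho0 -> `|g - g0| < rho0 -> Gam <= g <= 1 ->
   [/\ nrm (x N g) <= C, nrm (x N g - x N0 g0) <= C * (nrm (N - N0) + `|g - g0|) &
       `|l N g - l N0 g0| <= C * (nrm (N - N0) + `|g - g0|)].
  move=> hN hg gO; have [_ nx] := x_null _ _ hN hg gO.
  by have [xl ll _] := x_lip _ _ _ _ hN hg gO N0z g0z g0O; split.
have [rho1 [c0 [KB [rho1_gt0 c0_gt0 KB_gt0 bounds1]]]] :=
  pencil_bounds rho0_gt0 C_gt0 g0O x_bd a0N0.
pose rho := Num.min rho1 (Num.min (rho0 / 2) ((1 - g0) / 2)).
have rho_gt0 : 0 < rho by rewrite !lt_min rho1_gt0 !divr_gt0 // subr_gt0.
have rho_le0 : rho <= rho1 by rewrite ge_min lexx.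
have rho_le1 : rho <= rho0 / 2 by rewrite !ge_min lexx orbT.
have rho_le3 : rho <= (1 - g0) / 2 by rewrite !ge_min lexx !orbT.
clearbody rho.
have bounds N g (hN : nrm (N - N0) < rho) (hg : `|g - g0| < rho) :=
  bounds1 N g (lt_le_trans hN rho_le0) (lt_le_trans hg rho_le0).
(* The radius keeps [g1] below this midpoint, so [1 / g1 ^+ 2] exceeds every admissible [g ^+ 2] by
   at least [c1]. *)
pose gm := (1 + g0) / 2.
have gm_gt0 : 0 < gm by rewrite divr_gt0 // addr_gt0 // (lt_le_trans Gam_gt0).
have gm_lt1 : gm < 1 by rewrite /gm; move: g0_lt1; clear; lra.
pose c1 := (gm ^+ 2)^-1 - 1.
have c1_gt0 : 0 < c1.
  by rewrite subr_gt0 invf_gt1 ?exprn_gt0 // expr_lt1 // ltW.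
have [c c_gt0 growth] := pencil_growth p0 m0 Gam_gt0 c0_gt0 c1_gt0 KB_gt0.
(* Growth in [g ^+ 2] becomes growth in [g] through [g + g1 >= 2 * Gam]. *)
exists rho, (c * (2 * Gam) ^+ 2); split; first exact: rho_gt0.
  by rewrite mulr_gt0 // exprn_gt0 // mulr_gt0.
move=> N g1 g NJ hN hg1 g1O gO min1.
have [nN nl nx na] := bounds _ _ hN hg1 g1O.
have /andP[Gg1 _] := g1O; have /andP[Gg g_le1] := gO.
have g1_gm : g1 < gm.
  have := hg1; rewrite ltr_norml => /andP[_]; rewrite /gm.
  by move: rho_le3 g0_lt1; clear; lra.
have g1_lt1 := lt_trans g1_gm gm_lt1.
have g1_gt0 : 0 < g1 by apply: lt_le_trans Gg1.
have g_gt0 : 0 < g by apply: lt_le_trans Gg.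
have [->|gg1] := eqVneq g g1.
  by rewrite [g1 - g1]subrr expr0n mulr0 addr0 lexx.
have hN0 : nrm (N - N0) < rho0 by move: hN rho_le1 rho0_gt0; clear; lra.
have hg10 : `|g1 - g0| < rho0 by move: hg1 rho_le1 rho0_gt0; clear; lra.
have [Px _] := x_null _ _ hN0 hg10 g1O.
pose F0 := dot (a N g1) (x N g1).
have F0_step g' : `|g' - g1| < rho -> `|g' - g1| < h0 -> Gam <= g' <= 1 -> g' != g1 ->
    - (nrm (a N g1) * C * `|g' - g1|) <= Num.sg (g' - g1) * F0.
  move=> hg' hg'0 g'O g'n.
  have g'z : `|g' - g0| < rho0.
    have := ler_normD (g' - g1) (g1 - g0); rewrite addrA subrK => /le_lt_trans; apply.
    by move: hg' hg1 rho_le1; clear; lra.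
  have := first_order N g1 g' hN0 hg10 g1O g'z g'O hg'0 (min1 _ g'O).
  have /andP[Gg' _] := g'O; have g'_gt0 : 0 < g' by apply: lt_le_trans Gg'.
  have D_n0 : g' - g1 != 0 by rewrite subr_eq0.
  have s_gt0 : 0 < g' + g1 by rewrite addr_gt0.
  have -> : g' ^+ 2 - g1 ^+ 2 = `|g' - g1| * ((g' + g1) * Num.sg (g' - g1)).
    by rewrite [_ * Num.sg _]mulrC mulrA [`|_| * _]mulrC -numEsg; ring.
  rewrite normrM normr_id normrM normr_sg D_n0 mulr1 (gtr0_norm s_gt0).
  rewrite -/(l N g1) -/(a N g1) -/F0 -!mulrA -mulrN ler_pM2l ?normr_gt0 //.
  by rewrite -mulrN ler_pM2l // !mulrA.
have Ca_ge0 : 0 <= nrm (a N g1) * C by rewrite mulr_ge0 ?nrm_ge0 // ltW.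
have F0_ge0 : 0 <= F0.
  apply: (@ge0_of_linear _ _ _ (Num.min (Num.min rho h0) (1 - g1)) _ Ca_ge0).
    by rewrite !lt_min rho_gt0 h0_gt0 subr_gt0.
  move=> h /andP[h_gt0]; rewrite !lt_min => /andP[/andP[h1 h2] h3].
  have hE : g1 + h - g1 = h by rewrite addrAC subrr add0r.
  have := F0_step (g1 + h); rewrite hE gtr0_norm // gtr0_sg // mul1r; apply => //.
    by apply/andP; split; move: h_gt0 h3 Gg1; clear; lra.
  by rewrite -subr_eq0 hE gt_eqF.
(* For [g < g1] steps to the left are admissible too, and [F0] vanishes. *)
have DF0 : 0 <= (g ^+ 2 - g1 ^+ 2) * F0.
  have [g_lt|g_ge] := ltP g g1; last first.
    by rewrite mulr_ge0 // subr_ge0 lerXn2r // nnegrE ltW.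
  have F0_le0 : 0 <= - F0.
    apply: (@ge0_of_linear _ _ _ (Num.min (Num.min rho h0) (g1 - g)) _ Ca_ge0).
      by rewrite !lt_min rho_gt0 h0_gt0 subr_gt0.
    move=> h /andP[h_gt0]; rewrite !lt_min => /andP[/andP[h1 h2] h3].
    have hE : g1 - h - g1 = - h by rewrite addrAC subrr add0r.
    have := F0_step (g1 - h).
    rewrite hE normrN gtr0_norm // sgrN gtr0_sg // mulN1r; apply => //.
      by apply/andP; split; move: h_gt0 h3 Gg g1_lt1; clear; lra.
    by rewrite -subr_eq0 hE oppr_eq0 gt_eqF.
  have -> : F0 = 0 by move: F0_le0 F0_ge0; clear; lra.
  by rewrite mulr0.
have g1O' : Gam <= g1 < 1 by rewrite Gg1.
have th_ge : c1 <= (g1 ^+ 2)^-1 - g ^+ 2.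
  have : (gm ^+ 2)^-1 <= (g1 ^+ 2)^-1.
    by rewrite lef_pV2 ?posrE ?exprn_gt0 // lerXn2r ?nnegrE // ltW.
  have : g ^+ 2 <= 1 by rewrite expr_le1 // ltW.
  by rewrite /c1; clear; lra.
have := growth N (l N g1) (x N g1) g1 g NJ nN nl nx g1O' gO gg1 th_ge Px na.
rewrite -/(a N g1) dotC -/F0 => /(_ F0_ge0 DF0); apply: le_trans.
rewrite lerD2l -mulrA ler_wpM2l ?(ltW c_gt0) //.
have -> : (g ^+ 2 - g1 ^+ 2) ^+ 2 = (g + g1) ^+ 2 * (g - g1) ^+ 2 by ring.
rewrite ler_wpM2r ?sqr_ge0 // lerXn2r ?nnegrE ?mulr_ge0 ?addr_ge0 ?(ltW Gam_gt0) ?(ltW g_gt0) ?(ltW g1_gt0) //.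
by move: Gg Gg1; clear; lra.
Qed.

(** * Interpolation error of the reduced transfer functions *)

(** Realification: it respects sums and products and turns multiplication by i into [Jmx], so that
    all estimates concern real matrices. *)
Definition cR (R : realType) q r (M : 'M[R[i]]_(q, r)) : 'M[R]_(q + q, r + r) :=
  let X := map_mx (@complex.Re R) M in let Y := map_mx (@complex.Im R) M in
  block_mx X (- Y) Y X.

Section ComplexBlocks.
Context {R : realType}.

Lemma ReMc (a b : R[i]) :
  complex.Re (a * b) = complex.Re a * complex.Re b - complex.Im a * complex.Im b.
Proof. by case: a b => [? ?] [? ?]. Qed.

Lemma ImMc (a b : R[i]) :
  complex.Im (a * b) = complex.Re a * complex.Im b + complex.Im a * complex.Re b.
Proof. by case: a b => [? ?] [? ?]. Qed.

Lemma cRB q r (M P : 'M[R[i]]_(q, r)) : cR (M - P) = cR M - cR P.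
Proof.
rewrite /cR opp_block_mx add_block_mx; congr block_mx; apply/matrixP => i j;
  by rewrite !mxE raddfB ?opprB ?opprK //= addrC.
Qed.

Lemma cRM q n r (M : 'M[R[i]]_(q, n)) (P : 'M[R[i]]_(n, r)) :
  cR (M *m P) = cR M *m cR P.
Proof.
have ReM : map_mx (@complex.Re R) (M *m P) =
    map_mx (@complex.Re R) M *m map_mx (@complex.Re R) P -
    map_mx (@complex.Im R) M *m map_mx (@complex.Im R) P.
  apply/matrixP => i j; rewrite !mxE raddf_sum -sumrB; apply: eq_bigr => k _.
  by rewrite [LHS]ReMc !mxE.
have ImM : map_mx (@complex.Im R) (M *m P) =
    map_mx (@complex.Re R) M *m map_mx (@complex.Im R) P +
    map_mx (@complex.Im R) M *m map_mx (@complex.Re R) P.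
  apply/matrixP => i j; rewrite !mxE raddf_sum -big_split; apply: eq_bigr => k _.
  by rewrite [LHS]ImMc !mxE.
rewrite /cR ReM ImM mulmx_block; congr block_mx.
- by rewrite mulNmx.
- by rewrite mulmxN mulNmx opprD.
- by rewrite addrC.
- by rewrite mulmxN addrC.
Qed.

Lemma cR_iscale q r (t : R) (M : 'M[R[i]]_(q, r)) :
  cR ((0 +i* t) *: M) = t *: (Jmx q *m cR M).
Proof.
rewrite /cR /Jmx mulmx_block !mul0mx !add0r !mulNmx !mul1mx !addr0 scale_block_mx.
congr block_mx; apply/matrixP => i j; rewrite !mxE ?ReMc ?ImMc /=; ring.
Qed.

Lemma cRJ q r (M : 'M[R[i]]_(q, r)) : cR M *m Jmx r = Jmx q *m cR M.
Proof.
rewrite /cR /Jmx !mulmx_block !mul0mx !mulmx0 !add0r !addr0 !mulNmx !mulmxN.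
by rewrite !mul1mx !mulmx1.
Qed.

Lemma nrm_J q r (M : 'M[R]_(q + q, r)) : nrm (Jmx q *m M) = nrm M.
Proof.
rewrite -[M in LHS]vsubmxK /Jmx mul_block_col !mul0mx add0r addr0 mulNmx !mul1mx.
rewrite -[M in RHS]vsubmxK.
have nrm_col (X Y : 'M[R]_(q, r)) : nrm (col_mx X Y) = nrm X + nrm Y.
  rewrite /nrm big_split_ord /=; congr (_ + _); apply: eq_bigr => i _;
  by apply: eq_bigr => j _; rewrite (col_mxEu, col_mxEd).
by rewrite !nrm_col nrmN addrC.
Qed.

Lemma ssT_Tg n m p (A : 'M[R[i]]_n) (B : 'M[R[i]]_(n, m)) (C : 'M[R[i]]_(p, n)) w g :
  ssT A B C w g = Tg g (cR (transfer A B C (0 +i* w))).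
Proof.
rewrite /ssT /Tg /cR block_mxKul block_mxKur block_mxKdl block_mxKdr.
by rewrite scalerN.
Qed.

Lemma resolvent_identity n (A : 'M[R[i]]_n) (w w' : R) :
  (0 +i* w)%:M - A \in unitmx -> (0 +i* w')%:M - A \in unitmx ->
  invmx ((0 +i* w')%:M - A) = invmx ((0 +i* w)%:M - A) -
  (0 +i* (w' - w)) *: (invmx ((0 +i* w')%:M - A) *m invmx ((0 +i* w)%:M - A)).
Proof.
move=> u u'; set X := _ - A in u *; set X' := _ - A in u' *.
apply: (canRL (addrK _)); rewrite addrC -[invmx X in RHS]mul1mx -(mulVmx u').
have YE : invmx X' = invmx X' *m X *m invmx X by rewrite -mulmxA mulmxV ?mulmx1.
rewrite [X in _ + X = _]YE scalemxAl -mulmxDl.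
congr (_ *m _); rewrite -mul_mx_scalar -mulmxDr; congr (_ *m _).
rewrite /X /X' addrA; congr (_ - _); rewrite -raddfD /=; congr (_%:M).
by apply/eqP; rewrite eq_complex /= add0r subrK !eqxx.
Qed.

End ComplexBlocks.

(** The reduced resolvent carried back to dimension n, so that its size does not depend on [d]. It
    is singular when d < n, yet orthonormality of the columns of [V] gives it the resolvent
    identity. *)
Definition red_resolvent (R : realType) n d (A : 'M[R]_n) (V : 'M[R[i]]_(n, d)) (w : R) :
    'M[R[i]]_n :=
  V *m invmx ((0 +i* w)%:M - redA A V) *m V ^t*.

Section ReducedResolvent.
Context {R : realType} (n d : nat) (A : 'M[R]_n) (V : 'M[R[i]]_(n, d)).
Hypothesis V_orth : V ^t* *m V = 1%:M.
Notation W := (red_resolvent A V).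

Lemma transfer_red m p (B : 'M[R[i]]_(n, m)) (C : 'M[R[i]]_(p, n)) w :
  transfer (redA A V) (V ^t* *m B) (C *m V) (0 +i* w) = C *m W w *m B.
Proof. by rewrite /transfer /red_resolvent !mulmxA. Qed.

Lemma red_resolvent_identity (w w' : R) :
  (0 +i* w)%:M - redA A V \in unitmx -> (0 +i* w')%:M - redA A V \in unitmx ->
  W w' = W w - (0 +i* (w' - w)) *: (W w' *m W w).
Proof.
move=> u u'; rewrite {1}/red_resolvent (resolvent_identity u u').
rewrite mulmxBr mulmxBl -scalemxAr -scalemxAl; congr (_ - _ *: _).
by rewrite /red_resolvent !mulmxA -(mulmxA _ (V ^t*) V) V_orth mulmx1.
Qed.

(** [W w] times [i w - A] is a projection, in general oblique, onto the column space of [V]. On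
    Krylov vectors this makes the reduced resolvent act as the full one. *)
Lemma red_resolvent_range k (K : 'M[R[i]]_(n, k)) (w : R) :
  (0 +i* w)%:M - redA A V \in unitmx -> (K^T <= V^T)%MS ->
  W w *m ((0 +i* w)%:M - cplxmx A) *m K = K.
Proof.
move=> u /submxP[Y /(congr1 trmx)]; rewrite trmx_mul !trmxK => ->.
rewrite /red_resolvent !mulmxA; congr (_ *m _).
rewrite -[RHS]mulmx1 -(mulVmx u) -!mulmxA; congr (_ *m (_ *m _)).
rewrite mulmxBl mulmxBr mul_scalar_mx -scalemxAr V_orth scalemx1.
by rewrite /redA !mulmxA.
Qed.

(** The smallest singular value bounds the inverse by [beta^-1], and [V] and its adjoint do not
    increase lengths. Every entry is thus at most [beta^-1] in modulus, and the realification has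
    four blocks of [n * n] entries; nothing depends on [d] or [V]. *)
Lemma red_resolvent_bound (w beta : R) : 0 < beta ->
  (0 +i* w)%:M - redA A V \in unitmx ->
  beta <= singval_min ((0 +i* w)%:M - redA A V) ->
  nrm (cR (W w)) <= 4 * (beta^-1 *+ (n * n)).
Proof.
move=> beta0; set M : 'M[R[i]]_d := _ - redA A V => M_unit beta_le.
pose S := M ^t* *m M.
have S_herm : S \is hermsymmx.
  rewrite /S; move: (M : 'M[R[i]]_d) => Q; apply/is_hermitianmxP.
  rewrite expr0 scale1r trmx_mul map_mxM.
  by rewrite -[RHS]/(Q ^t* *m Q ^t* ^t*) trmxCK.
have /orthomx_spectralP SE := hermitian_normalmx S_herm.
have U_unit := spectral_unitarymx S.
have D_real := hermitian_spectral_diag_real S_herm.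
set U := spectralmx S in SE U_unit; set D := spectral_diag S in SE D_real.
(* For a square matrix [take] drops nothing, and [singval_min] is the last, hence the least, of the
   [d] sorted values. *)
have D_ge j : (beta ^+ 2)%:C <= D 0 j.
  have : beta <= Num.sqrt (complex.Re (D 0 j)).
    apply: le_trans beta_le _.
    rewrite /singval_min /singval /singvals -/S -/D minnn.
    set s := sort _ _.
    have sd : size s = d by rewrite size_sort size_map size_enum_ord.
    rewrite take_oversize ?sd //.
    have : Num.sqrt (complex.Re (D 0 j)) \in s.
      by rewrite mem_sort; apply/mapP; exists j; rewrite ?mem_enum.
    move=> /(nthP 0)[i i_lt <-].
    have st : sorted >=%O s by apply: sort_sorted => x y; exact: ge_total.
    have d0 : (0 < d)%N by rewrite -sd (leq_trans _ i_lt).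
    have i_le : (i <= d.-1)%N by rewrite -ltnS prednK //; move: i_lt; rewrite sd.
    apply: (sorted_leq_nth (@ge_trans _ R) (@ge_refl _ R) 0 st) => //.
    by rewrite inE sd prednK.
  have /complex_realP[x xE] := mxOverP D_real 0 j.
  rewrite xE /= lecR => bx.
  have x0 : 0 <= x.
    by rewrite leNgt; apply/negP => /ltW x0; move: bx; rewrite ler0_sqrtr // leNgt beta0.
  by rewrite -(sqr_sqrtr x0) lerXn2r // nnegrE ?sqrtr_ge0 ?ltW.
pose cn k (z : 'cV[R[i]]_k) : R[i] := (z ^t* *m z) 0 0.
have cn_sum k (z : 'cV[R[i]]_k) : cn k z = \sum_i `|z i 0| ^+ 2.
  by rewrite /cn mxE; apply: eq_bigr => i _; rewrite !mxE normCKC.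
have cn_ge0 k (z : 'cV[R[i]]_k) : 0 <= cn k z.
  by rewrite cn_sum sumr_ge0 // => i _; rewrite exprn_ge0.
have adjM q r k (X : 'M[R[i]]_(q, r)) (Y : 'M[R[i]]_(r, k)) :
    (X *m Y) ^t* = Y ^t* *m X ^t* by rewrite trmx_mul map_mxM.
have adjK q r (X : 'M[R[i]]_(q, r)) : X ^t* ^t* = X by rewrite trmxCK.
have cnV z : cn _ (V *m z) = cn _ z.
  by rewrite /cn adjM -mulmxA (mulmxA (V ^t*)) V_orth mul1mx.
have UU : U ^t* *m U = 1%:M.
  by rewrite -invmx_unitary // mulVmx // unitarymx_unit.
have cnM z : (beta ^+ 2)%:C * cn _ z <= cn _ (M *m z).
  have -> : cn _ (M *m z) = \sum_k D 0 k * `|(U *m z) k 0| ^+ 2.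
    have -> : cn _ (M *m z) = ((U *m z) ^t* *m (diag_mx D *m (U *m z))) 0 0.
      rewrite /cn adjM -mulmxA (mulmxA (M ^t*)) -/S SE invmx_unitary //.
      by rewrite adjM !mulmxA.
    rewrite mxE; apply: eq_bigr => k _.
    by rewrite mul_diag_mx !mxE normCKC mulrCA.
  have -> : cn _ z = cn _ (U *m z).
    by rewrite /cn adjM -mulmxA (mulmxA (U ^t*)) UU mul1mx.
  rewrite cn_sum mulr_sumr; apply: ler_sum => k _.
  by rewrite ler_wpM2r // exprn_ge0.
(* Pythagoras: what is lost is the squared length of the part of [y] orthogonal to the column space
   of [V]. *)
have cnVt (y : 'cV_n) : cn _ (V ^t* *m y) <= cn _ y.
  rewrite -subr_ge0; have -> : cn _ y - cn _ (V ^t* *m y) = cn _ (y - V *m (V ^t* *m y)).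
    rewrite /cn [in RHS]trmxB map_mxB mulmxBl !mulmxBr.
    rewrite !adjM !adjK.
    rewrite -!mulmxA (mulmxA (V ^t*) V) V_orth mul1mx subrr subr0.
    by rewrite [in RHS]mxE [X in _ = _ + X]mxE.
  exact: cn_ge0.
have W_entry i j : `|complex.Re (W w i j)| <= beta^-1 /\ `|complex.Im (W w i j)| <= beta^-1.
  pose y : 'cV[R[i]]_n := delta_mx j 0.
  have cny : cn _ y = 1.
    rewrite cn_sum (bigD1 j) //= big1 => [|k kj].
      by rewrite !mxE !eqxx normr1 expr1n addr0.
    by rewrite !mxE (negPf kj) normr0 expr0n.
  have : (beta ^+ 2)%:C * cn _ (W w *m y) <= 1.
    rewrite -cny; apply: le_trans (cnVt y).
    rewrite /red_resolvent -!mulmxA cnV; apply: le_trans (cnM _) _.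
    by rewrite mulKVmx.
  have Wij : `|W w i j| ^+ 2 <= cn _ (W w *m y).
    rewrite cn_sum (bigD1 i) //= -colE [col _ _ _ _]mxE lerDl sumr_ge0 // => k _.
    by rewrite exprn_ge0.
  have b2 : 0 <= (beta ^+ 2)%:C :> R[i] by rewrite ler0c sqr_ge0.
  move=> /(le_trans (ler_wpM2l b2 Wij)).
  rewrite -add_Re2_Im2 -rmorphM /= -(rmorph1 (real_complex R)) lecR.
  move: (complex.Re _) (complex.Im _) => s t st.
  have bd (r : R) : beta ^+ 2 * r ^+ 2 <= 1 -> `|r| <= beta^-1.
    move=> br; rewrite -[beta^-1]mul1r ler_pdivlMr // -(@expr_le1 _ 2) //.
      by rewrite exprMn real_normK ?num_real // mulrC.
    by rewrite mulr_ge0 // ltW.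
  have := mulr_ge0 (sqr_ge0 beta) (sqr_ge0 s); have := mulr_ge0 (sqr_ge0 beta) (sqr_ge0 t).
  by move=> ? ?; split; apply: bd; lra.
rewrite /cR nrm_block nrmN.
have nB (X : 'M[R]_n) : (forall i j, `|X i j| <= beta^-1) -> nrm X <= beta^-1 *+ (n * n).
  move=> Xb; apply: (@le_trans _ _ (\sum_(i < n) \sum_(j < n) beta^-1)).
    by apply: ler_sum => i _; apply: ler_sum => j _.
  by rewrite !sumr_const !card_ord -mulrnA.
have : nrm (map_mx (@complex.Im R) (W w)) <= beta^-1 *+ (n * n).
  by apply: nB => i j; rewrite mxE; case: (W_entry i j).
have : nrm (map_mx (@complex.Re R) (W w)) <= beta^-1 *+ (n * n).
  by apply: nB => i j; rewrite mxE; case: (W_entry i j).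
by move: (nrm _) (nrm _) (beta^-1 *+ _); clear => *; lra.
Qed.

End ReducedResolvent.

Lemma stable_resolvent (R : realType) n (A : 'M[R]_n) (w : R) :
  stable A -> (0 +i* w)%:M - cplxmx A \in unitmx.
Proof.
move=> stA; rewrite -row_free_unit -kermx_eq0; apply: contraT => ker.
have /rowV0Pn[v /sub_kermxP vA vN0] := ker.
have : eigenvalue (cplxmx A) (0 +i* w).
  apply/eigenvalueP; exists v => //; move/eqP: vA.
  by rewrite mulmxBr subr_eq0 mul_mx_scalar eq_sym => /eqP.
by move/stA; rewrite /= ltxx.
Qed.

Lemma imaginary_cube (R : realType) (t : R) :
  (0 +i* (t ^+ 3)) = - (0 +i* t) ^+ 3 :> R[i].
Proof.
have ReNc (z : R[i]) : complex.Re (- z) = - complex.Re z by case: z.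
have ImNc (z : R[i]) : complex.Im (- z) = - complex.Im z by case: z.
rewrite [(0 +i* t) ^+ 3]exprS [(0 +i* t) ^+ 2]expr2; apply/eqP; rewrite eq_complex.
rewrite ReNc ImNc !(ReMc, ImMc) [complex.Re (0 +i* _)]/= [complex.Im (0 +i* _)]/=.
by apply/andP; split; apply/eqP => /=; ring.
Qed.

(** * Bounds that follow from the resolvent identity and one value *)

Section ResolventBounds.
Context {R : realType} (n : nat) (X : R -> 'M[R[i]]_n) (ws K : R).
Hypothesis X_res : forall w w', X w' = X w - (0 +i* (w' - w)) *: (X w' *m X w).
Hypotheses (K_gt0 : 0 < K) (X_bound : nrm (cR (X ws)) <= K).

(** A self-improving estimate: for [|w - ws| <= (2 * K)^-1] the identity bounds [nrm (cR (X w))] by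
    [K] plus half of itself. *)
Lemma resolvent_le (w : R) : `|w - ws| <= (2 * K)^-1 -> nrm (cR (X w)) <= 2 * K.
Proof.
move=> hw; have := nrm_ge0 (cR (X w)); rewrite [in X in _ -> X](X_res ws w).
rewrite cRB cR_iscale => x0; apply: le_trans (nrmB _ _) _.
rewrite nrmZ nrm_J cRM.
have h1 : nrm (cR (X w) *m cR (X ws)) <= nrm (cR (X w)) * K.
  by apply: le_trans (nrmM _ _) _; rewrite ler_wpM2l.
have : nrm (cR (X w)) <= 2 * K.
  have xle : nrm (cR (X w)) <= K + `|w - ws| * (nrm (cR (X w)) * K).
    rewrite {1}(X_res ws w) cRB cR_iscale; apply: le_trans (nrmB _ _) _.
    by rewrite nrmZ nrm_J cRM lerD // ler_wpM2l.
  have hK : `|w - ws| * (2 * K) <= 1 by rewrite -ler_pdivlMr ?mulr_gt0 // mul1r.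
  have := ler_wpM2r x0 hK; lra.
move=> x2; have hK : `|w - ws| * (2 * K) <= 1 by rewrite -ler_pdivlMr ?mulr_gt0 // mul1r.
have := ler_wpM2l (normr_ge0 (w - ws)) h1.
have := ler_wpM2r (ltW K_gt0) hK; have := normr_ge0 (w - ws).
have : `|w - ws| * (nrm (cR (X w)) * K) <= `|w - ws| * (2 * K * K).
  by rewrite ler_wpM2l // ler_wpM2r // ltW.
by move: X_bound; lra.
Qed.

Lemma resolvent_lip (w w' : R) : `|w - ws| <= (2 * K)^-1 -> `|w' - ws| <= (2 * K)^-1 ->
  nrm (cR (X w') - cR (X w)) <= `|w' - w| * (2 * K) ^+ 2.
Proof.
move=> hw hw'; rewrite -cRB (X_res w w') addrC addKr -scaleN1r.
have -> : (-1 : R[i]) *: ((0 +i* (w' - w)) *: (X w' *m X w)) =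
   (0 +i* (- (w' - w))) *: (X w' *m X w).
  rewrite scaleN1r -scaleNr; congr (_ *: _).
  by apply/eqP; rewrite eq_complex /= oppr0 !eqxx.
rewrite cR_iscale nrmZ normrN nrm_J ler_wpM2l // cRM.
apply: le_trans (nrmM _ _) _; rewrite expr2.
by apply: ler_pM; rewrite ?nrm_ge0 // resolvent_le.
Qed.

End ResolventBounds.

(** Iterating the identity leaves three terms that involve only [b1], [b2], [b3]. The full and the
    reduced resolvent satisfy the hypotheses with the same vectors, so they differ only in the
    remainder, of third order in [z]. *)
Lemma resolvent_taylor3 (F : fieldType) n m (X Xr : 'M[F]_n) (b b1 b2 b3 : 'M[F]_(n, m)) z :
  X = Xr - z *: (X *m Xr) -> Xr *m b = b1 -> Xr *m b1 = b2 -> Xr *m b2 = b3 ->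
  X *m b = b1 - z *: b2 + z ^+ 2 *: b3 - z ^+ 3 *: (X *m b3).
Proof.
move=> XE e1 e2 e3.
have step (c c' : 'M[F]_(n, m)) : Xr *m c = c' -> X *m c = c' - z *: (X *m c').
  by move=> ce; rewrite {1}XE mulmxBl -scalemxAl -mulmxA ce.
rewrite (step _ _ e1) (step _ _ e2) (step _ _ e3).
by mxring.
Qed.

Lemma interpolation_error (R : realType) n m p d (A : 'M[R]_n) (B : 'M[R[i]]_(n, m))
    (C : 'M[R[i]]_(p, n)) (V : 'M[R[i]]_(n, d)) (wk w : R) :
  let S t := invmx ((0 +i* t)%:M - cplxmx A) in
  let b3 := S wk *m (S wk *m (S wk *m B)) in
  V ^t* *m V = 1%:M ->
  (forall t, (0 +i* t)%:M - cplxmx A \in unitmx) ->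
  (forall t, (0 +i* t)%:M - redA A V \in unitmx) ->
  ((row_mx (S wk *m B) (row_mx (S wk *m (S wk *m B)) b3))^T <= V^T)%MS ->
  transfer (redA A V) (V ^t* *m B) (C *m V) (0 +i* w) -
  transfer (cplxmx A) B C (0 +i* w) =
  (0 +i* ((w - wk) ^+ 3)) *: (C *m (red_resolvent A V w - S w) *m b3).
Proof.
move=> S b3 V_orth Su Vu; rewrite !tr_row_mx !col_mx_sub => /and3P[sub1 sub2 sub3].
rewrite transfer_red /transfer -/(S w).
have rng k (K : 'M[R[i]]_(n, k)) : (K^T <= V^T)%MS ->
    red_resolvent A V wk *m ((0 +i* wk)%:M - cplxmx A) *m K = K.
  exact: red_resolvent_range.
have SK k (K : 'M[R[i]]_(n, k)) : ((0 +i* wk)%:M - cplxmx A) *m (S wk *m K) = K.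
  by rewrite mulmxA mulmxV // mul1mx.
have WS k (K : 'M[R[i]]_(n, k)) : ((S wk *m K)^T <= V^T)%MS ->
    red_resolvent A V wk *m K = S wk *m K.
  by move=> /rng; rewrite -mulmxA SK.
have eS : S w = S wk - (0 +i* (w - wk)) *: (S w *m S wk) by exact: resolvent_identity.
have eW := red_resolvent_identity V_orth (Vu wk) (Vu w).
have tS := resolvent_taylor3 eS erefl erefl (erefl b3).
have tW := resolvent_taylor3 eW (WS _ _ sub1) (WS _ _ sub2) (WS _ _ sub3).
rewrite -/b3 in tW.
rewrite -[C *m red_resolvent A V w *m B]mulmxA -[C *m S w *m B]mulmxA -mulmxBr.
rewrite -[C *m (_ - _) *m b3]mulmxA scalemxAr; congr (_ *m _).
rewrite tW tS mulmxBl.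
rewrite imaginary_cube.
by mxring.
Qed.

(** The increment of a cube is of order [s * (b ^+ 2 + s)] with [s = |a' - a|] and [b = |a|]. A
    plain Lipschitz bound would lose the factor [b ^+ 2], which later becomes the quadratic rate. *)
Lemma cubic_error_step (R : realType) q r (P P' : 'M[R]_(q, r)) (a a' K L : R) :
  `|a| <= 1 -> `|a' - a| <= 1 -> 0 <= K -> 0 <= L ->
  nrm P' <= K -> nrm (P' - P) <= L * `|a' - a| ->
  nrm (a' ^+ 3 *: P' - a ^+ 3 *: P) <=
  (5 * K + L) * (`|a' - a| * (`|a| ^+ 2 + `|a' - a|)).
Proof.
move=> a1 s1 K0 L0 nP' nPP.
have -> : a' ^+ 3 *: P' - a ^+ 3 *: P = (a' ^+ 3 - a ^+ 3) *: P' + a ^+ 3 *: (P' - P).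
  by rewrite scalerBl scalerBr addrA subrK.
apply: le_trans (nrmD _ _) _; rewrite !nrmZ.
set s := `|a' - a| in s1 nPP *; have s0 : 0 <= s by rewrite normr_ge0.
set b := `|a| in a1 *; have b0 : 0 <= b by rewrite normr_ge0.
have d1 : `|a' ^+ 3 - a ^+ 3| <= s * (5 * (b ^+ 2 + s)).
  have -> : a' ^+ 3 - a ^+ 3 =
      (a' - a) * (3 * a ^+ 2 + 3 * (a * (a' - a)) + (a' - a) ^+ 2) by ring.
  rewrite normrM ler_wpM2l // -/s; apply: le_trans (ler_normD _ _) _.
  apply: le_trans (lerD (ler_normD _ _) (lexx _)) _.
  have -> : `|3 * a ^+ 2| = 3 * b ^+ 2 by rewrite normrM normrX ger0_norm.
  have -> : `|3 * (a * (a' - a))| = 3 * (b * s) by rewrite !normrM ger0_norm.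
  rewrite normrX -/s; have := ler_wpM2r s0 s1; have := sqr_ge0 (b - s).
  by have := sqr_ge0 b; move: s0; rewrite !expr2; clear; lra.
have d3 : `|a ^+ 3| <= b ^+ 2.
  by rewrite normrX -/b exprS ler_piMl ?sqr_ge0.
have bs0 : 0 <= s * (5 * (b ^+ 2 + s)).
  by rewrite !mulr_ge0 // addr_ge0 // sqr_ge0.
have t1 : `|a' ^+ 3 - a ^+ 3| * nrm P' <= s * (5 * (b ^+ 2 + s)) * K.
  by apply: ler_pM; rewrite ?nrm_ge0.
have t2 : `|a ^+ 3| * nrm (P' - P) <= b ^+ 2 * (L * s).
  by apply: ler_pM; rewrite ?nrm_ge0.
have : 0 <= L * (s * s) by rewrite !mulr_ge0.
by move: t1 t2; clear; lra.
Qed.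

Section ReducedError.
Context {R : realType} (n m p : nat).
Variables (A : 'M[R]_n) (B : 'M[R]_(n, m)) (C : 'M[R]_(p, n)).

Definition tfR (w : R) : 'M[R]_(p + p, m + m) :=
  cR (transfer (cplxmx A) (cplxmx B) (cplxmx C) (0 +i* w)).

Definition tfR_red d (V : 'M[R[i]]_(n, d)) (w : R) : 'M[R]_(p + p, m + m) :=
  cR (transfer (redA A V) (V ^t* *m cplxmx B) (cplxmx C *m V) (0 +i* w)).

Definition interpolates d (V : 'M[R[i]]_(n, d)) (wk : R) : Prop :=
  [/\ V ^t* *m V = 1%:M, (forall t : R, (0 +i* t)%:M - redA A V \in unitmx) &
      ((krylov3 A B wk)^T <= V^T)%MS].

Lemma reduced_error (ws beta : R) : stable A -> 0 < beta ->
  exists eta K : R, [/\ 0 < eta, 0 < K,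
   (forall w w', `|w - ws| < eta -> `|w' - ws| < eta ->
      nrm (tfR w' - tfR w) <= K * `|w' - w|) &
   forall d (V : 'M[R[i]]_(n, d)) wk,
     interpolates V wk -> beta <= singval_min ((0 +i* ws)%:M - redA A V) ->
     `|wk - ws| < eta -> forall w w', `|w - ws| < eta -> `|w' - ws| < eta ->
     nrm (tfR_red V w - tfR w) <= K * `|w - wk| ^+ 3 /\
     nrm ((tfR_red V w' - tfR w') - (tfR_red V w - tfR w)) <=
       K * (`|w' - w| * (`|w - wk| ^+ 2 + `|w' - w|))].
Proof.
move=> stA beta0.
have Su t := stable_resolvent t stA.
pose S (t : R) := invmx ((0 +i* t)%:M - cplxmx A).
have S_res (w w' : R) : S w' = S w - (0 +i* (w' - w)) *: (S w' *m S w).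
  exact: resolvent_identity.
(* A common bound at [ws] for the full resolvent and, through [beta], for every admissible reduced
   one; it is fixed before [V]. *)
pose k := 4 * (beta^-1 *+ (n * n)) + nrm (cR (S ws)) + 1.
have k1 : 4 * (beta^-1 *+ (n * n)) <= k.
  by rewrite /k -addrA lerDl addr_ge0 ?nrm_ge0.
have k20 : 0 <= 4 * (beta^-1 *+ (n * n)).
  by rewrite mulr_ge0 // mulrn_wge0 // invr_ge0 ltW.
have k2 : nrm (cR (S ws)) <= k by rewrite /k; move: k20; clear; lra.
have k0 : 0 < k.
  by rewrite /k; have := nrm_ge0 (cR (S ws)); move: k20; clear; lra.
clearbody k.
pose eta := Num.min (2 * k)^-1 (1 / 2).
have eta0 : 0 < eta by rewrite lt_min invr_gt0 mulr_gt0 // divr_gt0.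
have eta1 (x : R) : `|x - ws| < eta -> `|x - ws| <= (2 * k)^-1.
  by move=> /ltW /le_trans; apply; rewrite ge_min lexx.
have eta2 (x y : R) : `|x - ws| < eta -> `|y - ws| < eta -> `|x - y| <= 1.
  have eh : eta <= 1 / 2 by rewrite ge_min lexx orbT.
  move=> hx hy; have := ler_distD ws x y; rewrite (distrC ws y).
  by move: hx hy eh; clear; lra.
pose nB := nrm (cR (cplxmx B)); pose nC := nrm (cR (cplxmx C)).
have nB0 : 0 <= nB by exact: nrm_ge0.
have nC0 : 0 <= nC by exact: nrm_ge0.
pose k3 := (2 * k) * ((2 * k) * ((2 * k) * nB)).
have k30 : 0 <= k3 by rewrite !mulr_ge0 // ltW.
pose K1 := nC * (2 * k) ^+ 2 * nB.
pose K2 := nC * (2 * k + 2 * k) * k3.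
pose K3 := nC * (2 * (2 * k) ^+ 2) * k3.
have kk0 : 0 <= (2 * k) ^+ 2 by exact: sqr_ge0.
have K10 : 0 <= K1 by exact: mulr_ge0 (mulr_ge0 nC0 kk0) nB0.
have K20 : 0 <= K2 by rewrite !mulr_ge0 ?addr_ge0 ?mulr_ge0 // ltW.
have K30 : 0 <= K3.
  by apply: mulr_ge0 k30; apply: mulr_ge0 nC0 _; exact: mulr_ge0.
have nrm3 q1 q2 q3 q4 (X : 'M[R]_(q1, q2)) (Y : 'M[R]_(q2, q3)) (Z : 'M[R]_(q3, q4)) x y z :
    nrm X <= x -> nrm Y <= y -> nrm Z <= z -> nrm (X *m Y *m Z) <= x * y * z.
  move=> hx hy hz; apply: le_trans (nrmM _ _) _; apply: ler_pM; rewrite ?nrm_ge0 //.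
  by apply: le_trans (nrmM _ _) _; apply: ler_pM; rewrite ?nrm_ge0.
exists eta, (K1 + (5 * K2 + K3) + 1); split => //.
- by move: K10 K20 K30; clear; lra.
- move=> w w' hw hw'.
  have Slip := resolvent_lip S_res k0 k2 (eta1 _ hw) (eta1 _ hw').
  rewrite /tfR -cRB /transfer -mulmxBl -mulmxBr !cRM cRB.
  apply: le_trans (nrm3 _ _ _ _ _ _ _ _ _ _ (lexx nC) Slip (lexx nB)) _.
  rewrite [X in X <= _](_ : _ = K1 * `|w' - w|); last by rewrite /K1; ring.
  by rewrite ler_wpM2r //; move: K20 K30; clear; lra.
move=> d V wk [V_orth Vu sub] beta_le hk w w' hw hw'.
have W_res (t t' : R) : red_resolvent A V t' = red_resolvent A V t -
    (0 +i* (t' - t)) *: (red_resolvent A V t' *m red_resolvent A V t).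
  exact: red_resolvent_identity.
have W_bound : nrm (cR (red_resolvent A V ws)) <= k.
  exact: le_trans (red_resolvent_bound V_orth beta0 (Vu ws) beta_le) k1.
pose b3 := S wk *m (S wk *m (S wk *m cplxmx B)).
have nb3 : nrm (cR b3) <= k3.
  have Sk := resolvent_le S_res k0 k2 (eta1 _ hk).
  by do 3! (rewrite cRM; apply: le_trans (nrmM _ _) _; apply: ler_pM;
    rewrite ?nrm_ge0 //).
pose P t := Jmx p *m (cR (cplxmx C) *m (cR (red_resolvent A V t) - cR (S t)) *m cR b3).
have errE t : tfR_red V t - tfR t = (t - wk) ^+ 3 *: P t.
  rewrite /tfR_red /tfR -cRB (interpolation_error _ _ V_orth Su Vu sub) cR_iscale.
  by rewrite -/(S t) -/(S wk) -/b3 (cRM _ b3) (cRM (cplxmx C)) cRB.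
have nP t : `|t - ws| < eta -> nrm (P t) <= K2.
  move=> ht; rewrite /P nrm_J; apply: nrm3 nb3 => //.
  apply: le_trans (nrmB _ _) _; apply: lerD.
    exact: resolvent_le W_res k0 W_bound _ (eta1 _ ht).
  exact: resolvent_le S_res k0 k2 _ (eta1 _ ht).
have nPP : nrm (P w' - P w) <= K3 * `|w' - w|.
  rewrite /P -mulmxBr -mulmxBl -mulmxBr nrm_J.
  have Wlip := resolvent_lip W_res k0 W_bound (eta1 _ hw) (eta1 _ hw').
  have Slip := resolvent_lip S_res k0 k2 (eta1 _ hw) (eta1 _ hw').
  rewrite [X in _ <= X](_ : _ = nC * (`|w' - w| * (2 * (2 * k) ^+ 2)) * k3); last first.
    by rewrite /K3; ring.
  apply: nrm3 nb3 => //; move: Wlip Slip.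
  move: (cR (red_resolvent A V w')) (cR (red_resolvent A V w)) (cR (S w')) (cR (S w)).
  move=> X' X Y' Y hX hY; have -> : X' - Y' - (X - Y) = (X' - X) - (Y' - Y).
    by mxring.
  by apply: le_trans (nrmB _ _) _; move: hX hY; clear; lra.
suff main X X' : X = (w - wk) ^+ 3 *: P w -> X' = (w' - wk) ^+ 3 *: P w' ->
    nrm X <= (K1 + (5 * K2 + K3) + 1) * `|w - wk| ^+ 3 /\
    nrm (X' - X) <=
      (K1 + (5 * K2 + K3) + 1) * (`|w' - w| * (`|w - wk| ^+ 2 + `|w' - w|)).
  exact: main (errE w) (errE w').
move=> -> ->; split.
  rewrite nrmZ normrX mulrC; apply: ler_pM; rewrite ?nrm_ge0 ?exprn_ge0 //.
  by apply: le_trans (nP _ hw) _; move: K10 K20 K30; clear; lra.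
have -> : w' - w = (w' - wk) - (w - wk) by ring.
have ww' : (w' - wk) - (w - wk) = w' - w by ring.
apply: le_trans (cubic_error_step _ _ K20 K30 (nP _ hw') _) _.
- exact: eta2.
- by rewrite ww' eta2.
- by rewrite ww'.
rewrite ler_wpM2r //; first by rewrite mulr_ge0 // addr_ge0 // sqr_ge0.
by move: K10; clear; lra.
Qed.

End ReducedError.

(** * Rate of convergence *)

Section RealFunctions.
Context {R : realType}.
Implicit Types f : R -> R.

Lemma lipschitz_min f (a b K : R) : a <= b ->
  (forall x y, a <= x <= b -> a <= y <= b -> `|f x - f y| <= K * `|x - y|) ->
  exists2 c, a <= c <= b & forall t, a <= t <= b -> f c <= f t.
Proof.
move=> ab lip; have [|c cab cmin] := @EVT_min R f a b ab.
  apply/subspace_continuousP => x; rewrite /= in_itv /= => xab.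
  apply/cvgrPdist_lt => e e0; rewrite near_withinE.
  have K1 : 0 < `|K| + 1 by rewrite ltr_wpDl.
  apply/nbhs_ballP; exists (e / (`|K| + 1)); rewrite /= ?divr_gt0 // => y /=.
  rewrite /ball /= ltr_pdivlMr // => yx; rewrite in_itv /= => yab.
  apply: le_lt_trans (lip _ _ xab yab) _; apply: le_lt_trans yx.
  by rewrite mulrC ler_wpM2l // (le_trans (ler_norm K)) // lerDl.
exists c; first by move: cab; rewrite in_itv.
by move=> t tab; apply: cmin; rewrite in_itv.
Qed.

Lemma derivable_approx f (x : R) : derivable f x 1 ->
  forall e, 0 < e -> exists2 r, 0 < r &
    forall h, `|h| < r -> `|f (x + h) - f x - derive1 f x * h| <= e * `|h|.
Proof.
move=> df e e0.
have cv : (fun h => h^-1 *: (f (h + x) - f x)) @ 0^' --> derive1 f x.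
  rewrite derive1E; have := df; rewrite /derivable /derive.
  have -> : (fun h => h^-1 *: ((f \o shift x) (h *: 1) - f x)) =
            (fun h => h^-1 *: (f (h + x) - f x)).
    by apply/funext => h /=; rewrite [h%:A](mulr1).
  by [].
have /cvgrPdist_lt/(_ e e0) := cv.
rewrite /nbhs /= /dnbhs /within /= => /nbhs_ballP[r /= r0 hr].
exists r => // h hhr; have [->|h0] := eqVneq h 0.
  by rewrite addr0 mulr0 subrr subr0 normr0 mulr0.
have := hr h; rewrite /ball /= sub0r normrN => /(_ hhr h0) hq.
have hn : 0 < `|h| by rewrite normr_gt0.
rewrite -ler_pdivrMr //; apply: ltW; apply: le_lt_trans hq.
rewrite -normfV -normrM -normrN le_eqVlt; apply/orP; left; apply/eqP.
by congr (`| _ |); rewrite /GRing.scale /= (addrC h); field.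
Qed.

Lemma derivative_local_max f (x : R) : derivable f x 1 ->
  (\forall y \near x, f y <= f x) -> derive1 f x = 0.
Proof.
move=> df /nbhs_ballP[r0 /= r00 fmax]; apply/eqP; rewrite -normr_le0.
apply/ler_addgt0Pl => e e0; rewrite addr0.
have [r r_gt0 hr] := derivable_approx df e0.
pose h := Num.min r r0 / 2; have h0 : 0 < h by rewrite divr_gt0 // lt_min r_gt0.
have hr0 : h < r0.
  have : Num.min r r0 <= r0 by rewrite ge_min lexx orbT.
  by rewrite /h; move: r00; lra.
have hr1 : h < r.
  have : Num.min r r0 <= r by rewrite ge_min lexx.
  by rewrite /h; move: r_gt0; lra.
have step k : `|k| = h -> derive1 f x * k <= e * h.
  move=> kh; have := hr k; rewrite kh => /(_ hr1); rewrite ler_norml => /andP[lo _].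
  have : f (x + k) <= f x.
    by apply: fmax; rewrite /ball /= opprD addrA subrr add0r normrN kh.
  by lra.
have := step h (gtr0_norm h0); have := step (- h); rewrite normrN gtr0_norm // => /(_ erefl).
rewrite mulrN => h1 h2; rewrite -(ler_pM2r h0) -[X in _ * X](gtr0_norm h0) -normrM.
by rewrite ler_norml; apply/andP; split; lra.
Qed.

End RealFunctions.

(** [mu] as a function of the realified transfer matrix alone, so that the full and the reduced
    functions are values of one map. *)
Definition kap (R : realType) p m (Gam : R) (N : 'M[R]_(p + p, m + m)) : R :=
  inf [set singval (cplxmx (Tg g N)) 2 | g in Omega Gam].

(** * The minimum over the weight *)

Section Kappa.
Context {R : realType} (p m : nat).
Implicit Types (N : 'M[R]_(p + p, m + m)) (g : R).

Lemma singval_ge0 q r (M : 'M[R[i]]_(q, r)) i : 0 <= singval M i.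
Proof.
have [i_lt|i_ge] := ltnP i.-1 (size (singvals M)); last first.
  by rewrite /singval nth_default.
have := mem_nth 0 i_lt; rewrite -/(singval M i) => /mem_take.
by rewrite mem_sort => /mapP[j _ ->]; exact: sqrtr_ge0.
Qed.

Lemma lam2_Tg_lip Gam N N' g g' : (0 < p)%N -> (0 < m)%N -> 0 < Gam ->
  Gam <= g <= 1 -> Gam <= g' <= 1 ->
  `|lam2 (Tg g N) - lam2 (Tg g' N')| <=
  Gam^-2 * (nrm N + nrm N') * (Gam^-2 * (nrm (N - N') + `|g - g'| * nrm N')).
Proof.
move=> p0 m0 G0 gO g'O.
apply: le_trans (lam2_weyl (leq_add p0 p0) (leq_add m0 m0) _ _) _.
apply: le_trans (gram_sub_le _ _) _; apply: ler_pM; rewrite ?addr_ge0 ?nrm_ge0 //.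
  by rewrite mulrDr lerD // nrm_Tg.
exact: Tg_near.
Qed.

Lemma kap_min Gam N : (0 < p)%N -> (0 < m)%N -> 0 < Gam -> Gam <= 1 ->
  exists g, [/\ Gam <= g <= 1, kap Gam N = singval (cplxmx (Tg g N)) 2 &
    forall g', Gam <= g' <= 1 -> lam2 (Tg g N) <= lam2 (Tg g' N)].
Proof.
move=> p0 m0 G0 G1.
have [x y xO yO|g gO gmin] := @lipschitz_min _ (fun g => lam2 (Tg g N)) Gam 1
  (Gam^-2 * (nrm N + nrm N) * (Gam^-2 * nrm N)) G1.
  apply: le_trans (lam2_Tg_lip _ _ p0 m0 G0 xO yO) _.
  rewrite subrr nrm0 add0r le_eqVlt; apply/orP; left; apply/eqP; ring.
exists g; split => //; apply/eqP; rewrite eq_le; apply/andP; split.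
  apply: ge_inf; last by exists g.
  by exists 0 => _ [h _ <-]; exact: singval_ge0.
apply: lb_le_inf; first by exists (singval (cplxmx (Tg g N)) 2); exists g.
move=> _ [h hO <-]; have := gmin h hO.
by rewrite /lam2 ler_pXn2r ?nnegrE ?singval_ge0.
Qed.

Lemma ssMu_kap n (A : 'M[R[i]]_n) (B : 'M[R[i]]_(n, m)) (C : 'M[R[i]]_(p, n)) Gam w :
  ssMu A B C Gam w = kap Gam (cR (transfer A B C (0 +i* w))).
Proof.
have E : ssSigma A B C 2 w =
    (fun g => singval (cplxmx (Tg g (cR (transfer A B C (0 +i* w))))) 2).
  by apply/funext => g; rewrite -ssT_Tg.
exact: (congr1 (fun F : R -> R => inf [set F g | g in Omega Gam]) E).
Qed.

(** Outside the [e]-neighborhood of [g0] the values at [N0] exceed the minimum by some [d], by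
    compactness of the two remaining intervals. A perturbation that moves all values by less than
    [d / 2] cannot carry a minimizer there. *)
Lemma minimizer_near (Gam g0 e : R) (N0 : 'M[R]_(p + p, m + m)) :
  (0 < p)%N -> (0 < m)%N -> 0 < Gam -> Gam <= g0 <= 1 -> 0 < e ->
  (forall g, Gam <= g <= 1 -> g != g0 -> lam2 (Tg g0 N0) < lam2 (Tg g N0)) ->
  exists2 rho : R, 0 < rho & forall N g, nrm (N - N0) < rho -> Gam <= g <= 1 ->
    (forall g', Gam <= g' <= 1 -> lam2 (Tg g N) <= lam2 (Tg g' N)) -> `|g - g0| < e.
Proof.
move=> p0 m0 G0 g0O e0 uniq_min.
have arith (a b c b' x K d : R) : - (a - b) <= K * x -> c - b' <= K * x ->
    x * (2 * (K + 1)) < d -> b' + d <= b -> a <= c -> 0 <= x -> False.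
  by clear; lra.
have lip x y : Gam <= x <= 1 -> Gam <= y <= 1 ->
    `|lam2 (Tg x N0) - lam2 (Tg y N0)| <=
    Gam^-2 * (nrm N0 + nrm N0) * (Gam^-2 * nrm N0) * `|x - y|.
  move=> xO yO; apply: le_trans (lam2_Tg_lip _ _ p0 m0 G0 xO yO) _.
  by rewrite subrr nrm0 add0r le_eqVlt; apply/orP; left; apply/eqP; ring.
have gap_on (a b : R) : Gam <= a -> b <= 1 -> (forall g, a <= g <= b -> g != g0) ->
    exists2 d, 0 < d & forall g, a <= g <= b -> lam2 (Tg g0 N0) + d <= lam2 (Tg g N0).
  move=> Ga b1 away; have [ab|ba] := leP a b; last first.
    exists 1 => // g /andP[ag gb]; have := le_trans ag gb; by rewrite leNgt ba.
  have sub x : a <= x <= b -> Gam <= x <= 1.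
    by case/andP=> ax xb; rewrite (le_trans Ga ax) (le_trans xb b1).
  have [x y xab yab|c cab cmin] := @lipschitz_min _ (fun g => lam2 (Tg g N0)) a b
      (Gam^-2 * (nrm N0 + nrm N0) * (Gam^-2 * nrm N0)) ab.
    by apply: lip; apply: sub.
  exists (lam2 (Tg c N0) - lam2 (Tg g0 N0)).
    by rewrite subr_gt0; apply: uniq_min; [exact: sub | exact: away].
  by move=> g gab; rewrite addrC subrK; exact: cmin.
have [d1 d1_gt0 gap1] : exists2 d, 0 < d & forall g, Gam <= g <= g0 - e ->
    lam2 (Tg g0 N0) + d <= lam2 (Tg g N0).
  apply: gap_on => //; first by case/andP: g0O => _; move: e0; clear; lra.
  by move=> g /andP[_ ge]; rewrite lt_eqF //; move: ge e0; clear; lra.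
have [d2 d2_gt0 gap2] : exists2 d, 0 < d & forall g, g0 + e <= g <= 1 ->
    lam2 (Tg g0 N0) + d <= lam2 (Tg g N0).
  apply: gap_on => //; first by case/andP: g0O => + _; move: e0; clear; lra.
  by move=> g /andP[ge _]; rewrite gt_eqF //; move: ge e0; clear; lra.
pose K := Gam^-2 * (2 * nrm N0 + 1) * Gam^-2.
have L0 : 0 <= Gam^-2 by rewrite invr_ge0 exprn_ge0 // ltW.
have n0 := nrm_ge0 N0.
have b0 : 0 <= 2 * nrm N0 + 1 by move: n0; clear; lra.
have K0 : 0 <= K by rewrite !mulr_ge0.
have close N g : nrm (N - N0) < 1 -> Gam <= g <= 1 ->
    `|lam2 (Tg g N) - lam2 (Tg g N0)| <= K * nrm (N - N0).
  move=> hN gO; apply: le_trans (lam2_Tg_lip _ _ p0 m0 G0 gO gO) _.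
  rewrite subrr normr0 mul0r addr0 !mulrA ler_wpM2r ?nrm_ge0 // ler_wpM2r //.
  rewrite ler_wpM2l //; have : nrm N <= nrm N0 + nrm (N - N0).
    by rewrite -{1}(subrK N0 N) addrC nrmD.
  by move: hN; clear; lra.
pose d := Num.min d1 d2; pose rho := Num.min 1 (d / (2 * (K + 1))).
have d_gt0 : 0 < d by rewrite lt_min d1_gt0.
have K1 : 0 < 2 * (K + 1) by rewrite mulr_gt0 // ltr_wpDl.
exists rho; first by rewrite lt_min ltr01 divr_gt0.
move=> N g; rewrite lt_min => /andP[hN1 hN2] gO gmin.
rewrite ltr_pdivlMr // in hN2.
have c1 := close _ _ hN1 gO; have c2 := close _ _ hN1 g0O; have c3 := gmin _ g0O.
rewrite ltNge; apply/negP => far.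
have gd : lam2 (Tg g0 N0) + d <= lam2 (Tg g N0).
  have /andP[Gg g1] := gO; have dd1 : d <= d1 by rewrite ge_min lexx.
  have dd2 : d <= d2 by rewrite ge_min lexx orbT.
  move: far; rewrite ler_normr => /orP[far|far].
    apply: le_trans (gap2 g _); first by rewrite lerD2l.
    by rewrite g1 andbT -lerBrDl.
  apply: le_trans (gap1 g _); first by rewrite lerD2l.
  by rewrite Gg /= lerBrDr -lerBrDl -opprB.
have nn := nrm_ge0 (N - N0).
have /ler_normlP[c1' _] := c1; have /ler_normlP[_ c2'] := c2.
exact: arith c1' c2' hN2 gd c3 nn.
Qed.

End Kappa.

Definition minimizes (R : realType) p m (Gam : R) (N : 'M[R]_(p + p, m + m)) g :=
  Gam <= g <= 1 /\ forall g', Gam <= g' <= 1 -> lam2 (Tg g N) <= lam2 (Tg g' N).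

Lemma lam2_local_data (R : realType) p m (Gam g0 : R) (N0 : 'M[R]_(p + p, m + m)) :
  (0 < p)%N -> (0 < m)%N -> 0 < Gam -> Gam <= g0 < 1 ->
  simple_singval (cplxmx (Tg g0 N0)) (singval (cplxmx (Tg g0 N0)) 2) ->
  0 < lam2 (Tg g0 N0) ->
  (forall g, Gam <= g <= 1 -> g != g0 -> lam2 (Tg g0 N0) < lam2 (Tg g N0)) ->
  exists rho e K c : R, [/\ [/\ 0 < rho, 0 < K & 0 < c],
    forall N g, nrm (N - N0) < rho -> minimizes Gam N g -> `|g - g0| < e,
    forall g N1 N2 N3 N4, Gam <= g <= 1 -> `|g - g0| < e ->
      nrm (N1 - N0) < rho -> nrm (N2 - N0) < rho ->
      nrm (N3 - N0) < rho -> nrm (N4 - N0) < rho ->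
      `|(lam2 (Tg g N1) - lam2 (Tg g N2)) - (lam2 (Tg g N3) - lam2 (Tg g N4))| <=
      K * (nrm ((N1 - N2) - (N3 - N4)) +
           nrm (N3 - N4) * (nrm (N1 - N3) + nrm (N2 - N4))),
    forall g g' N N', Gam <= g <= 1 -> Gam <= g' <= 1 -> `|g - g0| < e -> `|g' - g0| < e ->
      nrm (N - N0) < rho -> nrm (N' - N0) < rho ->
      `|(lam2 (Tg g N) - lam2 (Tg g N')) - (lam2 (Tg g' N) - lam2 (Tg g' N'))| <=
      K * (nrm (N - N') * `|g - g'|)
    & forall N g1 g, N *m Jmx m = Jmx p *m N -> nrm (N - N0) < rho ->
      minimizes Gam N g1 -> Gam <= g <= 1 ->
      lam2 (Tg g1 N) + c * (g - g1) ^+ 2 <= lam2 (Tg g N)].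
Proof.
move=> p0 m0 G0 g0O simp pos uniq_min.
have g0O' : Gam <= g0 <= 1 by case/andP: g0O => -> /ltW.
have [r0 [K [r00 K0 four]]] :=
  lam2_four_point (leq_add p0 p0) (leq_add m0 m0) simp pos.
have [r1 [c [r10 c0 growth]]] := lam2_growth p0 m0 G0 g0O simp pos uniq_min.
pose L := Gam^-2.
have L0 : 0 < L by rewrite invr_gt0 exprn_gt0.
pose b := nrm N0 + 1; have b0 : 0 < b by rewrite ltr_wpDl ?nrm_ge0.
(* [L * (a + a * nrm N0) = r0]: moving both [N] and [g] by less than [a] stays in the ball of the
   four-point estimate. *)
pose a := r0 / (L * b).
have a0 : 0 < a by rewrite divr_gt0 // mulr_gt0.
pose e := Num.min a r1; have e0 : 0 < e by rewrite lt_min a0.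
have [r2 r20 near] := minimizer_near p0 m0 G0 g0O' e0 uniq_min.
pose rho := Num.min 1 (Num.min a (Num.min r1 r2)).
have rho0 : 0 < rho by rewrite !lt_min ltr01 a0 r10.
have rhoP (x : R) : x < rho -> [/\ x < 1, x < a, x < r1 & x < r2].
  by rewrite !lt_min => /and4P[].
have eP (x : R) : x < e -> x < a /\ x < r1 by rewrite lt_min => /andP[].
clearbody rho e.
have inball g N : Gam <= g <= 1 -> `|g - g0| < e -> nrm (N - N0) < rho ->
    nrm (Tg g N - Tg g0 N0) < r0.
  move=> gO /eP[ga _] /rhoP[_ Na _ _].
  apply: le_lt_trans (Tg_near N N0 G0 gO g0O') _.
  have -> : r0 = L * (a + a * nrm N0).
    by rewrite /a -[X in _ + X * _]mul1r; move: b0 L0; rewrite /b; clear => ? ?; field; lra.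
  rewrite ltr_pM2l // ltr_leD // ler_wpM2r ?nrm_ge0 // ltW //.
pose K' := K * (L + L ^+ 2) + K * (L + L * (2 * L * b)).
have L2 : 0 < L ^+ 2 by rewrite exprn_gt0.
have Ka : 0 < K * (L + L ^+ 2) by rewrite mulr_gt0 // addr_gt0.
have Kb : 0 < K * (L + L * (2 * L * b)) by rewrite mulr_gt0 // addr_gt0 // !mulr_gt0.
have K'0 : 0 < K' by rewrite addr_gt0.
have ar1 x y z : 0 <= x -> 0 <= y -> 0 <= z.1 + z.2 ->
    K * (L * x + L * y * (L * z.1 + L * z.2)) <= K' * (x + y * (z.1 + z.2)).
  move=> x0 y0 z0; have yz := mulr_ge0 y0 z0.
  have -> : K * (L * x + L * y * (L * z.1 + L * z.2)) =
    K * L * x + K * L ^+ 2 * (y * (z.1 + z.2)) by ring.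
  rewrite [X in _ <= X]mulrDr; apply: lerD; rewrite ler_wpM2r // /K'.
    by move: Kb (mulr_gt0 K0 L2); rewrite mulrDr; clear; lra.
  by move: Kb (mulr_gt0 K0 L0); rewrite mulrDr; clear; lra.
have ar2 x y : 0 <= x * y ->
    K * (L * y * x + L * x * (L * y * b + L * y * b)) <= K' * (x * y).
  move=> xy0.
  have -> : K * (L * y * x + L * x * (L * y * b + L * y * b)) =
    K * (L + L * (2 * L * b)) * (x * y) by ring.
  by rewrite ler_wpM2r // lerDr ltW.
exists rho, e, K', c; split.
- by split.
- move=> N g /rhoP[_ _ _ Nr] [gO gm]; exact: near Nr gO gm.
- move=> g N1 N2 N3 N4 gO ge h1 h2 h3 h4.
  apply: le_trans (four _ _ _ _ (inball _ _ gO ge h1) (inball _ _ gO ge h2)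
    (inball _ _ gO ge h3) (inball _ _ gO ge h4)) _.
  rewrite -!Tg_sub.
  apply: le_trans (_ : K * (L * nrm (N1 - N2 - (N3 - N4)) +
    L * nrm (N3 - N4) * (L * nrm (N1 - N3) + L * nrm (N2 - N4))) <= _).
    rewrite ler_wpM2l ?(ltW K0) // lerD ?nrm_Tg // ler_pM ?addr_ge0 ?nrm_ge0 ?nrm_Tg //.
    by rewrite lerD ?nrm_Tg.
  apply: (ar1 _ _ (nrm (N1 - N3), nrm (N2 - N4))); rewrite ?addr_ge0 ?nrm_ge0 //.
- move=> g g' N N' gO g'O ge g'e hN hN'.
  apply: le_trans (four _ _ _ _ (inball _ _ gO ge hN) (inball _ _ gO ge hN')
    (inball _ _ g'O g'e hN) (inball _ _ g'O g'e hN')) _.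
  rewrite -!Tg_sub.
  have nb M : nrm (M - N0) < rho -> nrm M <= b.
    move=> /rhoP[/ltW h1 _ _ _]; rewrite -(subrK N0 M); apply: le_trans (nrmD _ _) _.
    by rewrite addrC lerD2l.
  have nTb M : nrm (M - N0) < rho -> nrm (Tg g M - Tg g' M) <= L * `|g - g'| * b.
    move=> hM; apply: le_trans (nrm_Tg_sub M G0 gO g'O) _.
    by rewrite ler_wpM2l ?nb // mulr_ge0 // ltW.
  apply: le_trans (_ : K * (L * `|g - g'| * nrm (N - N') +
    L * nrm (N - N') * (L * `|g - g'| * b + L * `|g - g'| * b)) <= _).
    rewrite ler_wpM2l ?(ltW K0) // lerD ?nrm_Tg_sub // ler_pM ?addr_ge0 ?nrm_ge0 ?nrm_Tg //.
    by rewrite lerD ?nTb.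
  apply: ar2; rewrite ?mulr_ge0 ?nrm_ge0 //.
move=> N g1 g NJ /[dup] hN /rhoP[_ _ Nr1 Nr2] [g1O g1m] gO.
have [_ g1r] := eP _ (near _ _ Nr2 g1O g1m).
exact: growth.
Qed.

(** In [increment_bound], [a], [b], [u], [v] are the values of [lam2] at [h'], [h], [v'], [v]; the
    index 1 or 2 refers to the weight [g1] optimal for [h] or [g2] optimal for [v'], and
    [D = g2 - g1]. Growth gives [c * D ^+ 2 <= b2 - b1], which by [u2 <= u1] is at most a mixed
    difference of order [E * |D|], so [|D|] is of order [E]. Finally [a1 - b1] equals [u2 - v2 <= 0]
    up to two mixed differences. *)
Lemma increment_arith (R : realType) (a1 a2 b1 b2 u2 u1 v2 K L c D E t : R) :
  0 <= K -> 0 <= L -> 0 < c -> 0 <= t ->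
  `|(a2 - b2) - (u2 - v2)| <= K * (L * (t * E) + 3 * L * t * (3 * L * E)) ->
  u2 <= v2 -> b1 + c * D ^+ 2 <= b2 -> u2 <= u1 ->
  `|(b2 - u2) - (b1 - u1)| <= K * (3 * L * E * `|D|) ->
  `|(a1 - b1) - (a2 - b2)| <= K * (L * t * `|D|) ->
  0 <= E ->
  a1 - b1 <= (K * (L + 9 * L ^+ 2) + 3 * (K * L) ^+ 2 / c) * (E * t).
Proof.
move=> K0 L0 c0 t0 /ler_normlP[_ h1] h2 h3 h4 /ler_normlP[_ h5] /ler_normlP[_ h6] E0.
have D0 := normr_ge0 D.
have hD : c * `|D| <= 3 * K * L * E.
  have [->|DN0] := eqVneq D 0; first by rewrite normr0 mulr0 !mulr_ge0.
  have Dp : 0 < `|D| by rewrite normr_gt0.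
  rewrite -(ler_pM2r Dp).
  have -> : c * `|D| * `|D| = c * D ^+ 2 by rewrite -mulrA -normrM -expr2 ger0_norm ?sqr_ge0.
  by move: h3 h4 h5; clear; lra.
have hD' : `|D| <= 3 * K * L * E / c by rewrite ler_pdivlMr // mulrC.
have := ler_wpM2l (mulr_ge0 (mulr_ge0 K0 L0) t0) hD'.
have -> : K * L * t * (3 * K * L * E / c) = 3 * (K * L) ^+ 2 / c * (E * t) by ring.
have e1 : K * (L * (t * E) + 3 * L * t * (3 * L * E)) = K * (L + 9 * L ^+ 2) * (E * t).
  by ring.
rewrite e1 in h1; rewrite mulrDl; move: h1 h2 h6; clear; lra.
Qed.

Lemma kap_minimizes (R : realType) p m Gam (N : 'M[R]_(p + p, m + m)) :
  (0 < p)%N -> (0 < m)%N -> 0 < Gam -> Gam <= 1 ->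
  exists2 g, minimizes Gam N g & kap Gam N ^+ 2 = lam2 (Tg g N).
Proof.
by move=> p0 m0 G0 G1; have [g [gO -> gmin]] := kap_min N p0 m0 G0 G1; exists g.
Qed.

Lemma kap_ge0 (R : realType) p m Gam (N : 'M[R]_(p + p, m + m)) :
  (0 < p)%N -> (0 < m)%N -> 0 < Gam -> Gam <= 1 -> 0 <= kap Gam N.
Proof.
by move=> p0 m0 G0 G1; have [g [_ -> _]] := kap_min N p0 m0 G0 G1; exact: singval_ge0.
Qed.

Lemma increment_bound (R : realType) n m p (A : 'M[R]_n) (B : 'M[R]_(n, m))
    (C : 'M[R]_(p, n)) (Gam ws gs beta : R) (N0 := tfR A B C ws) :
  stable A -> 0 < beta -> (0 < p)%N -> (0 < m)%N -> 0 < Gam -> Gam <= gs < 1 ->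
  simple_singval (cplxmx (Tg gs N0)) (singval (cplxmx (Tg gs N0)) 2) ->
  0 < lam2 (Tg gs N0) ->
  (forall g, Gam <= g <= 1 -> g != gs -> lam2 (Tg gs N0) < lam2 (Tg g N0)) ->
  exists eta K : R, [/\ 0 < eta, 0 < K & forall d (V : 'M[R[i]]_(n, d)) wk w1 s,
    interpolates A B V wk ->
    beta <= singval_min ((0 +i* ws)%:M - redA A V) ->
    (forall t, kap Gam (tfR_red A B C V t) <= kap Gam (tfR_red A B C V w1)) ->
    `|wk - ws| < eta -> `|w1 - ws| < eta -> `|w1 + s - ws| < eta ->
    kap Gam (tfR A B C (w1 + s)) ^+ 2 - kap Gam (tfR A B C w1) ^+ 2 <=
    K * ((`|w1 - wk| ^+ 2 + `|s|) * `|s|)].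
Proof.
move=> stA beta0 p0 m0 G0 gsO simp pos uniq_min.
have G1 : Gam <= 1 by case/andP: gsO => h1 /ltW; exact: le_trans.
have [eta1 [L [eta10 L0 lip red]]] := reduced_error B C ws stA beta0.
have [rho [e [K [c [[rho0 K0 c0] near same mixed growth]]]]] :=
  lam2_local_data p0 m0 G0 gsO simp pos uniq_min.
(* Three distances add up when a reduced matrix is compared with [N0]: [|w - ws|] twice and
   [|wk - ws|] once, each multiplied by [L]. *)
pose eta := Num.min eta1 (Num.min (1 / 2) (rho / (3 * L))).
have eta0 : 0 < eta by rewrite !lt_min eta10 !divr_gt0 ?mulr_gt0.
have etaP x : x < eta -> [/\ x < eta1, x < 1 / 2 & x * (3 * L) < rho].
  by rewrite !lt_min => /and3P[? ? ?]; rewrite -ltr_pdivlMr ?mulr_gt0.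
pose Kf := K * (L + 9 * L ^+ 2) + 3 * (K * L) ^+ 2 / c.
exists eta, Kf; split => //.
  by rewrite addr_gt0 // ?divr_gt0 ?mulr_gt0 ?addr_gt0 ?exprn_gt0 ?mulr_gt0 ?exprn_gt0.
clearbody eta.
move=> d V wk w1 s hV hb vmax hk h1 hs.
have {}red := red d V wk hV hb.
have [k1 k2 k3] := etaP _ hk; have [l1 l2 l3] := etaP _ h1; have [s1 s2 s3] := etaP _ hs.
have {}red := red k1.
have d1 : `|w1 - wk| <= 1.
  have -> : w1 - wk = (w1 - ws) - (wk - ws) by ring.
  by apply: le_trans (ler_normB _ _) _; move: k2 l2; clear; lra.
have t1 : `|s| <= 1.
  have -> : s = (w1 + s - ws) - (w1 - ws) by ring.
  by apply: le_trans (ler_normB _ _) _; move: s2 l2; clear; lra.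
set h := tfR A B C w1; set h' := tfR A B C (w1 + s).
pose v := tfR_red A B C V w1; pose v' := tfR_red A B C V (w1 + s).
set t := `|s| in t1 *; have t0 : 0 <= t by exact: normr_ge0.
set q := `|w1 - wk| ^+ 2; have q0 : 0 <= q by exact: sqr_ge0.
have q1 : q <= 1 by rewrite /q exprn_ile1.
have ww : w1 + s - w1 = s by ring.
have [red1 red2] := red _ _ l1 s1; have [red3 _] := red _ _ s1 l1.
have liph := lip _ _ l1 s1.
rewrite ww -/t -/v -/v' -/h -/h' in red1 red2 red3 liph.
have nball w : `|w - ws| < eta -> nrm (tfR A B C w - N0) < rho /\
  nrm (tfR_red A B C V w - N0) < rho.
  move=> hw; have [w1' w2' w3'] := etaP _ hw.
  have wsws : `|ws - ws| < eta1 by rewrite subrr normr0.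
  have hL := lip _ _ wsws w1'.
  have a0 := normr_ge0 (w - ws); have La := mulr_ge0 (ltW L0) a0.
  split; first by apply: le_lt_trans hL _; move: w3' La; clear; lra.
  have [hR _] := red _ _ w1' wsws.
  rewrite -(subrK (tfR A B C w) (tfR_red A B C V w)) -addrA.
  apply: le_lt_trans (nrmD _ _) _; apply: le_lt_trans (lerD hR hL) _.
  have dd : `|w - wk| <= `|w - ws| + `|wk - ws|.
    have -> : w - wk = (w - ws) - (wk - ws) by ring.
    exact: ler_normB.
  have dd1 : `|w - wk| ^+ 3 <= `|w - wk|.
    rewrite exprS ler_piMr // exprn_ile1 //.
    by move: dd w2' k2; clear; lra.
  have := ler_wpM2l (ltW L0) (le_trans dd1 dd).
  by move: w3' k3; rewrite mulrDr; clear; lra.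
have [[hN vN] [hN' vN']] := (nball _ h1, nball _ hs).
rewrite -/v -/v' -/h -/h' in hN vN hN' vN'.
have hJ : h *m Jmx m = Jmx p *m h by exact: cRJ.
have vle : kap Gam v' <= kap Gam v := vmax _.
clearbody h h' v v'; clear vmax.
(* The test weights are [g1], optimal for the full matrix at [w1], and [g2], optimal for the reduced
   one at [w1 + s]; [g3] and [g0] serve to compare [kap] at [h'] and at [v] with values at these. *)
have [g1 g1m e1] := kap_minimizes h p0 m0 G0 G1.
have [g2 g2m e2] := kap_minimizes v' p0 m0 G0 G1.
have [g0 g0m e0] := kap_minimizes v p0 m0 G0 G1.
have [g3 g3m e3] := kap_minimizes h' p0 m0 G0 G1.
have n1 : nrm (v - h) <= L * q.
  apply: le_trans red1 _; rewrite ler_wpM2l ?(ltW L0) //.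
  by rewrite exprSr ler_piMr // exprn_ge0.
rewrite -/q in red2; clearbody q t.
pose E := q + t.
have E0 : 0 <= E by rewrite addr_ge0.
have Lt0 : 0 <= L * t by rewrite mulr_ge0 // ltW.
have Lq0 : 0 <= L * q by rewrite mulr_ge0 // ltW.
have Ltq : L * t * q <= L * q by rewrite mulrAC ler_piMr.
have Ltq' : L * t * q <= L * t by rewrite ler_piMr.
have Ltt : L * t * t <= L * t by rewrite ler_piMr.
have n3 : nrm (h' - v') <= 2 * L * E.
  rewrite nrmBC -(subrK (v - h) (v' - h')); apply: le_trans (nrmD _ _) _.
  apply: le_trans (lerD red2 n1) _; rewrite /E.
  by move: Lt0 Lq0 Ltq Ltt; clear; lra.
have n4 : nrm (h - v) <= L * q by rewrite nrmBC.
have n5 : nrm (v' - v) <= 3 * L * t.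
  have -> : v' - v = (h' - h) + ((v' - h') - (v - h)) by mxring.
  apply: le_trans (nrmD _ _) _; apply: le_trans (lerD liph red2) _.
  by move: Lt0 Lq0 Ltq' Ltt; clear; lra.
have g1e := near _ _ hN g1m; have g2e := near _ _ vN' g2m.
have [g1O g2O] := (proj1 g1m, proj1 g2m).
apply: le_trans (_ : lam2 (Tg g1 h') - lam2 (Tg g1 h) <= _).
  apply: lerB; last by rewrite -e1 lexx.
  by rewrite e3; apply: (proj2 g3m).
have a1 : `|(lam2 (Tg g2 h') - lam2 (Tg g2 h)) - (lam2 (Tg g2 v') - lam2 (Tg g2 v))| <=
    K * (L * (t * E) + 3 * L * t * (3 * L * E)).
  apply: le_trans (same g2 h' h v' v g2O g2e hN' hN vN' vN) _.
  rewrite ler_wpM2l ?(ltW K0) //; apply: lerD.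
    have -> : (h' - h) - (v' - v) = - ((v' - h') - (v - h)) by mxring.
    by rewrite nrmN.
  apply: ler_pM; rewrite ?addr_ge0 ?nrm_ge0 //.
  apply: le_trans (lerD n3 n4) _.
  by rewrite /E; move: Lt0 Lq0; clear; lra.
(* The maximizing property of [w1] enters here: the value at [v'] and [g2] is [kap Gam v' ^+ 2],
   which is at most [kap Gam v ^+ 2], and this is at most the value at [v] and [g2]. *)
have a2 : lam2 (Tg g2 v') <= lam2 (Tg g2 v).
  rewrite -e2; apply: le_trans (_ : kap Gam v ^+ 2 <= _).
    by rewrite ler_pXn2r ?nnegrE ?kap_ge0.
  by rewrite e0; apply: (proj2 g0m).
have a3 := growth _ _ g2 hJ hN g1m g2O.
have a4 : lam2 (Tg g2 v') <= lam2 (Tg g1 v') by apply: (proj2 g2m).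
have a5 : `|(lam2 (Tg g2 h) - lam2 (Tg g2 v')) - (lam2 (Tg g1 h) - lam2 (Tg g1 v'))| <=
    K * (3 * L * E * `|g2 - g1|).
  apply: le_trans (mixed g2 g1 h v' g2O g1O g2e g1e hN vN') _.
  rewrite ler_wpM2l ?(ltW K0) // ler_wpM2r //.
  rewrite -(subrK h' h) -addrA; apply: le_trans (nrmD _ _) _.
  rewrite (nrmBC h); apply: le_trans (lerD liph n3) _.
  by rewrite /E; move: Lt0 Lq0; clear; lra.
have a6 : `|(lam2 (Tg g1 h') - lam2 (Tg g1 h)) - (lam2 (Tg g2 h') - lam2 (Tg g2 h))| <=
    K * (L * t * `|g2 - g1|).
  rewrite (distrC g2); apply: le_trans (mixed g1 g2 h' h g1O g2O g1e g2e hN' hN) _.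
  by rewrite ler_wpM2l ?(ltW K0) // ler_wpM2r.
exact: increment_arith (ltW K0) (ltW L0) c0 t0 a1 a2 a3 a4 a5 a6 E0.
Qed.

(** Steps with the sign of the derivative are taken and shrunk, which removes the term [K * |s|].
    The inequality [2 * f x * (f (x + s) - f x) <= f (x + s) ^+ 2 - f x ^+ 2] does the work of
    differentiating the square. *)
Lemma derivative_from_increments (R : realType) (f : R -> R) (x K d r : R) :
  derivable f x 1 -> 0 <= f x -> 0 < K -> 0 < r ->
  (forall s, `|s| < r -> f (x + s) ^+ 2 - f x ^+ 2 <= K * ((d + `|s|) * `|s|)) ->
  2 * f x * `|derive1 f x| <= K * d.
Proof.
move=> df fx0 K0 r0 incr; apply/ler_addgt0Pl => e e0.
(* With this [u] one has [2 * f x * (e / u) <= e / 2]; the other half of [e] pays for [K * t]. *)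
pose u := 4 * f x + 1; have u0 : 0 < u by rewrite ltr_wpDl // mulr_ge0.
have [r1 r10 approx] := derivable_approx df (divr_gt0 e0 u0).
pose t := Num.min (Num.min r r1 / 2) (e / (2 * K)).
have m0 : 0 < Num.min r r1 by rewrite lt_min r0.
have t0 : 0 < t by rewrite lt_min !divr_gt0 // mulr_gt0.
have tm : t <= Num.min r r1 / 2 by rewrite ge_min lexx.
have tr : t < Num.min r r1 by move: tm m0; clear; lra.
have [tr0 tr1] : t < r /\ t < r1 by move: tr; rewrite lt_min => /andP[].
have tK : t * (2 * K) <= e.
  by rewrite -ler_pdivlMr ?mulr_gt0 // ge_min lexx orbT.
have [s hs hds] : exists2 s, `|s| = t & derive1 f x * s = `|derive1 f x| * t.
  have [d0|d0] := leP 0 (derive1 f x).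
    by exists t; rewrite ?(gtr0_norm t0) // ger0_norm.
  by exists (- t); rewrite ?normrN ?(gtr0_norm t0) // ltr0_norm // mulrN mulNr.
have h1 := incr s; rewrite hs in h1; have {}h1 := h1 tr0.
have h2 := approx s; rewrite hs hds in h2; have {h2} /ler_normlP[h2 _] := h2 tr1.
have h3 : 2 * f x * (f (x + s) - f x) <= f (x + s) ^+ 2 - f x ^+ 2.
  by have := sqr_ge0 (f (x + s) - f x); clear; nra.
set D := `|derive1 f x| in h2 *; set q := e / u in h2.
have h4 := ler_wpM2l (mulr_ge0 (ler0n R 2) fx0) h2.
have h5 : 2 * f x * (D - q) * t <= K * (d + t) * t.
  by move: h1 h3 h4; clear; lra.
rewrite ler_pM2r // in h5.
have h6 : 2 * f x * q <= e / 2.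
  have qu : q * u = e by rewrite /q divfK // gt_eqF.
  have q0 : 0 < q by rewrite divr_gt0.
  by move: qu q0; rewrite /u; clear; lra.
by move: h5 h6 tK; clear; lra.
Qed.

Lemma quadratic_rate (R : realType) (f : R -> R) (ws eta K : R) :
  (forall x, 0 <= f x) -> 0 < f ws -> (\forall w \near ws, f w <= f ws) ->
  (\forall w \near ws, derivable f w 1) -> derivable (derive1 f) ws 1 ->
  derive1 (derive1 f) ws != 0 -> 0 < eta -> 0 < K ->
  exists eta' c : R, [/\ 0 < eta', 0 < c & forall wk w1,
    `|wk - ws| < eta' -> `|w1 - ws| < eta' ->
    (forall s, `|w1 + s - ws| < eta ->
      f (w1 + s) ^+ 2 - f w1 ^+ 2 <= K * ((`|w1 - wk| ^+ 2 + `|s|) * `|s|)) ->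
    `|w1 - ws| <= c * `|wk - ws| ^+ 2].
Proof.
move=> f0 fws locmax dfn ddf; set H := derive1 (derive1 f) ws => H0 eta0 K0.
have df : derivable f ws 1 by exact: nbhs_singleton dfn.
have dws := derivative_local_max df locmax.
have nH : 0 < `|H| by rewrite normr_gt0.
have [r1 r10 a1] := derivable_approx ddf (divr_gt0 nH (ltr0n R 2)).
have [r2 r20 a2] := derivable_approx df ltr01.
have [r3 /= r30 dfn'] := (nbhs_ballP _ _).1 dfn.
pose b := f ws * `|H|; have b0 : 0 < b by rewrite mulr_gt0.
(* The bound [b / (8 * K)] absorbs the term [2 * K * x ^+ 2], which comes from splitting [|w1 - wk|]
   into [x] and [y], into half of [b / 2 * x]; what remains is [b / 4 * x <= 2 * K * y ^+ 2]. The
   bound [f ws / 2] keeps [f w1] at least half of [f ws]. *)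
pose eta' := Num.min (Num.min (Num.min r1 r2) (Num.min r3 (f ws / 2)))
  (Num.min eta (b / (8 * K))).
exists eta', (8 * K / b); split.
- by rewrite !lt_min r10 r20 r30 eta0 !divr_gt0 // mulr_gt0.
- by rewrite divr_gt0 // mulr_gt0.
move=> wk w1; rewrite !lt_min => /andP[_ /andP[_ hk]].
move=> /andP[/andP[/andP[h1 h2] /andP[h3 h4]] /andP[h5 h6]] incr.
rewrite ltr_pdivlMr ?mulr_gt0 // in hk; rewrite ltr_pdivlMr ?mulr_gt0 // in h6.
have dw1 : derivable f w1 1 by apply: dfn'; rewrite /ball /= distrC.
have we : ws + (w1 - ws) = w1 by rewrite addrC subrK.
have := a1 _ h1; rewrite we dws subr0 -/H => A1.
have := a2 _ h2; rewrite we dws mul0r subr0 mul1r => /ler_normlP[A2 _].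
have eta2 : 0 < eta - `|w1 - ws| by rewrite subr_gt0.
have D1 := @derivative_from_increments _ f w1 K (`|w1 - wk| ^+ 2) _ dw1 (f0 w1) K0 eta2.
have {}D1 : 2 * f w1 * `|derive1 f w1| <= K * `|w1 - wk| ^+ 2.
  apply: D1 => s hs; apply: incr.
  rewrite addrAC; apply: le_lt_trans (ler_normD _ _) _; move: hs; clear; lra.
have D2 : `|H| / 2 * `|w1 - ws| <= `|derive1 f w1|.
  have := ler_normD (derive1 f w1) (H * (w1 - ws) - derive1 f w1).
  rewrite (addrC (derive1 f w1)) subrK normrM (distrC (H * _)); move: A1; clear; lra.
set x := `|w1 - ws| in h6 h4 D2 A2 *; set y := `|wk - ws|.
have x0 : 0 <= x by exact: normr_ge0.
have fw1 : f ws <= 2 * f w1 by move: A2 h4; clear; lra.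
have D3 : f ws * (`|H| / 2 * x) <= 2 * f w1 * `|derive1 f w1|.
  by apply: ler_pM; rewrite ?(ltW fws) // mulr_ge0 // divr_ge0.
have tri : `|w1 - wk| <= x + y.
  have -> : w1 - wk = (w1 - ws) - (wk - ws) by ring.
  exact: ler_normB.
have D4 : `|w1 - wk| ^+ 2 <= 2 * x ^+ 2 + 2 * y ^+ 2.
  apply: le_trans (_ : (x + y) ^+ 2 <= _).
    by rewrite ler_pXn2r ?nnegrE ?addr_ge0 ?normr_ge0.
  by have := sqr_ge0 (x - y); clear; nra.
have D5 := ler_wpM2l (ltW K0) D4.
have D6 : x * (8 * K) * x <= b * x by rewrite ler_wpM2r // ltW.
have D7 : f ws * (`|H| / 2 * x) = b / 2 * x by rewrite /b; ring.
rewrite D7 in D3; rewrite mulrAC ler_pdivlMr //.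
by move: (le_trans D3 (le_trans D1 D5)) D6; clear; lra.
Qed.

(** Supplies the positivity that simplicity of a singular value does not give: with maximum 0 the
    nonnegative [f] would vanish near [x], and both derivatives with it. *)
Lemma local_max_gt0 (R : realType) (f : R -> R) (x : R) :
  (forall y, 0 <= f y) -> (\forall y \near x, f y <= f x) ->
  (\forall y \near x, derivable f y 1) -> derivable (derive1 f) x 1 ->
  derive1 (derive1 f) x != 0 -> 0 < f x.
Proof.
move=> f0 fmax df ddf; apply: contraNT; rewrite -leNgt => fx.
have fy y : f y <= f x -> f y = 0 by move=> ?; apply/le_anti; rewrite f0 (le_trans _ fx).
have df0 : \forall y \near x, derive1 f y = 0.
  near=> y; apply: derivative_local_max; first by near: y.
  have : \forall z \near y, f z <= f x by near: y; exact: nbhs_interior fmax.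
  by apply: filterS => z /fy ->; exact: f0.
have f'x := nbhs_singleton df0; apply/eqP; apply: derivative_local_max ddf _.
by apply: filterS df0 => y ->; rewrite f'x.
Unshelve. all: by end_near.
Qed.

(** * From a run of the algorithm to the estimates *)

Lemma run_interpolates (R : realType) n m p (A : 'M[R]_n) (B : 'M[R]_(n, m))
    (C : 'M[R]_(p, n)) Gam k w (d : nat -> nat) (V : forall j, 'M[R[i]]_(n, d j)) :
  (2 <= k)%N -> algorithm_run A B C Gam k w V -> interpolates A B (V k) (w k).
Proof.
case: k => [|[|k]] // _ [_ step units _].
(* The Krylov block at [w k] enters the basis through the second clause with index [k - 1], which is
   why [2 <= k] is asked. *)
have [V_orth /andP[_ sub]] := step k.+1 (ltnSn _); split => //.
  by apply: units => /=; rewrite leqnn.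
by move: sub; rewrite tr_row_mx col_mx_sub => /andP[].
Qed.

Lemma lam2_le (R : realType) q r q' r' (T : 'M[R]_(q, r)) (T' : 'M[R]_(q', r')) :
  (lam2 T <= lam2 T') = (singval (cplxmx T) 2 <= singval (cplxmx T') 2).
Proof. by rewrite /lam2 ler_pXn2r ?nnegrE ?singval_ge0. Qed.

(** If a dimension is 0, the list of singular values is empty and no value has multiplicity one. *)
Lemma simple_singval_dim (R : realType) q r (M : 'M[R[i]]_(q, r)) s :
  simple_singval M s -> (0 < q)%N /\ (0 < r)%N.
Proof.
move=> simp; apply/andP; rewrite -leq_min lt0n; apply/eqP => z.
by move: simp; rewrite /simple_singval /singvals z take0.
Qed.

Theorem theorem3p7 (R : realType) (n m p : nat)
    (A : 'M[R]_n) (B : 'M[R]_(n, m)) (C : 'M[R]_(p, n)) (Gam : R)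
    (stableA : stable A) (Gam_gt0 : 0 < Gam) (Gam_lt1 : Gam < 1)
    (ws gs : R)
    (* a global maximizer is in particular a local one *)
    (ws_locmax : \forall w \near ws, mu A B C Gam w <= mu A B C Gam ws)
    (gs_argmin : argmin (Omega Gam) (sigma A B C 2 ws) = [set gs])
    (ws_neq0 : ws != 0) (gs_neq1 : gs != 1)
    (sigma2_simple :
      simple_singval (cplxmx (Tmx A B C ws gs)) (sigma A B C 2 ws gs))
    (* mu'' exists at ws and is nonzero; [derive1] alone is total *)
    (mu_derivable : \forall w \near ws, derivable (mu A B C Gam) w 1)
    (dmu_derivable : derivable (mu A B C Gam)^`() ws 1)
    (d2mu_neq0 : (mu A B C Gam)^`(2) ws != 0)
    (beta : R) (beta_gt0 : 0 < beta) :
  exists eta c : R, [/\ 0 < eta, 0 < c &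
    forall (k : nat) (w : nat -> R) (d : nat -> nat)
           (V : forall j, 'M[R[i]]_(n, d j)),
      (2 <= k)%N ->
      algorithm_run A B C Gam k w V ->
      `|w k.-1 - ws| < eta -> `|w k - ws| < eta -> `|w k.+1 - ws| < eta ->
      w k != ws ->
      beta <= singval_min ((0 +i* ws)%:M - redA A (V k)) ->
      `|w k.+1 - ws| / `|w k - ws| ^+ 2 <= c].
Proof.
pose h := tfR A B C.
have [p0 m0] : (0 < p)%N /\ (0 < m)%N.
  by have := simple_singval_dim sigma2_simple; rewrite !addn_gt0 !orbb.
have sigmaE w : sigma A B C 2 w = fun g => singval (cplxmx (Tg g (h w))) 2.
  by apply/funext => g; rewrite /sigma /ssSigma ssT_Tg.
have muE : mu A B C Gam = fun w => kap Gam (h w).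
  by apply/funext => w; exact: ssMu_kap.
rewrite !muE in ws_locmax mu_derivable dmu_derivable d2mu_neq0.
have argminE : argmin (Omega Gam) (fun g => singval (cplxmx (Tg g (h ws))) 2) = [set gs].
  by rewrite -sigmaE.
have gs_in (g : R) : (Gam <= g <= 1 /\ forall y, Gam <= y <= 1 ->
    singval (cplxmx (Tg g (h ws))) 2 <= singval (cplxmx (Tg y (h ws))) 2) <-> g = gs.
  exact: (eq_ind _ (fun D : set R => D g <-> g = gs) (iff_refl _) _ (esym argminE)).
have [gsO gsmin] := (gs_in gs).2 erefl.
have gsO' : Gam <= gs < 1 by case/andP: gsO => -> gs1; rewrite lt_neqAle gs_neq1.
have uniq_min g : Gam <= g <= 1 -> g != gs ->
    lam2 (Tg gs (h ws)) < lam2 (Tg g (h ws)).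
  move=> gO; apply: contraNT; rewrite -leNgt lam2_le => le_g.
  apply/eqP; apply: (gs_in g).1; split; first exact: gO.
  by move=> y yO; exact: le_trans le_g (gsmin y yO).
have kap_h0 w : 0 <= kap Gam (h w).
  exact: kap_ge0 _ p0 m0 Gam_gt0 (ltW Gam_lt1).
have mu_gt0 := local_max_gt0 kap_h0 ws_locmax mu_derivable dmu_derivable d2mu_neq0.
have kap_ws : kap Gam (h ws) = singval (cplxmx (Tg gs (h ws))) 2.
  have [g [gO -> gm]] := kap_min (h ws) p0 m0 Gam_gt0 (ltW Gam_lt1).
  suff -> : g = gs by [].
  apply: (gs_in g).1; split; first exact: gO.
  by move=> y yO; rewrite -lam2_le; exact: gm yO.
have simp : simple_singval (cplxmx (Tg gs (h ws))) (singval (cplxmx (Tg gs (h ws))) 2).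
  by move: sigma2_simple; rewrite sigmaE /Tmx ssT_Tg.
have pos : 0 < lam2 (Tg gs (h ws)) by rewrite /lam2 -kap_ws exprn_gt0.
have [eta1 [K [eta1_gt0 K_gt0 incr]]] :=
  increment_bound stableA beta_gt0 p0 m0 Gam_gt0 gsO' simp pos uniq_min.
have [eta2 [c [eta2_gt0 c_gt0 rate]]] := quadratic_rate kap_h0 mu_gt0 ws_locmax
  mu_derivable dmu_derivable d2mu_neq0 eta1_gt0 K_gt0.
exists (Num.min eta1 eta2), c; split; [by rewrite lt_min eta1_gt0 | exact: c_gt0 |].
move=> k w d V k2 run _; rewrite !lt_min => /andP[hk1 hk2] /andP[hw1 hw2] wkN gap.
have wk_gt0 : 0 < `|w k - ws| by rewrite normr_gt0 subr_eq0; exact: wkN.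
rewrite (ler_pdivrMr _ _ (exprn_gt0 2 wk_gt0)); apply: rate hk2 hw2 _ => s hs.
apply: incr (run_interpolates k2 run) gap _ hk1 hw1 hs.
have mu_redE : mu_red A B C (V k) Gam = fun u => kap Gam (tfR_red A B C (V k) u).
  by apply/funext => u; exact: ssMu_kap.
have kk : (1 <= k <= k)%N by rewrite leqnn andbT ltnW.
by case: run => _ _ _ /(_ k kk); rewrite mu_redE; exact.
Qed.
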